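(* Let $u,d$ be positive integers with $u<d/2$ and $\gcd(u,d)=1$, and let $\mathbb K$ be a field. With the notation of the context, the map $\Phi_3$ in the minimal bigraded free resolution $0\to F_3\xrightarrow{\Phi_3}F_2\xrightarrow{\Phi_2}F_1\xrightarrow{\Phi_1}S\xrightarrow{\Phi_0}\mathrm{Rees}(\mathcal I)\to0$ of the $S$-module $\mathrm{Rees}(\mathcal I)$ (with $\Phi_1(\mathbf e_n)=F_{n,b_n}$ and $\Phi_2(\mathbf e_{n,k})=\mathbf s_{n,k}$) can be made explicit as $$\Phi_3:\ \bigoplus_{n=1}^{q-1}S\big(-(b_n,|\sigma_n-\tau_n|+2|\sigma_{m_{\ell(n)}}-\tau_{m_{\ell(n)}}|)\big)\to\bigoplus_{n=1}^{q}S\big(-(b_n,|\sigma_n-\tau_n|+|\sigma_{m_{\ell(n)}}-\tau_{m_{\ell(n)}}|)\big)^2,\qquad \mathbf e_{n,\rho(n),\ell(n)}\mapsto\mathbf s_{n,\rho(n),\ell(n)},$$ where $\{\mathbf e_{n,\rho(n),\ell(n)}\}_{n=1,\dots,q-1}$ is the canonical basis of the source. Moreover, $\mathcal F_2=\{\mathbf s_{n,\rho(n),\ell(n)}\}_{n=1,\dots,q-1}$ is a Gröbner basis of $\ker(\Phi_2)\subset S^{2q}$ with respect to $\prec_{l,\mathcal F_1}$. This set is also $S$-linearly independent (in particular, a minimal set of generators of this module).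
   Context: Setting: $R=\mathbb K[T_0,T_1]$, $S=\mathbb K[T_0,T_1,X_0,X_1,X_2]$, $\mathcal I=\langle T_0^d,\,T_0^{d-u}T_1^u,\,T_1^d\rangle\subset R$, $\mathrm{Rees}(\mathcal I)=\bigoplus_{n\ge0}\mathcal I^nZ^n\subset R[Z]$. $\Phi_0:S\to\mathrm{Rees}(\mathcal I)$ is the surjective $\mathbb K$-algebra morphism with $T_i\mapsto T_i$, $X_0\mapsto ZT_0^d$, $X_1\mapsto ZT_0^{d-u}T_1^u$, $X_2\mapsto ZT_1^d$; $\mathrm{Rees}(\mathcal I)$ is an $S$-module through $\Phi_0$. Bigrading: $\mathrm{bideg}(T_i)=(1,0)$, $\mathrm{bideg}(X_j)=(0,1)$, $\mathrm{bideg}(Z)=(-d,1)$; $S(a,b)_{(k,l)}=S_{(a+k,b+l)}$. Euclidean data: $a_0=d-u$, $a_1=u$, and for $1\le i\le p-1$, $a_{i-1}=q_ia_i+a_{i+1}$ with $0\le a_{i+1}<a_i$, where $p$ is such that $a_p=0$. Put $q=\sum_{i=1}^{p-1}q_i$, $m_\ell=1+\sum_{j=1}^{\ell}q_j$ for $0\le\ell\le p-1$, $m_p=q+2$. For $1\le n\le q$, $\ell(n)$ is the unique $\ell$ with $m_{\ell-1}\le n<m_\ell$, and $\rho(n)=n+1$ if $n+1<m_{\ell(n)}$, $\rho(n)=m_{\ell(n)+1}$ if $n+1=m_{\ell(n)}$. Slow Euclidean Remainder Sequence: $(b_1,c_1)=(d-u,u)$, $(\sigma_1,\tau_1,\alpha_1,\beta_1)=(0,1,1,0)$,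 and for $1\le n\le q$: if $b_n-c_n\ge c_n$, then $(b_{n+1},c_{n+1})=(b_n-c_n,c_n)$ and $(\sigma_{n+1},\tau_{n+1},\alpha_{n+1},\beta_{n+1})=(\sigma_n-\alpha_n,\tau_n-\beta_n,\alpha_n,\beta_n)$; if $b_n-c_n<c_n$, then $(b_{n+1},c_{n+1})=(c_n,b_n-c_n)$ and $(\sigma_{n+1},\tau_{n+1},\alpha_{n+1},\beta_{n+1})=(\alpha_n,\beta_n,\sigma_n-\alpha_n,\tau_n-\beta_n)$. Moreover $b_{q+2}=0$ and $(\sigma_{q+2},\tau_{q+2})=(d-u,-u)$ by convention. Polynomials: for $1\le n\le q+1$, $F_{n,b_n}=T_0^{b_n}X_0^{-\sigma_n}X_2^{\tau_n}-T_1^{b_n}X_1^{\tau_n-\sigma_n}$ if $\sigma_n\le0$, and $F_{n,b_n}=T_0^{b_n}X_1^{\sigma_n-\tau_n}-T_1^{b_n}X_0^{\sigma_n}X_2^{-\tau_n}$ if $\sigma_n>0$; $F_{q+2,0}=X_0^{d-u}X_2^u-X_1^d$ if $\sigma_q>0$, $F_{q+2,0}=X_1^d-X_0^{d-u}X_2^u$ if $\sigma_q<0$ (always $\sigma_q\ne0$). $\mathcal F_0=(F_{n,b_n})_{n=1,\dots,q+2}$; $\Phi_1:S^{q+2}\to S$, $\mathbf e_n\mapsto F_{n,b_n}$. First syzygies in $S^{q+2}$ (canonical basis $\mathbf e_1,\dots,\mathbf e_{q+2}$). For $1\le n\le q-1$, write $m=m_{\ell(n)}$, $\rho=\rho(n)$: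 - if $\sigma_n\le0$: $\mathbf s_{n,\rho}=X_0^{\sigma_m}X_2^{-\tau_m}\mathbf e_n-T_0^{b_m}\mathbf e_\rho-T_1^{b_\rho}X_1^{\tau_n-\sigma_n}\mathbf e_m$ and $\mathbf s_{n,m}=X_1^{\sigma_m-\tau_m}\mathbf e_n-T_0^{b_\rho}X_0^{-\sigma_n}X_2^{\tau_n}\mathbf e_m-T_1^{b_m}\mathbf e_\rho$; - if $\sigma_n>0$: $\mathbf s_{n,\rho}=X_1^{\tau_m-\sigma_m}\mathbf e_n-T_0^{b_m}\mathbf e_\rho-T_1^{b_\rho}X_0^{\sigma_n}X_2^{-\tau_n}\mathbf e_m$ and $\mathbf s_{n,m}=X_0^{-\sigma_m}X_2^{\tau_m}\mathbf e_n-T_0^{b_\rho}X_1^{\sigma_n-\tau_n}\mathbf e_m-T_1^{b_m}\mathbf e_\rho$. If $\sigma_q<0$: $\mathbf s_{q,q+1}=X_1^{\sigma_{q+1}-\tau_{q+1}}\mathbf e_q-X_0^{-\sigma_q}X_2^{\tau_q}\mathbf e_{q+1}+T_1\mathbf e_{q+2}$; if $\sigma_q>0$: $\mathbf s_{q,q+1}=X_0^{-\sigma_{q+1}}X_2^{\tau_{q+1}}\mathbf e_q-X_1^{\sigma_q-\tau_q}\mathbf e_{q+1}+T_1\mathbf e_{q+2}$. If $\sigma_{q+1}\le0$: $\mathbf s_{q+1,q+2}=X_0^{\sigma_q}X_2^{-\tau_q}\mathbf e_{q+1}-T_0\mathbf e_{q+2}-X_1^{\tau_{q+1}-\sigma_{q+1}}\mathbf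 e_q$; if $\sigma_{q+1}>0$: $\mathbf s_{q+1,q+2}=X_1^{\tau_q-\sigma_q}\mathbf e_{q+1}-T_0\mathbf e_{q+2}-X_0^{\sigma_{q+1}}X_2^{-\tau_{q+1}}\mathbf e_q$. $\mathcal F_1=\{\mathbf s_{q,q+1},\mathbf s_{q+1,q+2}\}\cup\{\mathbf s_{n,m_{\ell(n)}},\mathbf s_{n,\rho(n)}\}_{1\le n\le q-1}$ has $2q$ elements; the canonical basis of $S^{2q}$ is denoted $\{\mathbf e_{n,k}\}$, indexed by the pairs $(n,k)$ with $\mathbf s_{n,k}\in\mathcal F_1$, and $\Phi_2:S^{2q}\to S^{q+2}$, $\mathbf e_{n,k}\mapsto\mathbf s_{n,k}$. Bidegrees: $\mathrm{bideg}(\mathbf e_{n,\rho(n)})=\mathrm{bideg}(\mathbf e_{n,m_{\ell(n)}})=(b_n,|\sigma_n-\tau_n|+|\sigma_{m_{\ell(n)}}-\tau_{m_{\ell(n)}}|)$ for $n\le q-1$, and $\mathrm{bideg}(\mathbf e_{q,q+1})=\mathrm{bideg}(\mathbf e_{q+1,q+2})=(1,d)$. Second syzygies in $S^{2q}$: for $1\le n\le q-1$, with $m=m_{\ell(n)}$, $\rho=\rho(n)$, and with the convention that the symbol $\mathbf e_{q,q+2}$ (which occurs only for $n=q-1$, as $\mathbf e_{\rho(n),\rho(n+1)}$) stands for $-\mathbf e_{q+1,q+2}$: - if $\sigma_n\le0$, $\rho(n)=n+1$: $\mathbf s_{n,\rho(n),\ell(n)}=X_1^{\sigma_m-\tau_m}\mathbf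 e_{n,\rho}-X_0^{\sigma_m}X_2^{-\tau_m}\mathbf e_{n,m}+T_0^{b_m}\mathbf e_{n+1,m}-T_1^{b_m}\mathbf e_{n+1,\rho(n+1)}$; - if $\sigma_n\le0$, $\rho(n)=m_{\ell(n)+1}$: $\mathbf s_{n,\rho(n),\ell(n)}=X_0^{\sigma_m}X_2^{-\tau_m}\mathbf e_{n,m}-X_1^{\sigma_m-\tau_m}\mathbf e_{n,\rho}+T_0^{b_\rho}\mathbf e_{n+1,\rho}-T_1^{b_\rho}\mathbf e_{n+1,\rho(n+1)}$; - if $\sigma_n>0$, $\rho(n)=n+1$: $\mathbf s_{n,\rho(n),\ell(n)}=X_0^{-\sigma_m}X_2^{\tau_m}\mathbf e_{n,\rho}-X_1^{\tau_m-\sigma_m}\mathbf e_{n,m}+T_0^{b_m}\mathbf e_{n+1,m}-T_1^{b_m}\mathbf e_{n+1,\rho(n+1)}$; - if $\sigma_n>0$, $\rho(n)=m_{\ell(n)+1}$: $\mathbf s_{n,\rho(n),\ell(n)}=X_1^{\tau_m-\sigma_m}\mathbf e_{n,m}-X_0^{-\sigma_m}X_2^{\tau_m}\mathbf e_{n,\rho}+T_0^{b_\rho}\mathbf e_{n+1,\rho}-T_1^{b_\rho}\mathbf e_{n+1,\rho(n+1)}$. Orders: $\prec_l$ is the lexicographic order on the monomials of $S$ with $X_2\prec_lX_1\prec_lX_0\prec_lT_1\prec_lT_0$ if $\sigma_q>0$, and $X_2\prec_lX_0\prec_lX_1\prec_lT_1\prec_lT_0$ if $\sigma_q\le0$. Given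 a sequence $\mathcal F=(\mathbf f_1,\dots,\mathbf f_t)$ of nonzero vectors in $S^k$ and a term order $\prec$ on $S^k$, the induced order $\prec_{\mathcal F}$ on $S^t$ is: $M\mathbf e_i\prec_{\mathcal F}M'\mathbf e_j$ iff $\mathrm{lm}(M\mathbf f_i)\prec\mathrm{lm}(M'\mathbf f_j)$, or these are equal and $j<i$. $\prec_{l,\mathcal F_0}$ is the order on $S^{q+2}$ induced by $\prec_l$ and $\mathcal F_0$, and $\prec_{l,\mathcal F_1}$ is the order on $S^{2q}$ induced by $\prec_{l,\mathcal F_0}$ and $\mathcal F_1$, the elements $\mathbf s_{n,k}$ of $\mathcal F_1$ being listed by increasing lexicographic order of $(n,k)$. *)

(* Defs.v *)
From HB Require Import structures.
From mathcomp Require Import all_boot all_order all_algebra.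
From mathcomp.multinomials Require Import freeg mpoly.

Set Implicit Arguments.
Unset Strict Implicit.
Unset Printing Implicit Defensive.

Import Order.TTheory GRing.Theory.

Local Open Scope ring_scope.

(* -------------------------------------------------------------------- *)
(* Combinatorial data attached to (u, d).  All sequences keep their
   mathematical indexing (starting at 1 for the remainder sequence), through functions
   on nat whose values outside the relevant range are irrelevant.         *)

Section EuclideanData.

Variables u d : nat.

(* (a_i, a_{i+1}) *)
Fixpoint euclid_pair (i : nat) : nat * nat :=
  if i is j.+1 then
    let: (x, y) := euclid_pair j in (y, (x %% y)%N)
  else ((d - u)%N, u).

Definition a_ (i : nat) : nat := (euclid_pair i).1.

Definition q_ (i : nat) : nat := (a_ i.-1 %/ a_ i)%N.

(* The least p with a_p = 0.  As a_{i+1} < a_i while a_i > 0 (i >= 1), one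
   has p <= u + 1 and the bounded search succeeds. *)
Definition p_ : nat := find (fun i => a_ i == 0%N) (iota 0 u.+2).

Definition q : nat := (\sum_(1 <= i < p_) q_ i)%N.

Definition m_ (l : nat) : nat :=
  if (l < p_)%N then (\sum_(1 <= j < l.+1) q_ j).+1%N else q.+2.

Definition ell (n : nat) : nat :=
  head 0%N [seq l <- iota 1 p_.-1 | (m_ l.-1 <= n)%N && (n < m_ l)%N].

Definition rho (n : nat) : nat :=
  if (n.+1 < m_ (ell n))%N then n.+1 else m_ (ell n).+1.

(* m_{l(n)} *)
Definition mm (n : nat) : nat := m_ (ell n).

Record sers_state := SersState {
  st_b : nat; st_c : nat;
  st_sigma : int; st_tau : int; st_alpha : int; st_beta : int }.

Definition sers_init : sers_state := SersState (d - u) u 0 1 1 0.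

Definition sers_step (x : sers_state) : sers_state :=
  let: SersState b c s t al be := x in
  if (c <= b - c)%N then SersState (b - c) c (s - al) (t - be) al be
  else SersState c (b - c) al be (s - al) (t - be).

Definition sers (n : nat) : sers_state := iter n.-1 sers_step sers_init.

Definition b_ (n : nat) : nat := if n == q.+2 then 0%N else st_b (sers n).
Definition sigma (n : nat) : int :=
  if n == q.+2 then (d - u)%N%:Z else st_sigma (sers n).
Definition tau (n : nat) : int :=
  if n == q.+2 then - u%:Z else st_tau (sers n).

(* The pairs (n, k) with s_{n,k} in F_1, in increasing lexicographic order;
   this list has 2q elements. *)
Definition pair_lex (x y : nat * nat) : bool :=
  (x.1 < y.1)%N || (x.1 == y.1) && (x.2 <= y.2)%N.

Definition pairs : seq (nat * nat) :=
  sort pair_lex ([seq (n, mm n) | n <- iota 1 q.-1]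
                 ++ [seq (n, rho n) | n <- iota 1 q.-1]
                 ++ [:: (q, q.+1); (q.+1, q.+2)]).

Definition pair_at (i : nat) : nat * nat := nth (0%N, 0%N) pairs i.

(* |sigma_n - tau_n| *)
Definition width (n : nat) : nat := absz (sigma n - tau n).

Definition deg_e1 (n : nat) : int * int := ((b_ n)%:Z, (width n)%:Z).

(* e_{q+1,q+2} is the second basis vector of the summand n = q. *)
Definition deg_e2 (nk : nat * nat) : int * int :=
  let n := minn nk.1 q in ((b_ n)%:Z, (width n + width (mm n))%N%:Z).

Definition deg_e3 (n : nat) : int * int :=
  ((b_ n)%:Z, (width n + 2 * width (mm n))%N%:Z).

End EuclideanData.

(* -------------------------------------------------------------------- *)
(* S = K[T0,T1,X0,X1,X2] and R = K[T0,T1].                                *)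

Definition iT0 : 'I_5 := @Ordinal 5 0 isT.
Definition iT1 : 'I_5 := @Ordinal 5 1 isT.
Definition iX0 : 'I_5 := @Ordinal 5 2 isT.
Definition iX1 : 'I_5 := @Ordinal 5 3 isT.
Definition iX2 : 'I_5 := @Ordinal 5 4 isT.

Definition jT0 : 'I_2 := @Ordinal 2 0 isT.
Definition jT1 : 'I_2 := @Ordinal 2 1 isT.

Section GeneralModules.

Variable K : fieldType.

Local Notation S := {mpoly K[5]}.
Local Notation R := {mpoly K[2]}.

(* Ideals and submodules are Prop-valued predicates. *)
Definition span (A : comNzRingType) (V : lmodType A) (P : V -> Prop) (v : V)
    : Prop :=
  exists (k : nat) (c : 'I_k -> A) (w : 'I_k -> V),
    (forall i, P (w i)) /\ v = \sum_(i < k) c i *: w i.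

Definition ideal_gen (A : comNzRingType) (G : seq A) (x : A) : Prop :=
  exists c : 'I_(size G) -> A, x = \sum_(i < size G) c i * G`_i.

Definition ideal_mul (A : comNzRingType) (I J : A -> Prop) (x : A) : Prop :=
  exists (k : nat) (y z : 'I_k -> A),
    [/\ forall i, I (y i), forall i, J (z i) & x = \sum_(i < k) y i * z i].

Fixpoint ideal_exp (A : comNzRingType) (I : A -> Prop) (n : nat) : A -> Prop :=
  if n is n'.+1 then ideal_mul I (ideal_exp I n') else fun _ => True.

(* The Rees algebra of I as a subset of A[Z]; Z is the variable 'X of
   {poly A}. *)
Definition rees (A : comNzRingType) (I : A -> Prop) (P : {poly A}) : Prop :=
  forall n, ideal_exp I n P`_n.

(* bideg(T_i) = (1,0), bideg(X_j) = (0,1). *)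
Definition mbideg (m : 'X_{1..5}) : int * int :=
  ((m iT0 + m iT1)%N%:Z, (m iX0 + m iX1 + m iX2)%N%:Z).

Definition bihomog (e : int * int) (p : S) : Prop :=
  forall m, m \in msupp p -> mbideg m = e.

(* Bihomogeneous elements of bidegree e of the free module
   \bigoplus_i S(- deg i), whose e-th component is
   \bigoplus_i S_{e - deg i}. *)
Definition bihomog_vec (k : nat) (deg : 'I_k -> int * int) (e : int * int)
    (v : 'rV[S]_k) : Prop :=
  forall i, bihomog (e - deg i) (v 0 i).

(* On R[Z], with bideg(T_i) = (1,0) and bideg(Z) = (-d,1). *)
Definition bihomog_RZ (d : nat) (e : int * int) (P : {poly R}) : Prop :=
  forall n m, m \in msupp P`_n -> ((mdeg m)%:Z - (d * n)%N%:Z, n%:Z) = e.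

(* A matrix A is identified with the map v |-> v *m A on row vectors, which
   sends the i-th canonical basis vector to the i-th row of A. *)
Definition bigraded_map (s t : nat) (degs : 'I_s -> int * int)
    (degt : 'I_t -> int * int) (A : 'M[S]_(s, t)) : Prop :=
  forall e v, bihomog_vec degs e v -> bihomog_vec degt e (v *m A).

(* Entries in the maximal ideal <T0,T1,X0,X1,X2>. *)
Definition minimal_map (s t : nat) (A : 'M[S]_(s, t)) : Prop :=
  forall i j, (A i j)@_0%MM = 0.

(* 0 -> S^n3 -> S^n2 -> S^n1 -> S -> M -> 0 is a minimal bigraded free
   resolution of the S-module M, where M is a subring of R[Z] which is an
   S-module through phi0. *)
Record minimal_bigraded_free_resolution (d n1 n2 n3 : nat)
    (M : {poly R} -> Prop) (phi0 : S -> {poly R})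
    (deg1 : 'I_n1 -> int * int) (phi1 : 'M[S]_(n1, 1))
    (deg2 : 'I_n2 -> int * int) (phi2 : 'M[S]_(n2, n1))
    (deg3 : 'I_n3 -> int * int) (phi3 : 'M[S]_(n3, n2)) : Prop := {
  res_graded0 : forall e f, bihomog e f -> bihomog_RZ d e (phi0 f);
  res_graded1 : bigraded_map deg1 (fun _ => (0, 0)) phi1;
  res_graded2 : bigraded_map deg2 deg1 phi2;
  res_graded3 : bigraded_map deg3 deg2 phi3;
  res_surj0 : forall P, M P <-> exists f, phi0 f = P;
  res_exact0 : forall f, phi0 f = 0 <-> exists v : 'rV_n1, v *m phi1 = f%:M;
  res_exact1 : forall v : 'rV_n1,
    v *m phi1 = 0 <-> exists w : 'rV_n2, w *m phi2 = v;
  res_exact2 : forall v : 'rV_n2,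
    v *m phi2 = 0 <-> exists w : 'rV_n3, w *m phi3 = v;
  res_inj3 : forall v : 'rV_n3, v *m phi3 = 0 -> v = 0;
  res_minimal1 : minimal_map phi1;
  res_minimal2 : minimal_map phi2;
  res_minimal3 : minimal_map phi3 }.

(* The monomial M e_i of S^k is encoded as the pair (M, i). *)
Definition vmonom_vec (k : nat) (t : 'X_{1..5} * 'I_k) : 'rV[S]_k :=
  'X_[t.1] *: delta_mx 0 t.2.

Definition vsupp (k : nat) (f : 'rV[S]_k) : seq ('X_{1..5} * 'I_k) :=
  [seq (m, i) | i <- enum 'I_k, m <- msupp (f 0 i)].

(* Leading monomial for the strict order lt; None if f = 0. *)
Definition lm (k : nat) (lt : rel ('X_{1..5} * 'I_k)) (f : 'rV[S]_k)
    : option ('X_{1..5} * 'I_k) :=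
  ohead [seq t <- vsupp f | all (fun t' => (t' == t) || lt t' t) (vsupp f)].

(* The order on S^t induced by lt and the rows of A. *)
Definition induced_order (t k : nat) (lt : rel ('X_{1..5} * 'I_k))
    (A : 'M[S]_(t, k)) : rel ('X_{1..5} * 'I_t) :=
  fun x y =>
    match lm lt ('X_[x.1] *: row x.2 A), lm lt ('X_[y.1] *: row y.2 A) with
    | Some lx, Some ly => lt lx ly || (lx == ly) && (y.2 < x.2)%N
    | _, _ => false
    end.

Definition lead_monomials (k : nat) (lt : rel ('X_{1..5} * 'I_k))
    (P : 'rV[S]_k -> Prop) (v : 'rV[S]_k) : Prop :=
  exists f t, [/\ P f, lm lt f = Some t & v = vmonom_vec t].

Definition groebner_basis (k : nat) (lt : rel ('X_{1..5} * 'I_k))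
    (N : 'rV[S]_k -> Prop) (G : seq 'rV[S]_k) : Prop :=
  (forall g, g \in G -> N g /\ g <> 0) /\
  (forall v, span (lead_monomials lt N) v
             <-> span (lead_monomials lt (fun g => g \in G)) v).

Definition generates (k : nat) (N : 'rV[S]_k -> Prop) (G : seq 'rV[S]_k)
    : Prop :=
  forall v, N v <-> span (fun g => g \in G) v.

Definition minimal_generators (k : nat) (N : 'rV[S]_k -> Prop)
    (G : seq 'rV[S]_k) : Prop :=
  generates N G /\
  (forall G' : seq 'rV[S]_k,
      {subset G' <= G} -> generates N G' -> {subset G <= G'}).

Definition linearly_independent (t k : nat) (s : 'I_t -> 'rV[S]_k) : Prop :=
  forall c : 'I_t -> S, \sum_(i < t) c i *: s i = 0 -> forall i, c i = 0.

End GeneralModules.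

(* -------------------------------------------------------------------- *)

Section ReesResolution.

Variables (K : fieldType) (u d : nat).

Local Notation S := {mpoly K[5]}.
Local Notation R := {mpoly K[2]}.

Definition T0 : S := 'X_iT0.
Definition T1 : S := 'X_iT1.
Definition X0 : S := 'X_iX0.
Definition X1 : S := 'X_iX1.
Definition X2 : S := 'X_iX2.

Definition idealI : R -> Prop :=
  ideal_gen [:: 'X_jT0 ^+ d; 'X_jT0 ^+ (d - u) * 'X_jT1 ^+ u; 'X_jT1 ^+ d].

Definition Phi0_var (i : 'I_5) : {poly R} :=
  nth 0 [:: ('X_jT0)%:P; ('X_jT1)%:P;
            ('X_jT0 ^+ d)%:P * 'X;
            ('X_jT0 ^+ (d - u) * 'X_jT1 ^+ u)%:P * 'X;
            ('X_jT1 ^+ d)%:P * 'X] i.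

Definition Phi0 : S -> {poly R} :=
  mmap (fun c : K => (c%:MP_[2])%:P) Phi0_var.

Local Notation q := (q u d).
Local Notation b := (b_ u d).
Local Notation s := (sigma u d).
Local Notation t := (tau u d).
Local Notation m := (mm u d).
Local Notation r := (rho u d).

(* x to an integer exponent; in the formulas below the exponents are
   nonnegative in the branches where they are used. *)
Local Notation "x ^^ e" := (x ^+ absz e) (at level 29, left associativity).

Definition F (n : nat) : S :=
  if n == q.+2 then
    if 0 < s q then X0 ^+ (d - u) * X2 ^+ u - X1 ^+ d
    else X1 ^+ d - X0 ^+ (d - u) * X2 ^+ u
  else if s n <= 0 then
    T0 ^+ b n * X0 ^^ (- s n) * X2 ^^ (t n) - T1 ^+ b n * X1 ^^ (t n - s n)
  else
    T0 ^+ b n * X1 ^^ (s n - t n) - T1 ^+ b n * X0 ^^ (s n) * X2 ^^ (- t n).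

Definition Phi1 : 'M[S]_(q.+2, 1) := \col_(i < q.+2) F i.+1.

(* e_n, for 1 <= n <= q + 2 *)
Definition e1 (n : nat) : 'rV[S]_(q.+2) := \row_(j < q.+2) (j.+1 == n)%:R.

(* s_{n,rho(n)} and s_{n,m_{l(n)}}, for 1 <= n <= q - 1 *)
Definition s_rho (n : nat) : 'rV[S]_(q.+2) :=
  if s n <= 0 then
    (X0 ^^ (s (m n)) * X2 ^^ (- t (m n))) *: e1 n
    - T0 ^+ b (m n) *: e1 (r n)
    - (T1 ^+ b (r n) * X1 ^^ (t n - s n)) *: e1 (m n)
  else
    X1 ^^ (t (m n) - s (m n)) *: e1 n
    - T0 ^+ b (m n) *: e1 (r n)
    - (T1 ^+ b (r n) * X0 ^^ (s n) * X2 ^^ (- t n)) *: e1 (m n).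

Definition s_m (n : nat) : 'rV[S]_(q.+2) :=
  if s n <= 0 then
    X1 ^^ (s (m n) - t (m n)) *: e1 n
    - (T0 ^+ b (r n) * X0 ^^ (- s n) * X2 ^^ (t n)) *: e1 (m n)
    - T1 ^+ b (m n) *: e1 (r n)
  else
    (X0 ^^ (- s (m n)) * X2 ^^ (t (m n))) *: e1 n
    - (T0 ^+ b (r n) * X1 ^^ (s n - t n)) *: e1 (m n)
    - T1 ^+ b (m n) *: e1 (r n).

(* s_{q,q+1} and s_{q+1,q+2} *)
Definition s_q : 'rV[S]_(q.+2) :=
  if s q < 0 then
    X1 ^^ (s q.+1 - t q.+1) *: e1 q
    - (X0 ^^ (- s q) * X2 ^^ (t q)) *: e1 q.+1
    + T1 *: e1 q.+2
  else
    (X0 ^^ (- s q.+1) * X2 ^^ (t q.+1)) *: e1 q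
    - X1 ^^ (s q - t q) *: e1 q.+1
    + T1 *: e1 q.+2.

Definition s_q1 : 'rV[S]_(q.+2) :=
  if s q.+1 <= 0 then
    (X0 ^^ (s q) * X2 ^^ (- t q)) *: e1 q.+1
    - T0 *: e1 q.+2
    - X1 ^^ (t q.+1 - s q.+1) *: e1 q
  else
    X1 ^^ (t q - s q) *: e1 q.+1
    - T0 *: e1 q.+2
    - (X0 ^^ (s q.+1) * X2 ^^ (- t q.+1)) *: e1 q.

Definition syz1 (nk : nat * nat) : 'rV[S]_(q.+2) :=
  let: (n, k) := nk in
  if n == q then s_q
  else if n == q.+1 then s_q1
  else if k == r n then s_rho n
  else s_m n.

Definition Phi2 : 'M[S]_(2 * q, q.+2) :=
  \matrix_(i < 2 * q) syz1 (pair_at u d i).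

(* e_{n,k}, for (n,k) in the list pairs; by convention e_{q,q+2} stands for
   - e_{q+1,q+2}. *)
Definition e2_basis (n k : nat) : 'rV[S]_(2 * q) :=
  \row_(j < 2 * q) (pair_at u d j == (n, k))%:R.

Definition e2 (n k : nat) : 'rV[S]_(2 * q) :=
  if (n, k) == (q, q.+2) then - e2_basis q.+1 q.+2 else e2_basis n k.

(* s_{n,rho(n),l(n)}, for 1 <= n <= q - 1 *)
Definition syz2 (n : nat) : 'rV[S]_(2 * q) :=
  if s n <= 0 then
    if r n == n.+1 then
      X1 ^^ (s (m n) - t (m n)) *: e2 n (r n)
      - (X0 ^^ (s (m n)) * X2 ^^ (- t (m n))) *: e2 n (m n)
      + T0 ^+ b (m n) *: e2 n.+1 (m n)
      - T1 ^+ b (m n) *: e2 n.+1 (r n.+1)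
    else
      (X0 ^^ (s (m n)) * X2 ^^ (- t (m n))) *: e2 n (m n)
      - X1 ^^ (s (m n) - t (m n)) *: e2 n (r n)
      + T0 ^+ b (r n) *: e2 n.+1 (r n)
      - T1 ^+ b (r n) *: e2 n.+1 (r n.+1)
  else
    if r n == n.+1 then
      (X0 ^^ (- s (m n)) * X2 ^^ (t (m n))) *: e2 n (r n)
      - X1 ^^ (t (m n) - s (m n)) *: e2 n (m n)
      + T0 ^+ b (m n) *: e2 n.+1 (m n)
      - T1 ^+ b (m n) *: e2 n.+1 (r n.+1)
    else
      X1 ^^ (t (m n) - s (m n)) *: e2 n (m n)
      - (X0 ^^ (- s (m n)) * X2 ^^ (t (m n))) *: e2 n (r n)
      + T0 ^+ b (r n) *: e2 n.+1 (r n)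
      - T1 ^+ b (r n) *: e2 n.+1 (r n.+1).

Definition Phi3 : 'M[S]_(q.-1, 2 * q) := \matrix_(i < q.-1) syz2 i.+1.

Definition F2 : seq 'rV[S]_(2 * q) := [seq syz2 n | n <- iota 1 q.-1].

Definition ker_Phi2 (v : 'rV[S]_(2 * q)) : Prop := v *m Phi2 = 0.

Definition lex_vars : seq 'I_5 :=
  if 0 < s q then [:: iT0; iT1; iX0; iX1; iX2]
  else [:: iT0; iT1; iX1; iX0; iX2].

(* The order on the monomials of S, viewed as S^1. *)
Definition lex_lt : rel ('X_{1..5} * 'I_1) :=
  fun x y => @Order.lt _ (seqlexi nat)
    [seq x.1 v | v <- lex_vars] [seq y.1 v | v <- lex_vars].

Definition order_F0 : rel ('X_{1..5} * 'I_(q.+2)) := induced_order lex_lt Phi1.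

Definition order_F1 : rel ('X_{1..5} * 'I_(2 * q)) :=
  induced_order order_F0 Phi2.

End ReesResolution.

Arguments idealI : clear implicits.
Arguments Phi0 : clear implicits.
Arguments ker_Phi2 : clear implicits.
Arguments lex_lt : clear implicits.
Arguments order_F0 : clear implicits.
Arguments order_F1 : clear implicits.

(* Main.v *)
Require Import Defs.
From mathcomp Require Import all_boot all_order all_algebra zify ring.
From mathcomp.multinomials Require Import freeg mpoly.

Set Implicit Arguments.
Unset Strict Implicit.
Unset Printing Implicit Defensive.

Import Order.TTheory GRing.Theory Num.Theory.

(* Every map of the resolution is a matrix whose rows have explicit leading
   monomials for the Schreyer orders.  If A B = 0 and B is injective on the vectors
   supported on standard monomials (those divisible by no leading monomial of a row
   of A), then division by the rows of A shows that ker B is generated by these rows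
   and that they form a Groebner basis of it.  Injectivity holds because distinct
   standard monomials have distinct images (for Phi_0), or images with distinct
   leading monomials (for Phi_1, Phi_2, and for Phi_3, where A is empty).

   At each level this is a statement on the slow Euclidean sequence: for Phi_0, a
   best approximation property; for Phi_1, the growth of |sigma_n| and |tau_n| along
   the steps of a given sign; for Phi_2, the coprimality of two monomials.  Writing
   F_n = T_0^{b_n} P_n - T_1^{b_n} Q_n, m = m_{l(n)} and rho = rho(n), the syzygies
   come from b_n = b_m + b_rho, P_rho = P_n Q_m and Q_rho = Q_n P_m; the second ones
   equate two expressions of the Koszul relation between F_m and F_rho.  With
   e_{q+2} replaced by -e_{q+2} and s_{q+1,q+2} by -s_{q,q+2}, the formulas for n < q
   also hold for n = q. *)

(** * The slow Euclidean remainder sequence *)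

(** Two monomials with the same image under Phi_0 differ by a vector of a lattice of rank 2. Its
    coordinates (sigma, tau) are, up to sign, the changes in the exponents of X_0 and X_2, and the
    exponent of T_0 then changes by the height u sigma + (d - u) tau. The F_n are the binomials of
    the vectors met by subtractive Euclidean division, started at (0, 1) and (1, 0) of heights d - u
    and u; F_{q+2} belongs to the primitive vector of height 0. As sigma and tau never have the same
    strict sign, one monomial of each F_n involves, apart from T_0 and T_1, only X_1, and the other
    only X_0 and X_2. Passing from (n, m(n)) to (n + 1, m(n + 1)) is a change of basis of the
    lattice, so properties of arbitrary lattice vectors are proved by induction along the sequence.
    At height 0 the variable T_0 no longer decides comparisons: hence the dependence of the order of
    X_0 and X_1 on sigma_q, and the separate treatment of s_{q+1,q+2}. *)

Section Euclid.

Variables u d : nat.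

Local Notation a_ := (a_ u d).
Local Notation q_ := (q_ u d).
Local Notation p := (p_ u d).
Local Notation m_ := (m_ u d).
Local Notation q := (q u d).

Local Open Scope nat_scope.

Lemma euclid_pairE i : euclid_pair u d i = (a_ i, a_ i.+1).
Proof. by rewrite /Defs.a_ /=; case: (euclid_pair u d i). Qed.

Lemma a_rec i : a_ i.+2 = a_ i %% a_ i.+1.
Proof. by rewrite {1}/Defs.a_ /= euclid_pairE. Qed.

Lemma a_lt i : 0 < a_ i.+1 -> a_ i.+2 < a_ i.+1.
Proof. by move=> h; rewrite a_rec ltn_pmod. Qed.

Hypothesis hu : 0 < u.
Hypothesis hud : 2 * u < d.
Hypothesis hcop : coprime u d.

(** As long as no remainder vanishes, they decrease strictly from [a_ 1 = u]. So one of the first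
    [u + 2] of them vanishes and the bounded search in [p_] succeeds. *)
Lemma a_bound i : (exists2 j, j <= i & a_ j = 0) \/ a_ i.+1 <= u - i.
Proof.
elim: i => [|i [[j hj aj]|IH]].
- by right; rewrite /Defs.a_ /= subn0.
- by left; exists j => //; apply: leqW.
have [h|h] := posnP (a_ i.+1); first by left; exists i.+1.
by right; have := a_lt h; lia.
Qed.

Lemma has_zero_remainder : has (fun i => a_ i == 0) (iota 0 u.+2).
Proof.
apply/hasP; case: (a_bound u) => [[j hj aj]|].
  by exists j; [rewrite mem_iota; lia | apply/eqP].
by rewrite subnn leqn0 => h; exists u.+1; rewrite // mem_iota; lia.
Qed.

Lemma a_p : a_ p = 0.
Proof.
have := nth_find 0 has_zero_remainder; rewrite -/p nth_iota => [/eqP //|].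
by have := has_zero_remainder; rewrite has_find size_iota.
Qed.

Lemma a_gt0 i : i < p -> 0 < a_ i.
Proof.
move=> hi; have h := before_find 0 hi.
rewrite nth_iota in h; first by rewrite add0n lt0n in h *; rewrite h.
have := has_zero_remainder; rewrite has_find size_iota; exact: ltn_trans.
Qed.

Lemma p_ge2 : 1 < p.
Proof.
have h0 : 0 < a_ 0 by rewrite /Defs.a_ /=; lia.
have h1 : 0 < a_ 1 by rewrite /Defs.a_ /=.
case: p a_p => [|[|//]] h; first by rewrite h in h0.
by rewrite h in h1.
Qed.

Lemma a_ltS i : i.+1 < p -> a_ i.+1 < a_ i.
Proof.
move=> hi; case: i hi => [|i] hi; first by rewrite /Defs.a_ /=; lia.
by apply: a_lt; apply: a_gt0; lia.
Qed.

Lemma a_gcd i : gcdn (a_ i) (a_ i.+1) = 1.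
Proof.
elim: i => [|i IH].
  rewrite /Defs.a_ /= gcdnC; apply/eqP; move: hcop.
  by rewrite /coprime -{1}(@subnK u d) ?gcdnDr //; lia.
by rewrite a_rec gcdn_modr gcdnC.
Qed.

Lemma a_last : a_ p.-1 = 1.
Proof. by have := a_gcd p.-1; rewrite prednK ?a_p ?gcdn0 //; have := p_ge2; lia. Qed.

Lemma q_gt0 l : 0 < l < p -> 0 < q_ l.
Proof.
move=> /andP[l0 lp]; rewrite /Defs.q_ divn_gt0 ?a_gt0 //.
by apply: ltnW; have := @a_ltS l.-1; rewrite prednK //; apply.
Qed.

Lemma m_0 : m_ 0 = 1.
Proof. by rewrite /Defs.m_ big_geq // ifT //; have := p_ge2; lia. Qed.

Lemma m_S l : l.+1 < p -> m_ l.+1 = m_ l + q_ l.+1.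
Proof.
move=> h; rewrite /Defs.m_ h ifT; last by lia.
by rewrite big_nat_recr.
Qed.

Lemma m_p1 : m_ p.-1 = q.+1.
Proof.
rewrite /Defs.m_ ifT; last by have := p_ge2; lia.
by rewrite /Defs.q prednK //; have := p_ge2; lia.
Qed.

Lemma m_p : m_ p = q.+2.
Proof. by rewrite /Defs.m_ ltnn. Qed.

Lemma m_ltS l : l < p -> m_ l < m_ l.+1.
Proof.
move=> h; have [h1|h1] := ltnP l.+1 p.
  by rewrite m_S // -[X in X < _]addn0 ltn_add2l q_gt0 // h1.
have -> : l.+1 = p by lia.
have -> : l = p.-1 by lia.
by rewrite m_p1 m_p.
Qed.

Lemma m_mono k l : k <= l -> l <= p -> m_ k <= m_ l.
Proof.
elim: l => [|l IH]; first by rewrite leqn0 => /eqP ->.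
rewrite leq_eqVlt => /orP[/eqP -> //|h] hl.
by apply: leq_trans (ltnW (m_ltS hl)); apply: IH; lia.
Qed.

Lemma ellE n l : 0 < l < p -> m_ l.-1 <= n < m_ l -> ell u d n = l.
Proof.
move=> hl hn; rewrite /ell.
set P := fun k : nat => _; set s := [seq k <- _ | _].
have ls : l \in s.
  by rewrite mem_filter hn mem_iota; move: hl; have := p_ge2; lia.
have : head 0 s \in s by case: s ls => //= x t _; rewrite mem_head.
rewrite mem_filter mem_iota => /andP[/andP[h1 h2] h3].
set k := head 0 s in h1 h2 h3 *.
have [hkl|hkl|//] := ltngtP k l.
  have := @m_mono k l.-1; have := p_ge2; lia.
have := @m_mono l k.-1; have := p_ge2; lia.
Qed.

Local Notation sers := (sers u d).

Lemma sersS n : sers n.+2 = sers_step (sers n.+1).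
Proof. by []. Qed.

Definition swapping n := st_b (sers n) - st_c (sers n) < st_c (sers n).

(** In block [l] the slow sequence subtracts [a_ l] from [a_ l.-1] once per step. It swaps when the
    difference drops below [a_ l], that is, just before the index [m_ l]. *)
Lemma block n : 0 < n <= q -> exists l,
  [/\ 0 < l < p, m_ l.-1 <= n < m_ l,
      st_b (sers n) + (n - m_ l.-1) * a_ l = a_ l.-1,
      st_c (sers n) = a_ l & swapping n = (n.+1 == m_ l)].
Proof.
(* The last claim follows from the others: a swap at [k] means that [a_ l.-1] contains fewer than
   [k - m_ l.-1 + 2] copies of [a_ l]. *)
have main k l : 0 < l < p -> m_ l.-1 <= k < m_ l ->
    st_b (sers k) + (k - m_ l.-1) * a_ l = a_ l.-1 ->
    st_c (sers k) = a_ l -> swapping k = (k.+1 == m_ l).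
  move=> hl hk hb hc; rewrite /swapping hc.
  have al : 0 < a_ l by apply: a_gt0; lia.
  have hm : m_ l = m_ l.-1 + q_ l by have := @m_S l.-1; rewrite prednK //; lia.
  have -> : (k.+1 == m_ l) = (q_ l < (k - m_ l.-1).+2) by lia.
  rewrite /Defs.q_ ltn_divLR //.
  have : (k - m_ l.-1).+1 * a_ l <= a_ l.-1.
    by rewrite -leq_divRL //; move: hm; rewrite /Defs.q_; lia.
  rewrite !mulSn; lia.
elim: n => // n IH hn.
case: n IH hn => [|n] IH hn.
  exists 1; have h1 : 0 < 1 < p by have := p_ge2; lia.
  have h2 : m_ 0 <= 1 < m_ 1 by rewrite m_0 leqnn -{1}m_0 m_ltS //; lia.
  have h3 : st_b (sers 1) + (1 - m_ 0) * a_ 1 = a_ 0.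
    by rewrite m_0 subnn mul0n addn0.
  by split=> //; apply: main.
case: IH => [|l [hl hk hb hc hsw]]; first by lia.
case E : (sers n.+1) hb hc hsw => [b c s t al be] /= hb hc.
rewrite /swapping E /= => hsw.
have al0 : 0 < a_ l by apply: a_gt0; lia.
have hm : m_ l = m_ l.-1 + q_ l by have := @m_S l.-1; rewrite prednK //; lia.
have hle : (n.+1 - m_ l.-1).+1 * a_ l <= a_ l.-1.
  by rewrite -leq_divRL //; move: hm; rewrite /Defs.q_; lia.
rewrite mulSn in hle.
have [hswt|hswt] := boolP (n.+2 == m_ l).
  rewrite hswt in hsw.
  have hl1 : l.+1 < p.
    rewrite ltnNge; apply/negP => h; have E2 : l = p.-1 by lia.
    by have := m_p1; rewrite -E2; lia.
  (* At a swap all [q_ l] copies of [a_ l] have been subtracted, so the difference is the next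
     Euclidean remainder. *)
  have key : b - c = a_ l.+1.
    have -> : a_ l.+1 = a_ l.-1 %% a_ l by case: (l) hl => [//|k] _; exact: a_rec.
    have -> : b - c = a_ l.-1 - q_ l * a_ l.
      have -> : q_ l = (n.+1 - m_ l.-1).+1 by lia.
      by rewrite mulSn hc; lia.
    by rewrite /Defs.q_ {1}(divn_eq (a_ l.-1) (a_ l)); lia.
  exists l.+1; have h1 : 0 < l.+1 < p by lia.
  have h2 : m_ l <= n.+2 < m_ l.+1.
    by rewrite (eqP hswt) leqnn m_ltS //; lia.
  have h0 : (n.+2 - m_ l) = 0 by lia.
  have e : sers n.+2 = SersState c (b - c) al be (s - al)%R (t - be)%R.
    by rewrite sersS E /sers_step leqNgt hsw.
  have h3 : st_b (sers n.+2) + (n.+2 - m_ l.+1.-1) * a_ l.+1 = a_ l.+1.-1.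
    by rewrite e /= h0 mul0n addn0.
  have h4 : st_c (sers n.+2) = a_ l.+1 by rewrite e.
  by split; [exact h1|exact h2|exact h3|exact h4|exact: main].
rewrite (negbTE hswt) in hsw.
have e : sers n.+2 = SersState (b - c) c (s - al)%R (t - be)%R al be.
  by rewrite sersS E /sers_step leqNgt hsw.
exists l; have h2 : m_ l.-1 <= n.+2 < m_ l by lia.
have h3 : st_b (sers n.+2) + (n.+2 - m_ l.-1) * a_ l = a_ l.-1.
  rewrite e /=; have -> : n.+2 - m_ l.-1 = (n.+1 - m_ l.-1).+1 by lia.
  by rewrite mulSn hc; lia.
have h4 : st_c (sers n.+2) = a_ l by rewrite e.
by split; [exact hl|exact h2|exact h3|exact h4|exact: main].
Qed.

Local Notation mm := (mm u d).
Local Notation rho := (rho u d).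
Local Notation b_ := (b_ u d).
Local Notation sigma := (sigma u d).
Local Notation tau := (tau u d).

(** Either two blocks contribute to q, or [p = 2], and then u = 1 and q = d - 1. The bound is what
    makes [sigma q] nonzero, since [sigma] vanishes at 1. *)
Lemma q_ge2 : 1 < q.
Proof.
have h := m_p1; have h2 := p_ge2.
have [hp|hp] := leqP p 2; last first.
  have := @m_mono 2 p.-1; have := @m_ltS 1; have := @m_ltS 0.
  rewrite m_0; lia.
have E : p = 2 by lia.
have e1 : a_ 1 = 1 by have := a_last; rewrite E.
have e2 : m_ 1 = m_ 0 + q_ 1 by apply: m_S; rewrite E.
move: h; rewrite E /= e2 m_0 /Defs.q_ e1 divn1 /Defs.a_ /=.
by move: e1; rewrite /Defs.a_ /=; lia.
Qed.

(** For n < q, the indices m(n) and rho(n) are n + 1 and m(n + 1), in an order that depends on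
    whether a swap occurs. The inductions along the sequence split on this alternative. *)
Variant step_spec n : Prop :=
| NoSwap of n < q & rho n = n.+1 & n.+1 < mm n <= q.+1 & mm n.+1 = mm n
    & ~~ swapping n
| Swap of n < q & mm n = n.+1 & n.+1 < rho n <= q.+1 & mm n.+1 = rho n
    & swapping n
| Last of n = q & mm n = q.+1 & rho n = q.+2 & swapping n.

Lemma stepP n : 0 < n <= q -> step_spec n.
Proof.
move=> hn; have [l [hl hk _ _ hs]] := block hn.
have hml : m_ l <= q.+1 by rewrite -m_p1 m_mono //; lia.
have e := ellE hl hk.
have [h|h] := ltnP n.+1 (m_ l).
  apply: NoSwap; rewrite /Defs.rho /Defs.mm ?e ?h //; [lia | | by rewrite hs; lia].
  by rewrite (@ellE n.+1 l) //; lia.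
have E : m_ l = n.+1 by lia.
have sw : swapping n by rewrite hs E eqxx.
have [nq|nq] := eqVneq n q.
  apply: Last; rewrite // /Defs.rho /Defs.mm ?e ?E ?nq // ltnn.
  have [h1|h1] := ltnP l.+1 p.
    have := @m_mono l.+1 p.-1; have := @m_ltS l; rewrite m_p1; lia.
  have -> : l.+1 = p by lia.
  exact: m_p.
have hl1 : l.+1 < p.
  rewrite ltnNge; apply/negP => h1; have E2 : l = p.-1 by lia.
  by have := m_p1; rewrite -E2; lia.
have h1 : n.+1 < m_ l.+1 by rewrite -E m_ltS //; lia.
have h2 : m_ l.+1 <= q.+1 by rewrite -m_p1 m_mono //; lia.
apply: Swap; rewrite // /Defs.rho /Defs.mm ?e ?E ?ltnn ?h1 //; first by lia.
by rewrite (@ellE n.+1 l.+1) //= E leqnn h1.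
Qed.

Lemma sers_c n : 0 < n <= q -> 0 < st_c (sers n) <= st_b (sers n).
Proof.
move=> hn; have [l [hl hk hb hc _]] := block hn; rewrite hc a_gt0 /=; last by lia.
have hm : m_ l = m_ l.-1 + q_ l by have := @m_S l.-1; rewrite prednK //; lia.
have : (n - m_ l.-1).+1 * a_ l <= a_ l.-1.
  by rewrite -leq_divRL ?a_gt0 //; move: hm; rewrite /Defs.q_; lia.
rewrite mulSn; lia.
Qed.

(** Step q lies in the last block, where [st_c] is the last nonzero remainder, 1 by coprimality. As
    q is a swap step, [st_b] is less than 2. *)
Lemma sers_last : st_b (sers q) = 1 /\ st_c (sers q) = 1.
Proof.
have hq : 0 < q <= q by have := q_ge2; lia.
have [l [hl hk hb hc hs]] := block hq.
have E : l = p.-1.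
  have [h1|h1] := ltnP l.+1 p; last by lia.
  have h2 : m_ l.+1 <= q.+1 by rewrite -m_p1 m_mono //; lia.
  have h3 : m_ l < m_ l.+1 by apply: m_ltS; lia.
  by lia.
rewrite E a_last in hc; split=> //.
have hc0 := sers_c hq; case: (stepP hq) => [||_ _ _]; [by rewrite ltnn|by rewrite ltnn|].
by rewrite /swapping; lia.
Qed.

Local Open Scope ring_scope.

(** (sigma, tau) and (alpha, beta) form a basis of Z^2 whose heights are [st_b] and [st_c]. Their
    opposite signs turn each subtraction into an addition of absolute values; with [inv_alpha], this
    keeps the next sigma away from 0. *)
Record sers_inv (n : nat) (x : sers_state) : Prop := SersInv {
  inv_b : (st_b x)%:Z = u%:Z * st_sigma x + (d%:Z - u%:Z) * st_tau x;
  inv_c : (st_c x)%:Z = u%:Z * st_alpha x + (d%:Z - u%:Z) * st_beta x;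
  inv_det : `|st_sigma x * st_beta x - st_tau x * st_alpha x| = 1;
  inv_sign :
    (st_sigma x <= 0 /\ 0 < st_tau x /\ 0 < st_alpha x /\ st_beta x <= 0) \/
    (0 < st_sigma x /\ st_tau x <= 0 /\ st_alpha x <= 0 /\ 0 < st_beta x);
  inv_alpha : st_alpha x != 0;
  inv_sigma : (1 < n)%N -> st_sigma x != 0 }.

Lemma sersP n : (0 < n <= q.+1)%N -> sers_inv n (sers n).
Proof.
elim: n => // n IH hn; case: n IH hn => [_ _|n IH hn].
  split=> //=; [lia| lia| by left].
have hb := @sers_c n.+1; have {hb} := hb _; rewrite sersS.
have {IH} := IH _; case: (sers n.+1) => b c s t al be IH hb.
have [|/= ib ic idet isg ial is0] := IH _; first by lia.
have {hb}/= hb := hb _; have {}hb : (0 < c <= b)%N by apply: hb; lia.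
have inz : s - al != 0 by lia.
have e : (b - c)%N%:Z = b%:Z - c%:Z by lia.
have d1 : (s - al) * be - (t - be) * al = s * be - t * al by ring.
case: ifP => hs; split => //=.
- by rewrite e ib ic; ring.
- by rewrite d1.
- lia.
- by rewrite e ib ic; ring.
- by rewrite -normrN -d1 in idet; rewrite -idet; congr `|_|; ring.
- lia.
Qed.

End Euclid.

(** * Absolute values along the sequence, and best approximation *)

Section Magnitudes.

Variables u d : nat.
Hypothesis hu : (0 < u)%N.
Hypothesis hud : (2 * u < d)%N.
Hypothesis hcop : coprime u d.

Local Notation q := (q u d).
Local Notation mm := (mm u d).
Local Notation rho := (rho u d).
Local Notation b_ := (b_ u d).
Local Notation sigma := (sigma u d).
Local Notation tau := (tau u d).
Local Notation sers := (sers u d).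

Definition abs_sigma n := `|sigma n|%N.
Definition abs_tau n := `|tau n|%N.
(* At [n = q + 2], where sigma and tau are conventional, the value is chosen so that
   the leading monomial of F_{q+2} is given by the formula valid for n <= q + 1. *)
Definition sigma_side n := if n == q.+2 then ~~ (0 < sigma q)%R else (0 < sigma n)%R.

Local Open Scope ring_scope.

Lemma sersE n : (n <= q.+1)%N ->
  [/\ sigma n = st_sigma (sers n), tau n = st_tau (sers n) & b_ n = st_b (sers n)].
Proof. by move=> h; rewrite /Defs.sigma /Defs.tau /Defs.b_ !ifF //; lia. Qed.

Lemma sers_noswap n : (0 < n)%N -> ~~ swapping u d n -> let x := sers n in
  sers n.+1 = SersState (st_b x - st_c x) (st_c x) (st_sigma x - st_alpha x)
                (st_tau x - st_beta x) (st_alpha x) (st_beta x).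
Proof.
case: n => // n _; rewrite sersS /swapping -leqNgt.
by case: (sers n.+1) => b c s t al be /= ->.
Qed.

Lemma sers_swap n : (0 < n)%N -> swapping u d n -> let x := sers n in
  sers n.+1 = SersState (st_c x) (st_b x - st_c x) (st_alpha x) (st_beta x)
                (st_sigma x - st_alpha x) (st_tau x - st_beta x).
Proof.
case: n => // n _; rewrite sersS /swapping ltnNge.
by case: (sers n.+1) => b c s t al be /= /negbTE ->.
Qed.

(** [st_c], [st_alpha] and [st_beta] are kept until the next swap, which turns them into the height,
    sigma and tau of step m(n). Hence the induction goes down from q. *)
Lemma sers_mm n : (0 < n <= q)%N ->
  [/\ sigma (mm n) = st_alpha (sers n), tau (mm n) = st_beta (sers n)
    & b_ (mm n) = st_c (sers n)].
Proof.
have [k] := ubnP (q - n); elim: k n => // k IH n hk hn.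
have n0 : (0 < n)%N by lia.
case: (stepP hu hud hcop hn).
- move=> h1 _ _ <- hs; have [|| -> -> ->] := IH n.+1; try lia.
  by rewrite (sers_noswap n0 hs).
- move=> h1 -> _ _ hs; have [|-> -> ->] := @sersE n.+1; first by lia.
  by rewrite (sers_swap n0 hs).
- move=> -> -> _ hs; have [//|-> -> ->] := @sersE q.+1.
  by rewrite sers_swap //; have := q_ge2 hu hud hcop; lia.
Qed.

Lemma rho_rel n : (0 < n < q)%N ->
  [/\ sigma (rho n) = sigma n - sigma (mm n), tau (rho n) = tau n - tau (mm n)
    & (b_ n = b_ (mm n) + b_ (rho n))%N].
Proof.
move=> hn; have n0 : (0 < n)%N by lia.
have hn' : (0 < n <= q)%N by lia.
have hc := sers_c hu hud hcop hn'.
have [-> -> ->] := sers_mm hn'; have [|-> -> ->] := @sersE n; first by lia.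
case: (stepP hu hud hcop hn').
- move=> h1 -> _ _ hs; have [|-> -> ->] := @sersE n.+1; first by lia.
  by rewrite (sers_noswap n0 hs) /=; split=> //; lia.
- move=> h1 _ _ <- hs; have [|-> -> ->] := @sers_mm n.+1; first by lia.
  by rewrite (sers_swap n0 hs) /=; split=> //; lia.
- lia.
Qed.

Lemma mm_rho_q : mm q = q.+1 /\ rho q = q.+2.
Proof.
have q1 := q_ge2 hu hud hcop.
by case: (@stepP _ _ hu hud hcop q) => //; lia.
Qed.

Lemma b_last : [/\ b_ q = 1%N, b_ q.+1 = 1%N & b_ q.+2 = 0%N].
Proof.
have q1 := q_ge2 hu hud hcop.
have [e1 e2] := sers_last hu hud hcop.
have hq : (0 < q <= q)%N by lia.
split; last by rewrite /Defs.b_ eqxx.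
  by have [_ _ ->] := @sersE q (leqnSn _).
by have [_ _ ] := sers_mm hq; rewrite (mm_rho_q.1) e2.
Qed.

Lemma mm_bounds n : (0 < n <= q)%N ->
  [/\ (n < mm n <= q.+1)%N, (n < rho n <= q.+2)%N & (n < q -> rho n <= q.+1)%N].
Proof. by move=> hn; case: (stepP hu hud hcop hn) => *; split; lia. Qed.

Lemma b_gt0 n : (0 < n <= q.+1)%N -> (0 < b_ n)%N.
Proof.
move=> hn; have [nq|nq] := leqP n q; last first.
  have -> : n = q.+1 by lia.
  by have [_ -> _] := b_last.
have [|_ _ ->] := @sersE n; first by lia.
have := @sers_c _ _ hu hud hcop n; lia.
Qed.

Lemma sign_spec n : (0 < n <= q.+1)%N ->
  (sigma n <= 0 /\ 0 < tau n) \/ (0 < sigma n /\ tau n <= 0).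
Proof.
move=> hn; have [|-> -> _] := @sersE n; first by lia.
case: (inv_sign (sersP hu hud hcop hn)); lia.
Qed.

Lemma sigma_neq0 n : (1 < n <= q.+1)%N -> sigma n != 0.
Proof.
move=> hn; have [|-> _ _] := @sersE n; first by lia.
have h : (0 < n <= q.+1)%N by lia.
apply: (inv_sigma (sersP hu hud hcop h)); lia.
Qed.

Lemma sigma_sideE n : (n <= q.+1)%N -> sigma_side n = (0 < sigma n).
Proof. by move=> h; rewrite /sigma_side ifF //; lia. Qed.

Lemma sigma_mm n : (0 < n <= q)%N ->
  (sigma n <= 0 /\ 0 < tau n /\ 0 < sigma (mm n) /\ tau (mm n) <= 0) \/
  (0 < sigma n /\ tau n <= 0 /\ sigma (mm n) <= 0 /\ 0 < tau (mm n)).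
Proof.
move=> hn; have [-> -> _] := sers_mm hn; have [|-> -> _] := @sersE n; first by lia.
have h : (0 < n <= q.+1)%N by lia.
case: (inv_sign (sersP hu hud hcop h)); lia.
Qed.

Lemma sigma_side_mm n : (0 < n <= q)%N -> sigma_side (mm n) = ~~ sigma_side n.
Proof.
move=> hn; have [h1 _ _] := mm_bounds hn.
by rewrite !sigma_sideE; try lia; case: (sigma_mm hn); lia.
Qed.

Lemma sigma_side_rho n : (0 < n < q)%N -> sigma_side (rho n) = sigma_side n.
Proof.
move=> hn; have hn' : (0 < n <= q)%N by lia.
have [h1 h2 h3] := mm_bounds hn'; have [e _ _] := rho_rel hn.
by rewrite !sigma_sideE ?e; try lia; case: (sigma_mm hn'); lia.
Qed.

Lemma sigma_side_q : sigma_side q.+1 = ~~ sigma_side q /\ sigma_side q.+2 = ~~ sigma_side q.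
Proof.
have q1 := q_ge2 hu hud hcop.
split; first by rewrite -(mm_rho_q.1) sigma_side_mm //; lia.
by rewrite {1}/sigma_side eqxx sigma_sideE //; lia.
Qed.

(** Cramer's rule: the two heights are 1 and the determinant is 1 or -1. So the conventional values
    at q + 2 extend [rho_rel] to n = q up to a sign. *)
Lemma width_last :
  (sigma q - sigma q.+1 = (d - u)%N%:Z /\ tau q - tau q.+1 = - u%:Z) \/
  (sigma q - sigma q.+1 = - (d - u)%N%:Z /\ tau q - tau q.+1 = u%:Z).
Proof.
have q1 := q_ge2 hu hud hcop.
have hq : (0 < q <= q)%N by lia.
have hq' : (0 < q <= q.+1)%N by lia.
have [e1 e2] := sers_last hu hud hcop.
have [] := sers_mm hq; rewrite (mm_rho_q.1) => -> -> _.
have [|-> -> _] := @sersE q; first by lia.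
have [] := sersP hu hud hcop hq'; rewrite e1 e2.
set s := st_sigma _; set t := st_tau _; set al := st_alpha _; set be := st_beta _.
move=> hb hc hdet _ _ _.
have -> : (d - u)%N%:Z = d%:Z - u%:Z by lia.
have es : s - al = (d%:Z - u%:Z) * (s * be - t * al).
  have -> : s - al = s * (u%:Z * al + (d%:Z - u%:Z) * be)
                     - (u%:Z * s + (d%:Z - u%:Z) * t) * al by rewrite -hb -hc; ring.
  by ring.
have et : t - be = - u%:Z * (s * be - t * al).
  have -> : t - be = t * (u%:Z * al + (d%:Z - u%:Z) * be)
                     - (u%:Z * s + (d%:Z - u%:Z) * t) * be by rewrite -hb -hc; ring.
  by ring.
have [e|e] : s * be - t * al = 1 \/ s * be - t * al = -1 by lia.
  by left; rewrite es et e; split; ring.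
by right; rewrite es et e; split; ring.
Qed.

Lemma xy_q2 : abs_sigma q.+2 = (d - u)%N /\ abs_tau q.+2 = u.
Proof. by rewrite /abs_sigma /abs_tau /Defs.sigma /Defs.tau eqxx; lia. Qed.

Lemma xy_rho n : (0 < n <= q)%N ->
  [/\ abs_sigma (rho n) = (abs_sigma n + abs_sigma (mm n))%N, abs_tau (rho n) = (abs_tau n +
    abs_tau (mm n))%N
    & b_ n = (b_ (mm n) + b_ (rho n))%N].
Proof.
move=> hn; case: (sigma_mm hn) => hs; have [nq|nq] := ltnP n q.
- by have [|e1 e2 e3] := @rho_rel n; [lia | split=> //; rewrite /abs_sigma /abs_tau ?e1 ?e2;
  lia].
- have E : n = q by lia.
  move: hs; rewrite E (mm_rho_q.1) (mm_rho_q.2) xy_q2.1 xy_q2.2.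
  have [-> -> ->] := b_last.
  by case: width_last => -[h1 h2] hs; split; rewrite // /abs_sigma /abs_tau; lia.
- by have [|e1 e2 e3] := @rho_rel n; [lia | split=> //; rewrite /abs_sigma /abs_tau ?e1 ?e2;
  lia].
- have E : n = q by lia.
  move: hs; rewrite E (mm_rho_q.1) (mm_rho_q.2) xy_q2.1 xy_q2.2.
  have [-> -> ->] := b_last.
  by case: width_last => -[h1 h2] hs; split; rewrite // /abs_sigma /abs_tau; lia.
Qed.

Lemma widthE n : (0 < n <= q.+2)%N -> width u d n = (abs_sigma n + abs_tau n)%N.
Proof.
move=> hn; have [h|h] := leqP n q.+1.
  by rewrite /width /abs_sigma /abs_tau; have := @sign_spec n; lia.
have -> : n = q.+2 by lia.
by rewrite xy_q2.1 xy_q2.2 /width /Defs.sigma /Defs.tau eqxx; lia.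
Qed.

Lemma xy_gt0 n : (0 < n <= q.+1)%N -> (0 < abs_sigma n + abs_tau n)%N.
Proof. by move=> hn; have := sign_spec hn; rewrite /abs_sigma /abs_tau; lia. Qed.

Local Open Scope nat_scope.

Lemma b_decr n : (0 < n <= q)%N -> (b_ (mm n) <= b_ n)%N.
Proof. by move=> hn; have [_ _] := xy_rho hn; lia. Qed.

(** By [xy_rho] the bounds are the values at rho(n) and at m(n): after n, these steps have the
    smallest absolute values for the sign of n and for the opposite sign. *)
Lemma xy_mono n k : 0 < n <= q -> n < k <= q.+2 ->
  if sigma_side k == sigma_side n then (abs_sigma n + abs_sigma (mm n) <= abs_sigma k) &&
    (abs_tau n + abs_tau (mm n) <= abs_tau k)
  else (abs_sigma (mm n) <= abs_sigma k) && (abs_tau (mm n) <= abs_tau k).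
Proof.
have [j] := ubnP (q - n); elim: j n => // j IH n hj hn hk.
have pm := sigma_side_mm hn; have [ex ey _] := xy_rho hn.
case: (stepP hu hud hcop hn).
- move=> h1 e2 _ e4 _; rewrite e2 in ex ey.
  have pr : sigma_side n.+1 = sigma_side n by rewrite -e2 sigma_side_rho //; lia.
  have [kn|kn] := eqVneq k n.+1; first by rewrite kn pr eqxx; lia.
  have h0 : n.+1 < k <= q.+2 by lia.
  have {IH} := IH n.+1 _ _ h0; rewrite e4 pr.
  by case: ifP => _ h; have {h} := h _ _; lia.
- move=> h1 e2 _ e4 _.
  have pr : sigma_side n.+1 = ~~ sigma_side n by rewrite -e2.
  have [kn|kn] := eqVneq k n.+1; first by rewrite kn pr e2; case: (sigma_side n) => /=; lia.
  have h0 : n.+1 < k <= q.+2 by lia.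
  have {IH} := IH n.+1 _ _ h0; rewrite e4 pr => h.
  have {h} := h _ _; rewrite ex ey => h.
  rewrite e2 in h *.
  by move: h; case: (sigma_side k); case: (sigma_side n) => /= h; have {h} := h _ _; lia.
- move=> e1 e2 e3 _; rewrite e2 ?e3 in ex ey pm *; rewrite e1 in ex ey pm hk *.
  have [p1 p2] := sigma_side_q.
  have [->|->] : k = q.+1 \/ k = q.+2 by lia.
    by rewrite pm; case: (sigma_side q) => /=; lia.
  by rewrite p2; case: (sigma_side q) => /=; lia.
Qed.

(* Best approximation: a lattice vector of positive height, with coordinates
   (X + 1, -Y) or (-X, Y + 1) on the vectors (sigma, tau) of the steps n and m(n),
   dominates a later step with the same signs. *)
Lemma approx n X Y : 0 < n <= q ->
  (Y * b_ (mm n) < X.+1 * b_ n -> exists k,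
     [/\ 0 < k <= q.+1, sigma_side k = sigma_side n, b_ k + Y * b_ (mm n) <= X.+1 * b_ n,
         abs_sigma k <= X.+1 * abs_sigma n + Y * abs_sigma (mm n) & abs_tau k <= X.+1 *
           abs_tau n + Y * abs_tau (mm n)]) /\
  (X * b_ n < Y.+1 * b_ (mm n) -> exists k,
     [/\ 0 < k <= q.+1, sigma_side k = sigma_side (mm n), b_ k + X * b_ n <= Y.+1 * b_ (mm n),
         abs_sigma k <= X * abs_sigma n + Y.+1 * abs_sigma (mm n) & abs_tau k <= X * abs_tau
           n + Y.+1 * abs_tau (mm n)]).
Proof.
have [j] := ubnP (q - n); elim: j n X Y => // j IH n X Y hj hn.
have pm := sigma_side_mm hn; have [ex ey eb] := xy_rho hn.
have [h1 h2 h3] := mm_bounds hn.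
have bm : 0 < b_ (mm n) by apply: b_gt0; lia.
split=> hXY.
- have [hle|hlt] := leqP Y X.
    exists n; split=> //; first by lia.
    + by rewrite mulSn leq_add2l leq_mul // b_decr.
    + by rewrite mulSn -addnA leq_addr.
    + by rewrite mulSn -addnA leq_addr.
  (* Now X < Y. As the vector of rho(n) is that of n minus that of m(n), the coordinates (X + 1, -Y)
     on n, m(n) become (X + 1, -(Y - X - 1)) on rho(n), m(n). These two steps are n + 1 and m(n +
     1), exchanged by a swap; hence the joint induction on both halves. *)
  case: (stepP hu hud hcop hn).
  + move=> nq er _ em _; have [||+ _] := IH n.+1 X (Y - X.+1); try lia.
    rewrite em -er ex ey => -[|k [k1 k2 k3 k4 k5]].
      by rewrite mulnBl; nia.
    exists k; split=> //; first by rewrite k2 sigma_side_rho //; lia.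
    * by rewrite mulnBl in k3; nia.
    * by rewrite mulnBl in k4; nia.
    * by rewrite mulnBl in k5; nia.
  + move=> nq er _ em _; have [||_ +] := IH n.+1 (Y - X.+1) X; try lia.
    rewrite em -er ex ey => -[|k [k1 k2 k3 k4 k5]].
      by rewrite mulnBl; nia.
    exists k; split=> //; first by rewrite k2 sigma_side_rho //; lia.
    * by rewrite mulnBl in k3; nia.
    * by rewrite mulnBl in k4; nia.
    * by rewrite mulnBl in k5; nia.
  + move=> E em _ _; move: hXY; rewrite em E; have [-> -> _] := b_last; lia.
- have hle : X <= Y.
    have h : X * b_ (mm n) < Y.+1 * b_ (mm n).
      by apply: leq_ltn_trans hXY; rewrite leq_mul // b_decr.
    by move: h; rewrite ltn_pmul2r.
  have [X0|X0] := posnP X.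
    exists (mm n); rewrite X0 !mul0n !add0n addn0; split=> //; first by lia.
    + by rewrite leq_pmull.
    + by rewrite leq_pmull.
    + by rewrite leq_pmull.
  (* The same change of basis turns (-X, Y + 1) on n, m(n) into (-X, Y + 1 - X) on rho(n), m(n). *)
  case: (stepP hu hud hcop hn).
  + move=> nq er _ em _; have [||_ +] := IH n.+1 X (Y - X); try lia.
    rewrite em -er ex ey => -[|k [k1 k2 k3 k4 k5]].
      by rewrite -subSn // mulnBl; nia.
    rewrite -subSn // mulnBl in k3 k4 k5.
    by exists k; split=> //; nia.
  + move=> nq er _ em _; have [||+ _] := IH n.+1 (Y - X) X; try lia.
    rewrite em -er ex ey => -[|k [k1 k2 k3 k4 k5]].
      by rewrite -subSn // mulnBl; nia.
    rewrite -subSn // mulnBl in k3 k4 k5.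
    by exists k; split=> //; nia.
  + move=> E em _ _; exists q.+1; rewrite em E.
    rewrite em E in hXY *; move: hXY; have [-> -> _] := b_last => hXY; split=> //; nia.
Qed.

End Magnitudes.

(** * Induced orders and division in free modules *)

Section FreeModules.

Variable K : fieldType.

Local Notation S := {mpoly K[5]}.
Local Notation mon := 'X_{1..5}.

Local Open Scope ring_scope.

Definition vcoef k (v : 'rV[S]_k) (x : mon * 'I_k) : K := (v 0 x.2)@_(x.1).

Definition shift k (m : mon) (x : mon * 'I_k) : mon * 'I_k := ((m + x.1)%MM, x.2).

Section Coefficients.

Variable k : nat.
Implicit Types (v w : 'rV[S]_k) (x y z : mon * 'I_k).

Lemma vcoef0 x : vcoef 0 x = 0.
Proof. by rewrite /vcoef mxE mcoeff0. Qed.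

Lemma vcoefD v w x : vcoef (v + w) x = vcoef v x + vcoef w x.
Proof. by rewrite /vcoef mxE mcoeffD. Qed.

Lemma vcoefN v x : vcoef (- v) x = - vcoef v x.
Proof. by rewrite /vcoef mxE mcoeffN. Qed.

Lemma vcoefB v w x : vcoef (v - w) x = vcoef v x - vcoef w x.
Proof. by rewrite vcoefD vcoefN. Qed.

Lemma vcoefC c v x : vcoef (c%:MP *: v) x = c * vcoef v x.
Proof. by rewrite /vcoef mxE mcoeffCM. Qed.

Lemma vcoef_sum (I : Type) (r : seq I) (F : I -> 'rV[S]_k) x :
  vcoef (\sum_(i <- r) F i) x = \sum_(i <- r) vcoef (F i) x.
Proof.
by elim: r => [|i r IH]; rewrite ?big_nil ?vcoef0 // !big_cons vcoefD IH.
Qed.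

Lemma vcoef_inj v w : vcoef v =1 vcoef w -> v = w.
Proof. by move=> h; apply/rowP => i; apply/mpolyP => m; exact: (h (m, i)). Qed.

Lemma vcoef_shift m v x : vcoef ('X_[m] *: v) (shift m x) = vcoef v x.
Proof. by rewrite /vcoef /shift mxE /= mulrC mcoeffMX. Qed.

Lemma vcoef_shift_neq0 m v y :
  vcoef ('X_[m] *: v) y != 0 -> exists2 x, vcoef v x != 0 & y = shift m x.
Proof.
rewrite /vcoef mxE mulrC -mcoeff_msupp (perm_mem (msuppMX _ _)).
case/mapP => m' hm' e; exists (m', y.2); first by rewrite /= -mcoeff_msupp.
by rewrite /shift /= -e; case: (y).
Qed.

Lemma vcoef_vmonom x y : vcoef (vmonom_vec K x) y = (x == y)%:R.
Proof.
case: x y => [m i] [m' i']; rewrite /vcoef /vmonom_vec !mxE /= xpair_eqE (eq_sym i).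
case: (i' == i); first by rewrite mulr1 mcoeffX andbT.
by rewrite mulr0 mcoeff0 andbF.
Qed.

Lemma mem_vsupp v x : (x \in vsupp v) = (vcoef v x != 0).
Proof.
apply/allpairsPdep/idP => [[i [m [_ hm ->]]]|h].
  by rewrite /vcoef /= -mcoeff_msupp.
by exists x.2, x.1; rewrite mem_enum mcoeff_msupp; split=> //; case: (x).
Qed.

Lemma vsupp_uniq v : uniq (vsupp v).
Proof.
apply: allpairs_uniq_dep; first exact: enum_uniq.
  by move=> i _; exact: msupp_uniq.
by move=> [i m] [i' m'] _ _ /= [-> ->].
Qed.

Lemma vcoef_vsupp0 v : v != 0 -> exists x, vcoef v x != 0.
Proof.
move=> nz; have [e|] := boolP (vsupp v == [::]).
  case/negP: nz; apply/eqP/vcoef_inj => x; rewrite vcoef0; apply/eqP.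
  by rewrite -[_ == _]negbK -mem_vsupp (eqP e).
case E : (vsupp v) => [//|x s] _; exists x.
by rewrite -mem_vsupp E mem_head.
Qed.

End Coefficients.

(** Relational form of [lm], see [lmP]. Its strict companion [below] is stable under sums, so that
    leading monomials are checked term by term. *)
Definition is_lead k (lt : rel (mon * 'I_k)) (v : 'rV[S]_k) x :=
  vcoef v x != 0 /\ forall y, vcoef v y != 0 -> (y == x) || lt y x.

Definition below k (lt : rel (mon * 'I_k)) (v : 'rV[S]_k) x :=
  forall y, vcoef v y != 0 -> lt y x.

(** Well-foundedness is a field: it is proved directly for the lexicographic order and inherited by
    induced orders, without Dickson's lemma. *)
Record term_order k (lt : rel (mon * 'I_k)) : Prop := TermOrder {
  to_irr : irreflexive lt;
  to_trans : transitive lt;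
  to_total : forall x y, x != y -> lt x y || lt y x;
  to_shift : forall m x y, lt x y -> lt (shift m x) (shift m y);
  to_wf : well_founded (fun x y => lt x y) }.

Section Leads.

Variables (k : nat) (lt : rel (mon * 'I_k)).
Hypothesis T : term_order lt.
Implicit Types (v w : 'rV[S]_k) (x y z : mon * 'I_k).

Lemma belowN v x : below lt v x -> below lt (- v) x.
Proof. by move=> h y; rewrite vcoefN oppr_eq0; apply: h. Qed.

Lemma belowD v w x : below lt v x -> below lt w x -> below lt (v + w) x.
Proof.
move=> hv hw y; rewrite vcoefD => h.
have [e|/hv //] := eqVneq (vcoef v y) 0.
by apply: hw; move: h; rewrite e add0r.
Qed.

Lemma vcoef_below v x : below lt v x -> vcoef v x = 0.
Proof. by move=> h; apply/eqP/negP => /negP /h; rewrite (to_irr T). Qed.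

Lemma is_lead_uniq v x y : is_lead lt v x -> is_lead lt v y -> x = y.
Proof.
move=> [hx h1] [hy h2]; apply/eqP; apply/negP => /negP ne.
have := h1 _ hy; have := h2 _ hx; rewrite (negbTE ne) eq_sym (negbTE ne) /= => l1 l2.
by have := to_trans T l1 l2; rewrite (to_irr T).
Qed.

Lemma lmP v x : lm lt v = Some x <-> is_lead lt v x.
Proof.
have mem y : (y \in [seq t <- vsupp v | all (fun t' => (t' == t) || lt t' t) (vsupp v)])
    <-> is_lead lt v y.
  rewrite mem_filter mem_vsupp; split=> [/andP[/allP h1 h2]|[h1 h2]].
    by split=> // z; rewrite -mem_vsupp => /h1.
  by rewrite h1 andbT; apply/allP => z; rewrite mem_vsupp => /h2.
rewrite /lm; case E : [seq _ <- _ | _] mem => [|y s] mem /=; split=> //.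
- by move/mem.
- by case=> <-; apply/mem; rewrite mem_head.
- move=> h; congr Some; apply: (@is_lead_uniq v) => //.
  by apply/mem; rewrite mem_head.
Qed.

Lemma exists_lead v : v != 0 -> exists x, is_lead lt v x.
Proof.
case/vcoef_vsupp0 => x; rewrite -mem_vsupp => hx.
suff [y ys hy] : exists2 y, y \in vsupp v & forall z, z \in vsupp v -> (z == y) || lt z y.
  by exists y; split; [rewrite -mem_vsupp | move=> z; rewrite -mem_vsupp; apply: hy].
elim: (vsupp v) x hx => // a s IH x _.
have [->|bs] : s = [::] \/ exists b, b \in s.
- by case: (s) => [|b s']; [left | right; exists b; rewrite mem_head].
- by exists a; rewrite ?mem_head // => z; rewrite inE => /eqP ->; rewrite eqxx.
case: bs => b /IH [y ys hy].
have [e|ne] := eqVneq a y.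
  exists y; rewrite ?inE ?ys ?orbT // => z; rewrite inE => /orP[/eqP ->|/hy //].
  by rewrite e eqxx.
case/orP: (to_total T ne) => l.
  exists y; rewrite ?inE ?ys ?orbT // => z; rewrite inE => /orP[/eqP ->|/hy //].
  by rewrite l orbT.
exists a; rewrite ?mem_head // => z; rewrite inE => /orP[->//|/hy].
by case/orP=> [/eqP ->|l']; rewrite ?l ?orbT // (to_trans T l' l) orbT.
Qed.

Lemma below_sub v w x : (forall y, vcoef v y != 0 -> (y == x) || lt y x) ->
  (forall y, vcoef w y != 0 -> (y == x) || lt y x) -> vcoef w x = vcoef v x ->
  below lt (v - w) x.
Proof.
move=> hv hw e y; rewrite vcoefB => h.
have [E|ne] := eqVneq y x; first by move: h; rewrite E e subrr eqxx.
have [e0|/hv] := eqVneq (vcoef v y) 0; last by rewrite (negbTE ne).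
by move: h; rewrite e0 sub0r oppr_eq0 => /hw; rewrite (negbTE ne).
Qed.

Lemma is_lead_vmonom x v : below lt v x -> is_lead lt (vmonom_vec K x + v) x.
Proof.
move=> h; split; first by rewrite vcoefD vcoef_vmonom eqxx (vcoef_below h) addr0 oner_neq0.
move=> y; rewrite vcoefD vcoef_vmonom [x == y]eq_sym; case: (eqVneq y x) => //= _.
by rewrite add0r; apply: h.
Qed.

Lemma is_lead_shift m v x : is_lead lt v x -> is_lead lt ('X_[m] *: v) (shift m x).
Proof.
move=> [h1 h2]; split; first by rewrite vcoef_shift.
move=> y /vcoef_shift_neq0 [z /h2 h ->]; case/orP: h => [/eqP -> | h].
  by rewrite eqxx.
by rewrite (to_shift T _ h) orbT.
Qed.

End Leads.

(** * Orders induced by leading monomials *)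

Section Induced.

Variables (k t : nat) (lt : rel (mon * 'I_k)) (B : 'M[S]_(t, k)).
Variable nu : 'I_t -> mon * 'I_k.
Hypothesis T : term_order lt.
Hypothesis hnu : forall i, is_lead lt (row i B) (nu i).

Definition lead_image (x : mon * 'I_t) := shift x.1 (nu x.2).

Lemma induced_orderE x y : induced_order lt B x y =
  lt (lead_image x) (lead_image y) || (lead_image x == lead_image y) && (y.2 < x.2)%N.
Proof.
rewrite /induced_order.
have e z : lm lt ('X_[z.1] *: row z.2 B) = Some (lead_image z).
  by apply/(lmP T); apply: is_lead_shift.
by rewrite !e.
Qed.

Lemma lead_image_shift m x : lead_image (shift m x) = shift m (lead_image x).
Proof. by rewrite /lead_image /shift /= addmA. Qed.

Lemma induced_term_order : term_order (induced_order lt B).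
Proof.
split.
- by move=> x; rewrite induced_orderE (to_irr T) ltnn andbF.
- move=> y x z; rewrite !induced_orderE.
  case/orP=> [h1|/andP[/eqP -> h1]].
    case/orP=> [h2|/andP[/eqP <- h2]]; last by rewrite h1.
    by rewrite (to_trans T h1 h2).
  case/orP=> [->//|/andP[-> h2]].
  by rewrite (ltn_trans h2 h1) orbT.
- move=> x y ne; rewrite !induced_orderE.
  have [e|ne2] := eqVneq (lead_image x) (lead_image y); last first.
    by case/orP: (to_total T ne2) => ->; rewrite ?orbT.
  rewrite e (to_irr T) /=.
  have ne3 : x.2 != y.2.
    apply: contra ne => /eqP e2; move: e; rewrite /lead_image /shift e2.
    move/(congr1 (fun z => z.1 - (nu y.2).1)%MM) => /=; rewrite !addmK => e3.
    by rewrite [x]surjective_pairing e2 e3 -surjective_pairing.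
  by rewrite -neq_ltn eq_sym; move: ne3; rewrite -(inj_eq val_inj).
- move=> m x y; rewrite !induced_orderE !lead_image_shift.
  case/orP=> [h|/andP[/eqP -> ->]]; first by rewrite (to_shift T _ h).
  by rewrite eqxx orbT.
(* Induction on the image, then on [t - x.2]: among monomials with the same image, the smaller ones
   have the larger indices, which are bounded by [t]. *)
- move=> x; move E : (lead_image x) => z.
  elim: {z}(to_wf T z) x E => z _ IH x.
  have [j] := ubnP (t - x.2)%N; elim: j x => [x|j IHj x hj e]; first by rewrite ltn0.
  split=> y; rewrite induced_orderE => /orP[h|/andP[/eqP h1 h2]].
    by apply: IH (erefl _); rewrite -e.
  by apply: IHj; [have := ltn_ord y.2; lia | rewrite h1].
Qed.

Lemma mulmx_vsupp (v : 'rV[S]_t) :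
  v *m B = \sum_(x <- vsupp v) (vcoef v x)%:MP *: ('X_[x.1] *: row x.2 B).
Proof.
rewrite mulmx_sum_row /vsupp big_allpairs_dep /= big_enum /=.
apply: eq_bigr => i _; rewrite {1}[v 0 i]mpolyE scaler_suml.
by apply: eq_bigr => m _; rewrite scalerA mul_mpolyC.
Qed.

(** Any other monomial of [v] has a strictly smaller leading image, being smaller for the induced
    order and not tied. So the coefficient at [lead_image x] comes from [x] alone and cannot
    cancel. *)
Lemma lead_mulmx (v : 'rV[S]_t) x : is_lead (induced_order lt B) v x ->
  (forall y, vcoef v y != 0 -> lead_image y = lead_image x -> y = x) ->
  v *m B != 0.
Proof.
move=> [hx hlt] hinj; apply/eqP => e0.
have := vcoef0 (lead_image x); rewrite -e0 mulmx_vsupp vcoef_sum.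
rewrite (bigD1_seq x) ?vsupp_uniq ?mem_vsupp //= big1_seq; last first.
  move=> y /andP[ne]; rewrite mem_vsupp => hy.
  rewrite vcoefC; apply/eqP; rewrite mulf_eq0 orbC -[_ == 0]negbK; apply/orP; left.
  apply/negP => h.
  have [_ /(_ _ h)] := is_lead_shift T y.1 (hnu y.2).
  have := hlt _ hy; rewrite (negbTE ne) /= induced_orderE.
  have {}ne : lead_image y != lead_image x by apply: contra ne => /eqP /(hinj _ hy) ->.
  rewrite (negbTE ne) orbF -/(lead_image y) eq_sym (negbTE ne) /= => l1 l2.
  by have := to_trans T l1 l2; rewrite (to_irr T).
rewrite addr0 vcoefC /lead_image vcoef_shift => /eqP; rewrite mulf_eq0 (negbTE hx) /=.
by have [/negbTE ->] := hnu x.2.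
Qed.

End Induced.

(** * Division by the rows of a matrix, and kernels *)

Section Division.

Variables (t r : nat) (lt : rel (mon * 'I_t)) (A : 'M[S]_(r, t)).
Variable nu : 'I_r -> mon * 'I_t.
Hypothesis T : term_order lt.
Hypothesis hnu : forall i, is_lead lt (row i A) (nu i).

Definition standard (x : mon * 'I_t) :=
  [forall j, ~~ (((nu j).2 == x.2) && ((nu j).1 <= x.1)%MM)].

Lemma nonstandardP x : ~~ standard x -> exists j m, x = shift m (nu j).
Proof.
rewrite negb_forall => /existsP[j]; rewrite negbK => /andP[/eqP e l].
exists j, (x.1 - (nu j).1)%MM; rewrite /shift submK // e.
by case: (x).
Qed.

Lemma division_step v z : (forall y, vcoef v y != 0 -> (y == z) || lt y z) ->
  exists w s, below lt (v - w *m A - s) z /\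
    forall y, vcoef s y != 0 -> standard y /\ y = z.
Proof.
move=> hv.
have [st|/nonstandardP[j [m e]]] := boolP (standard z).
  exists 0, ((vcoef v z)%:MP *: vmonom_vec K z).
  have h y : vcoef ((vcoef v z)%:MP *: vmonom_vec K z) y != 0 -> y = z.
    by rewrite vcoefC vcoef_vmonom; case: (eqVneq z y) => // _; rewrite mulr0 eqxx.
  split=> [|y /h -> //]; rewrite mul0mx subr0.
  apply: below_sub => // [y /h ->|]; first by rewrite eqxx.
  by rewrite vcoefC vcoef_vmonom eqxx mulr1.
have [l0 _] := hnu j; set c := vcoef v z / vcoef (row j A) (nu j).
exists (c%:MP *: ('X_[m] *: delta_mx 0 j)), 0; split; last by move=> y; rewrite vcoef0 eqxx.
rewrite subr0 -!scalemxAl -rowE; apply: below_sub => //.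
  move=> y; rewrite vcoefC mulf_eq0 negb_or => /andP[_].
  by rewrite e; have [_] := is_lead_shift T m (hnu j); apply.
by rewrite vcoefC {1}e vcoef_shift /c divfK.
Qed.

Lemma division z v : below lt v z -> exists w s, v = w *m A + s /\
  forall y, vcoef s y != 0 -> standard y /\ lt y z.
Proof.
elim: {z}(to_wf T z) v => z _ IH v hv.
have [->|nz] := eqVneq v 0.
  by exists 0, 0; rewrite mul0mx addr0; split=> // y; rewrite vcoef0 eqxx.
have [z1 [hz1 hl]] := exists_lead T nz.
have lz : lt z1 z by apply: hv.
have [w [s [h1 h2]]] := division_step hl.
have [w' [s' [e h3]]] := IH _ lz _ h1.
exists (w + w'), (s + s'); split.
  by rewrite mulmxDl addrACA -e -[v - _ - _]addrA -opprD [RHS]addrC subrK.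
move=> y; rewrite vcoefD; have [->|/h2 [h4 e1] _] := eqVneq (vcoef s y) 0;
  last by split=> //; rewrite e1.
by rewrite add0r => /h3 [h4 h5]; split=> //; apply: (to_trans T) h5 lz.
Qed.

(** A predicate rather than the kernel of a matrix, so as to cover the kernel of [Phi0], which is
    not given by a matrix over S. *)
Variable N : 'rV[S]_t -> Prop.
Hypothesis NB : forall v w, N v -> N w -> N (v - w).
Hypothesis NA : forall w, N (w *m A).
Hypothesis Ninj : forall s, N s -> (forall y, vcoef s y != 0 -> standard y) -> s = 0.

(** If [x] were standard, keeping the leading term and dividing only the rest of [v] would leave a
    nonzero element of [N] supported on standard monomials. *)
Lemma kernel_lead v x : N v -> is_lead lt v x -> exists j m, x = shift m (nu j).
Proof.
move=> Nv [hx hl]; apply: nonstandardP; apply/negP => st.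
have hs y : vcoef ((vcoef v x)%:MP *: vmonom_vec K x) y != 0 -> y = x.
  by rewrite vcoefC vcoef_vmonom; case: (eqVneq x y) => // _; rewrite mulr0 eqxx.
have hc : vcoef ((vcoef v x)%:MP *: vmonom_vec K x) x = vcoef v x.
  by rewrite vcoefC vcoef_vmonom eqxx mulr1.
set u := _ *: _ in hs hc.
have hb : below lt (v - u) x.
  by apply: below_sub => // y /hs ->; rewrite eqxx.
have [w [s [e h]]] := division hb.
have s0 : u + s = 0.
  apply: Ninj.
    suff -> : u + s = v - w *m A by apply: NB.
    by apply/eqP; rewrite eq_sym subr_eq -addrA [s + _]addrC -e addrC subrK.
  move=> y; rewrite vcoefD; have [-> |/hs -> //] := eqVneq (vcoef u y) 0.
  by rewrite add0r => /h [].
have : vcoef (u + s) x = 0 by rewrite s0 vcoef0.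
have sx : vcoef s x = 0 by apply/eqP/negP => /negP /h []; rewrite (to_irr T).
by rewrite vcoefD sx addr0 hc; move/eqP: hx.
Qed.

Lemma kernel_image v : N v -> exists w, w *m A = v.
Proof.
move=> Nv; have [->|nz] := eqVneq v 0; first by exists 0; rewrite mul0mx.
have [z hz] := exists_lead T nz.
(* [division] requires a monomial strictly above the whole vector; one step at the leading monomial
   leaves a vector that is strictly below it. *)
have [w [s [h1 h2]]] := division_step hz.2.
have [w' [s' [e h3]]] := division h1.
have E : s + s' = v - (w + w') *m A.
  have -> : v = w *m A + s + (w' *m A + s').
    by rewrite -e -[v - _ - _]addrA -opprD [RHS]addrC subrK.
  by rewrite addrACA mulmxDl [RHS]addrC addKr.
exists (w + w'); apply/esym/eqP; rewrite -subr_eq0 -E; apply/eqP.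
apply: Ninj; first by rewrite E; apply: NB.
move=> y; rewrite vcoefD; have [-> |/h2 [h4 _]//] := eqVneq (vcoef s y) 0.
by rewrite add0r => /h3 [].
Qed.

End Division.
End FreeModules.

(** * The lexicographic order on monomials *)

Section Lex.

Local Notation mon := 'X_{1..5}.
Implicit Types (m : mon) (s : seq 'I_5).

Definition lexmon (s : seq 'I_5) (m m' : mon) : bool :=
  @Order.lt _ (seqlexi nat) [seq m v | v <- s] [seq m' v | v <- s].

Lemma lexmon_cons v s m m' :
  lexmon (v :: s) m m' = (m v < m' v)%N || (m v == m' v) && lexmon s m m'.
Proof.
rewrite /lexmon /= Order.SeqLexiOrder.ltxi_cons !leEnat.
by case: (ltngtP (m v) (m' v)).
Qed.

Lemma lexmon_irr s : irreflexive (lexmon s).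
Proof. by move=> m; rewrite /lexmon ltxx. Qed.

Lemma lexmon_trans s : transitive (lexmon s).
Proof. by move=> m' m m''; rewrite /lexmon; apply: lt_trans. Qed.

Lemma lexmon_total s m m' v : v \in s -> m v != m' v -> lexmon s m m' || lexmon s m' m.
Proof.
elim: s => // a s IH; rewrite inE !lexmon_cons => /orP[/eqP <-|hv] ne.
  by case: ltngtP ne.
by case: ltngtP => //= _; apply: IH.
Qed.

Lemma lexmon_add s k m m' : lexmon s (k + m)%MM (k + m')%MM = lexmon s m m'.
Proof.
elim: s => [|a s IH]; first by rewrite /lexmon /= !ltxx.
by rewrite !lexmon_cons IH !mnmDE ltn_add2l eqn_add2l.
Qed.

(** Only exponent sequences of the length of [s] are compared, which allows induction on [s]; over
    all lengths the lexicographic order is not well founded. *)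
Lemma lexmon_wf s : well_founded (fun m m' => lexmon s m m').
Proof.
elim: s => [|a s IH] m; first by split=> m'; rewrite /lexmon /= ltxx.
have [k] := ubnP (m a); elim: k m => [m|k IHk m hk]; first by rewrite ltn0.
elim: {m}(IH m) hk => m _ IHm hk; split=> m'; rewrite lexmon_cons.
case/orP=> [h|/andP[/eqP h h']]; last by apply: IHm; rewrite ?h.
by apply: IHk; apply: leq_trans h _; rewrite -ltnS.
Qed.

Lemma ord5 (v : 'I_5) : v \in [:: iT0; iT1; iX0; iX1; iX2].
Proof. by rewrite !inE -!val_eqE; case: v => -[|[|[|[|[|]]]]]. Qed.

Variables u d : nat.

Lemma lex_ltE x y : lex_lt u d x y = lexmon (lex_vars u d) x.1 y.1.
Proof. by []. Qed.

Lemma lex_term_order : term_order (lex_lt u d).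
Proof.
split.
- by move=> x; rewrite lex_ltE lexmon_irr.
- by move=> y x z; rewrite !lex_ltE; apply: lexmon_trans.
- move=> [m i] [m' i'] ne; rewrite !lex_ltE /=.
  have [v hv] : exists v, m v != m' v.
    apply/existsP; rewrite -negb_forall; apply: contra ne => /forallP h.
    have -> : m = m' by apply/mnmP => v; apply/eqP.
    by rewrite (ord1 i) (ord1 i').
  apply: lexmon_total hv; have := ord5 v; rewrite /lex_vars !inE.
  by case: ifP => _; rewrite !inE; do 4 case: (v == _).
- by move=> m x y; rewrite !lex_ltE lexmon_add.
- move=> [m i]; elim: {m}(lexmon_wf (lex_vars u d) m) i => m _ IH i.
  by split=> -[m' i']; rewrite lex_ltE => /IH; apply.
Qed.

Lemma lex_T0 (m m' : mon) i j : (m iT0 < m' iT0)%N -> lex_lt u d (m, i) (m', j).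
Proof.
by move=> h; rewrite lex_ltE /lex_vars; case: ifP => _; rewrite lexmon_cons h.
Qed.

End Lex.

(** * Monomials in coordinates, and bihomogeneous terms *)

Section Monomials.

Local Notation mon := 'X_{1..5}.

Definition mon5 (i j a b c : nat) : mon := [multinom nth 0%N [:: i; j; a; b; c] v | v < 5].

Lemma mon_eq (m m' : mon) : m iT0 = m' iT0 -> m iT1 = m' iT1 -> m iX0 = m' iX0 ->
  m iX1 = m' iX1 -> m iX2 = m' iX2 -> m = m'.
Proof.
move=> *; apply/mnmP => v; have := ord5 v; rewrite !inE.
by do 4 (case/orP=> [/eqP -> //|]); move/eqP ->.
Qed.

Lemma mon_le (m m' : mon) : (m <= m')%MM =
  [&& m iT0 <= m' iT0, m iT1 <= m' iT1, m iX0 <= m' iX0, m iX1 <= m' iX1 & m iX2 <= m' iX2]%N.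
Proof.
apply/mnm_lepP/idP => [h|]; first by rewrite !h.
case/and5P=> ? ? ? ? ? v; have := ord5 v; rewrite !inE.
by do 4 (case/orP=> [/eqP -> //|]); move/eqP ->.
Qed.

Lemma mon5P (m : mon) i j a b c : m iT0 = i -> m iT1 = j -> m iX0 = a ->
  m iX1 = b -> m iX2 = c -> m = mon5 i j a b c.
Proof. by move=> *; apply: mon_eq; rewrite !mnmE. Qed.

Lemma mon5D i j a b c i' j' a' b' c' : (mon5 i j a b c + mon5 i' j' a' b' c')%MM =
  mon5 (i + i') (j + j') (a + a') (b + b') (c + c').
Proof. by apply: mon5P; rewrite mnmDE !mnmE. Qed.

Lemma mon5_0 : mon5 0 0 0 0 0 = 0%MM.
Proof. by apply/esym/mon5P; rewrite mnm0E. Qed.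

Local Open Scope ring_scope.

Lemma mbideg_mon5 i j a b c : mbideg (mon5 i j a b c) = ((i + j)%N%:Z, (a + b + c)%N%:Z).
Proof. by rewrite /mbideg !mnmE. Qed.

Lemma mbidegD (m m' : mon) : mbideg (m + m')%MM = mbideg m + mbideg m'.
Proof.
by apply: injective_projections; rewrite /mbideg !mnmDE /= -PoszD;
  congr (Posz _); lia.
Qed.

Variable K : fieldType.

Lemma mpolyX_mon5 i j a b c : 'X_[mon5 i j a b c] =
  T0 K ^+ i * T1 K ^+ j * X0 K ^+ a * X1 K ^+ b * X2 K ^+ c.
Proof.
rewrite mpolyXE_id !big_ord_recl big_ord0 mulr1 !mulrA.
rewrite (_ : fintype.lift ord0 ord0 = iT1); last exact: val_inj.
rewrite (_ : fintype.lift ord0 (fintype.lift ord0 ord0) = iX0); last exact: val_inj.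
rewrite (_ : fintype.lift ord0 (fintype.lift ord0 (fintype.lift ord0 ord0)) = iX1);
  last exact: val_inj.
rewrite (_ : fintype.lift ord0 (fintype.lift ord0 (fintype.lift ord0 (fintype.lift ord0
  ord0))) = iX2); last exact: val_inj.
by rewrite (_ : ord0 = iT0) ?mnmE //; exact: val_inj.
Qed.

End Monomials.

Section Terms.

Variable K : fieldType.
Local Notation S := {mpoly K[5]}.
Local Notation mon := 'X_{1..5}.
Local Open Scope ring_scope.

Section Bihomogeneous.

Implicit Types (p q : S) (e : int * int).

Lemma bihomog0 e : bihomog e (0 : S).
Proof. by move=> m; rewrite msupp0. Qed.

Lemma bihomogN e p : bihomog e p -> bihomog e (- p).
Proof. by move=> h m; rewrite (perm_mem (msuppN p)); apply: h. Qed.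

Lemma bihomogD e p q : bihomog e p -> bihomog e q -> bihomog e (p + q).
Proof. by move=> hp hq m /msuppD_le; rewrite mem_cat => /orP[/hp|/hq]. Qed.

Lemma bihomogM e e' p q : bihomog e p -> bihomog e' q -> bihomog (e + e') (p * q).
Proof.
move=> hp hq m /msuppM_le /allpairsP[[m1 m2] /= [/hp <- /hq <- ->]].
exact: mbidegD.
Qed.

Lemma bihomogX m : bihomog (mbideg m) ('X_[m] : S).
Proof. by move=> m'; rewrite msuppX inE => /eqP ->. Qed.

Lemma bihomog_sum e (I : Type) (r : seq I) (F : I -> S) :
  (forall i, bihomog e (F i)) -> bihomog e (\sum_(i <- r) F i).
Proof.
move=> h; elim: r => [|i r IH]; rewrite ?big_nil ?big_cons; first exact: bihomog0.
exact: bihomogD.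
Qed.

Lemma bigraded_mapP (s t : nat) (degs : 'I_s -> int * int) (degt : 'I_t -> int * int)
    (A : 'M[S]_(s, t)) :
  (forall i j, bihomog (degs i - degt j) (A i j)) -> bigraded_map degs degt A.
Proof.
move=> h e v hv j; rewrite mxE; apply: bihomog_sum => i.
have -> : e - degt j = (e - degs i) + (degs i - degt j) by rewrite addrA subrK.
exact: bihomogM.
Qed.

End Bihomogeneous.

Section Term.

Variables (k : nat) (T : eqType) (f : 'I_k -> T).

(** Common form of [e1], where [f] is the successor, and of [e2_basis], where [f] reads the list of
    pairs. It is zero when [a] is not a value of [f]. *)
Definition indicator_row (a : T) : 'rV[S]_k := \row_j (f j == a)%:R.

Lemma below_term (lt : rel (mon * 'I_k)) (m : mon) a x :
  (forall i, f i = a -> lt (m, i) x) -> below lt ('X_[m] *: indicator_row a) x.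
Proof.
move=> h y; rewrite /vcoef !mxE; case: (f y.2 =P a) => [e|_].
  rewrite mulr1 mcoeffX; case: (m =P y.1) => [E _|_]; last by rewrite eqxx.
  by rewrite [y]surjective_pairing -E; apply: h.
by rewrite mulr0 mcoeff0 eqxx.
Qed.

Lemma term_vmonom (m : mon) i a : f i = a -> injective f ->
  'X_[m] *: indicator_row a = vmonom_vec K (m, i).
Proof.
move=> <- inj; rewrite /vmonom_vec; congr (_ *: _); apply/rowP => j.
by rewrite !mxE (inj_eq inj) eqxx.
Qed.

Lemma bihomog_term e (deg : 'I_k -> int * int) (m : mon) a j :
  (f j = a -> mbideg m = e - deg j) ->
  bihomog (e - deg j) (('X_[m] *: indicator_row a) 0 j).
Proof.
move=> h; rewrite !mxE; case: eqP => [/h <-|_]; rewrite ?mulr0 ?mulr1.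
  exact: bihomogX.
exact: bihomog0.
Qed.

Lemma minimal_term (m : mon) a j : m != 0%MM -> (('X_[m] *: indicator_row a) 0 j)@_0%MM = 0.
Proof.
move=> h; rewrite !mxE; case: eqP => _; rewrite ?mulr0 ?mulr1 ?mcoeff0 //.
by rewrite mcoeffX (negbTE h).
Qed.

End Term.

End Terms.

(** * The Rees algebra *)

Section ReesAlgebra.

Local Open Scope ring_scope.

Section Ideals.

Variables (A : comNzRingType) (I : A -> Prop).
Hypothesis I_add : forall a c, I a -> I c -> I (a + c).
Hypothesis I_mul : forall a c, I c -> I (a * c).

Lemma ideal_exp_add n a c : ideal_exp I n a -> ideal_exp I n c -> ideal_exp I n (a + c).
Proof.
case: n => //= n [k [y [z [hy hz ->]]]] [k' [y' [z' [hy' hz' ->]]]].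
pose glue (f : 'I_k -> A) (f' : 'I_k' -> A) (i : 'I_(k + k')) :=
  match fintype.split i with inl j => f j | inr j => f' j end.
exists (k + k')%N, (glue y y'), (glue z z'); split.
- by move=> i; rewrite /glue; case: fintype.split.
- by move=> i; rewrite /glue; case: fintype.split.
rewrite big_split_ord; congr (_ + _); apply: eq_bigr => i _; rewrite /glue.
  by rewrite (unsplitK (inl i)).
by rewrite (unsplitK (inr i)).
Qed.

Lemma ideal_exp_mul n a c : ideal_exp I n c -> ideal_exp I n (a * c).
Proof.
case: n => //= n [k [y [z [hy hz ->]]]].
exists k, (fun i => a * y i), z; split=> //; first by move=> i; apply: I_mul.
by rewrite mulr_sumr; apply: eq_bigr => i _; rewrite mulrA.
Qed.

Lemma ideal_exp0 n : ideal_exp I n 0.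
Proof.
case: n => //= n; exists 0%N, (fun _ => 0), (fun _ => 0).
by split=> [[]|[]|] //; rewrite big_ord0.
Qed.

Lemma ideal_exp_gen n a c : I a -> ideal_exp I n c -> ideal_exp I n.+1 (a * c).
Proof.
move=> ha hc; exists 1%N, (fun _ => a), (fun _ => c); split=> //.
by rewrite big_ord1.
Qed.

Lemma rees_add P Q : rees I P -> rees I Q -> rees I (P + Q).
Proof. by move=> hP hQ n; rewrite coefD; apply: ideal_exp_add. Qed.

Lemma rees_mulC a P : rees I P -> rees I (a%:P * P).
Proof. by move=> hP n; rewrite coefCM; apply: ideal_exp_mul. Qed.

Lemma rees_mulCX a P : I a -> rees I P -> rees I (a%:P * 'X * P).
Proof.
move=> ha hP [|n] //; rewrite -mulrA coefCM coefXM /=.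
exact: ideal_exp_gen.
Qed.

Lemma rees0 : rees I 0.
Proof. by move=> n; rewrite coef0; apply: ideal_exp0. Qed.

Lemma rees1 : rees I 1.
Proof. by move=> [|n] //; rewrite coef1; apply: (@ideal_exp0 n.+1). Qed.

End Ideals.

Lemma ideal_gen_add (A : comNzRingType) (G : seq A) a c :
  ideal_gen G a -> ideal_gen G c -> ideal_gen G (a + c).
Proof.
move=> [f ->] [f' ->]; exists (fun i => f i + f' i).
by rewrite -big_split; apply: eq_bigr => i _; rewrite mulrDl.
Qed.

Lemma ideal_gen_mul (A : comNzRingType) (G : seq A) a c :
  ideal_gen G c -> ideal_gen G (a * c).
Proof.
move=> [f ->]; exists (fun i => a * f i).
by rewrite mulr_sumr; apply: eq_bigr => i _; rewrite mulrA.
Qed.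

Lemma ideal_gen_nth (A : comNzRingType) (G : seq A) i :
  (i < size G)%N -> ideal_gen G G`_i.
Proof.
move=> hi; exists (fun j => (j == Ordinal hi)%:R).
rewrite (bigD1 (Ordinal hi)) //= eqxx mul1r big1 ?addr0 // => j /negbTE ->.
by rewrite mul0r.
Qed.

Variables (K : fieldType) (u d : nat).

Local Notation S := {mpoly K[5]}.
Local Notation R := {mpoly K[2]}.
Local Notation mon := 'X_{1..5}.
Local Notation I := (idealI K u d).

Definition phi : {rmorphism S -> {poly R}} :=
  mmap (polyC \o @mpolyC 2 K) (Phi0_var K u d).

Lemma phiE f : Phi0 K u d f = phi f.
Proof. by []. Qed.

Lemma phi_var i : phi 'X_i = Phi0_var K u d i.
Proof. by rewrite /phi /= mmapX mmap1U. Qed.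

Lemma idealI_gen (i : 'I_3) : I
  [:: 'X_jT0 ^+ d; 'X_jT0 ^+ (d - u) * 'X_jT1 ^+ u; 'X_jT1 ^+ d : R]`_i.
Proof. exact: ideal_gen_nth. Qed.

(** Closure of the Rees algebra under arbitrary products is avoided: the image of a monomial is
    built from 1 by multiplying by the image of one variable at a time. *)
Lemma rees_Phi0 f : rees I (Phi0 K u d f).
Proof.
have Iadd a c : I a -> I c -> I (a + c) by apply: ideal_gen_add.
have Imul a c : I c -> I (a * c) by apply: ideal_gen_mul.
have hvar i P : rees I P -> rees I (Phi0_var K u d i * P).
  have := ord5 i; rewrite !inE /Phi0_var.
  case/or4P => [/eqP ->|/eqP ->|/eqP ->|] /=.
  - by move=> hP; apply: rees_mulC.
  - by move=> hP; apply: rees_mulC.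
  - by move=> hP; apply: rees_mulCX => //; apply: (idealI_gen (@Ordinal 3 0 isT)).
  case/orP=> /eqP -> /= hP; apply: rees_mulCX => //.
    exact: (idealI_gen (@Ordinal 3 1 isT)).
  exact: (idealI_gen (@Ordinal 3 2 isT)).
have hpow i k P : rees I P -> rees I (Phi0_var K u d i ^+ k * P).
  by elim: k P => [|k IH] P hP; rewrite ?mul1r // exprS -mulrA; apply/hvar/IH.
rewrite /Phi0 /mmap; elim: (msupp f) => [|M s IH]; rewrite ?big_nil ?big_cons.
  exact: rees0.
apply: rees_add => //; apply: rees_mulC => //; rewrite /mmap1.
elim: (index_enum _) => [|i r IHr]; rewrite ?big_nil ?big_cons; first exact: rees1.
exact: hpow.
Qed.

Definition in_image (P : {poly R}) := exists f, phi f = P.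

Lemma in_image_sum (T : Type) (r : seq T) (F : T -> {poly R}) :
  (forall i, in_image (F i)) -> in_image (\sum_(i <- r) F i).
Proof.
move=> h; elim: r => [|i r [f hf]]; rewrite ?big_nil ?big_cons.
  by exists 0; rewrite rmorph0.
by have [g hg] := h i; exists (g + f); rewrite rmorphD hf hg.
Qed.

Lemma in_image_mul P Q : in_image P -> in_image Q -> in_image (P * Q).
Proof. by move=> [f <-] [g <-]; exists (f * g); rewrite rmorphM. Qed.

Lemma in_image_polyC (a : R) : in_image a%:P.
Proof.
rewrite [a]mpolyE raddf_sum /=; apply: in_image_sum => M.
rewrite -mul_mpolyC polyCM; apply: in_image_mul.
  by exists (a@_M)%:MP; rewrite /phi /= mmapC.
rewrite mpolyXE_id rmorph_prod /=.
elim: (index_enum _) => [|i r IHr]; rewrite ?big_nil ?big_cons.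
  by exists 1; rewrite rmorph1.
apply: in_image_mul => //.
have [E|E] : i = jT0 \/ i = jT1 by case: i => -[|[|//]] hi; [left|right]; apply: val_inj.
  by exists ('X_iT0 ^+ M i); rewrite rmorphXn /= phi_var E /Phi0_var /= polyC_exp.
by exists ('X_iT1 ^+ M i); rewrite rmorphXn /= phi_var E /Phi0_var /= polyC_exp.
Qed.

Lemma in_image_exp n a : ideal_exp I n a -> in_image (a%:P * 'X^n).
Proof.
elim: n a => [|n IH] a; first by rewrite mulr1 => _; apply: in_image_polyC.
move=> [k [y [z [hy hz ->]]]]; rewrite raddf_sum mulr_suml; apply: in_image_sum => i /=.
have -> : (y i * z i)%:P * 'X^(n.+1) = ((y i)%:P * 'X) * ((z i)%:P * 'X^n).
  by rewrite polyCM exprS; ring.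
apply: in_image_mul; last exact: IH (hz i).
have [c ->] := hy i; rewrite raddf_sum mulr_suml; apply: in_image_sum => j.
rewrite /= polyCM -mulrA; apply: in_image_mul; first exact: in_image_polyC.
case: j => -[|[|[|//]]] hj.
- by exists 'X_iX0; rewrite phi_var.
- by exists 'X_iX1; rewrite phi_var.
- by exists 'X_iX2; rewrite phi_var.
Qed.

Lemma rees_in_image P : rees I P -> in_image P.
Proof.
move=> hP; rewrite -[P]coefK poly_def; apply: in_image_sum => i.
by rewrite -mul_polyC; apply: in_image_exp.
Qed.

(** [Phi0] sends a monomial to a monomial: [Zdeg] is its exponent of Z and [Tpart] its factor in
    T_0, T_1. *)
Definition Zdeg (M : mon) : nat := (M iX0 + M iX1 + M iX2)%N.

Definition Tpart (M : mon) : 'X_{1..2} :=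
  (U_(jT0) *+ (M iT0 + d * M iX0 + (d - u) * M iX1)
   + U_(jT1) *+ (M iT1 + u * M iX1 + d * M iX2))%MM.

Lemma TpartE M : Tpart M jT0 = (M iT0 + d * M iX0 + (d - u) * M iX1)%N /\
  Tpart M jT1 = (M iT1 + u * M iX1 + d * M iX2)%N.
Proof. by rewrite /Tpart !mnmDE !mulmnE !mnm1E /=; lia. Qed.

Lemma rees_monomial (A : comNzRingType) (p r Z : A) (i j a c e dd uu w : nat) :
  p ^+ i * r ^+ j * (p ^+ dd * Z) ^+ a * (p ^+ w * r ^+ uu * Z) ^+ c * (r ^+ dd * Z) ^+ e
  = p ^+ (i + dd * a + w * c) * r ^+ (j + uu * c + dd * e) * Z ^+ (a + c + e).
Proof. by rewrite !exprMn !exprD !exprM; ring. Qed.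

Lemma mmap1_Phi0 M : mmap1 (Phi0_var K u d) M = ('X_[Tpart M])%:P * 'X^(Zdeg M).
Proof.
have -> : mmap1 (Phi0_var K u d) M = phi 'X_[M] by rewrite /phi /= mmapX.
rewrite {1}(_ : M = mon5 (M iT0) (M iT1) (M iX0) (M iX1) (M iX2)); last exact: mon5P.
rewrite mpolyX_mon5 !rmorphM !rmorphXn.
rewrite [phi (T0 K)]phi_var [phi (T1 K)]phi_var [phi (X0 K)]phi_var.
rewrite [phi (X1 K)]phi_var [phi (X2 K)]phi_var /Phi0_var /=.
rewrite /Zdeg /Tpart mpolyXD -!mpolyXn !polyCM !polyC_exp.
exact: rees_monomial.
Qed.

Lemma Phi0_coef f n (N : 'X_{1..2}) : ((Phi0 K u d f)`_n)@_N =
  \sum_(M <- msupp f) f@_M * ((Tpart M == N) && (Zdeg M == n))%:R.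
Proof.
rewrite /Phi0 /mmap coef_sum raddf_sum /=; apply: eq_bigr => M _.
rewrite mmap1_Phi0 coefCM coefCM coefXn mcoeffCM [n == _]eq_sym.
case: (Zdeg M == n); rewrite ?mulr1 ?mulr0 ?mcoeff0 ?andbF ?mulr0 //.
by rewrite mcoeffX andbT.
Qed.

Lemma Phi0_inj f : Phi0 K u d f = 0 ->
  {in msupp f &, forall M M', Tpart M = Tpart M' -> Zdeg M = Zdeg M' -> M = M'} -> f = 0.
Proof.
move=> h inj; apply/mpolyP => M; rewrite mcoeff0; apply/eqP/negP => /negP hM.
have hM' : M \in msupp f by rewrite mcoeff_msupp.
have := Phi0_coef f (Zdeg M) (Tpart M).
rewrite h coef0 mcoeff0 (bigD1_seq M) ?msupp_uniq //= !eqxx mulr1 big1_seq.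
  by rewrite addr0 => e; rewrite -e eqxx in hM.
move=> M' /andP[ne hM2]; case: andP => [[/eqP e1 /eqP e2]|_]; last by rewrite mulr0.
by rewrite (inj _ _ hM2 hM' e1 e2) eqxx in ne.
Qed.

Lemma Phi0_graded e f : (u <= d)%N -> bihomog e f -> bihomog_RZ d e (Phi0 K u d f).
Proof.
move=> hud he n N; rewrite mcoeff_msupp Phi0_coef => hN.
have [M hM [e1 e2]] : exists2 M, M \in msupp f & Tpart M = N /\ Zdeg M = n.
  have [/hasP[M hM /andP[/eqP e1 /eqP e2]]|/hasPn hno] :=
      boolP (has (fun M => (Tpart M == N) && (Zdeg M == n)) (msupp f)).
    by exists M.
  by move: hN; rewrite big1_seq ?eqxx // => M /andP[_ /hno /negbTE ->]; rewrite mulr0.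
rewrite -(he _ hM) /mbideg -e2 -/(Zdeg M); congr (_, _).
have -> : mdeg N = (N jT0 + N jT1)%N.
  rewrite mdegE big_ord_recl big_ord1; congr (N _ + N _)%N; exact: val_inj.
rewrite -e1 (TpartE M).1 (TpartE M).2 /Zdeg.
(* Each X_j contributes d to the degree in T_0, T_1, for X_1 as (d - u) + u, and the degree -d of Z
   removes it. *)
have h1 : ((d - u) * M iX1 + u * M iX1 = d * M iX1)%N by rewrite -mulnDl subnK.
rewrite !mulnDr; lia.
Qed.

End ReesAlgebra.

(** * Rows of a matrix as generators and as a Groebner basis *)

Section Generators.

Variable K : fieldType.

Local Notation S := {mpoly K[5]}.
Local Notation mon := 'X_{1..5}.

Local Open Scope ring_scope.

Variables (t r : nat) (A : 'M[S]_(r, t)) (G : seq 'rV[S]_t) (N : 'rV[S]_t -> Prop).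
Hypothesis hG : forall g, (g \in G) = [exists j, g == row j A].
Hypothesis hN : forall v, N v <-> exists w : 'rV_r, w *m A = v.

Lemma mem_rows g : g \in G -> exists j, g = row j A.
Proof. by rewrite hG => /existsP[j /eqP]; exists j. Qed.

Lemma rows_mem j : row j A \in G.
Proof. by rewrite hG; apply/existsP; exists j. Qed.

Lemma rows_ker j : N (row j A).
Proof. by apply/hN; exists (delta_mx 0 j); rewrite -rowE. Qed.

Lemma rows_generate : generates N G.
Proof.
move=> v; split=> [/hN[w <-]|[k [c [w [hw ->]]]]].
  exists r, (fun i => w 0 i), (fun i => row i A); rewrite -mulmx_sum_row.
  by split=> // i; apply: rows_mem.
have /fin_all_exists[J hJ] : forall i, exists j, w i = row j A.
  by move=> i; apply: mem_rows.
apply/hN; exists (\sum_(i < k) c i *: delta_mx 0 (J i)); rewrite mulmx_suml.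
by apply: eq_bigr => i _; rewrite -scalemxAl -rowE hJ.
Qed.

Lemma rows_groebner (lt : rel (mon * 'I_t)) (nu : 'I_r -> mon * 'I_t) :
  term_order lt -> (forall j, is_lead lt (row j A) (nu j)) ->
  (forall v z, N v -> is_lead lt v z -> exists j m, z = shift m (nu j)) ->
  groebner_basis lt N G.
Proof.
move=> T hnu hlead; split.
  move=> g /mem_rows[j ->]; split; first exact: rows_ker.
  by move=> e; have [] := hnu j; rewrite e vcoef0 eqxx.
move=> v; split=> -[k [c [w [hw ->]]]]; last first.
  exists k, c, w; split=> // i; have [g [z [/mem_rows[j ->] h1 h2]]] := hw i.
  by exists (row j A), z; split=> //; apply: rows_ker.
have /fin_all_exists[f hf] : forall i, exists mj : mon * 'I_r,
    w i = 'X_[mj.1] *: vmonom_vec K (nu mj.2).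
  move=> i; have [g [z [Ng /(lmP T) h1 ->]]] := hw i.
  have [j [m ->]] := hlead _ _ Ng h1.
  by exists (m, j); rewrite /vmonom_vec scalerA -mpolyXD.
exists k, (fun i => c i * 'X_[(f i).1]), (fun i => vmonom_vec K (nu (f i).2)); split.
  move=> i; exists (row (f i).2 A), (nu (f i).2); split=> //; first exact: rows_mem.
  exact/(lmP T).
by apply: eq_bigr => i _; rewrite hf scalerA.
Qed.

Hypothesis Ainj : forall w : 'rV_r, w *m A = 0 -> w = 0.

(** A row that could be dropped would be a combination of other rows, which injectivity excludes. *)
Lemma rows_minimal : minimal_generators N G.
Proof.
split; first exact: rows_generate.
move=> G' sub gen g /mem_rows[j ->]; apply/negPn/negP => nG'.
have /gen[k [c [w [hw e]]]] : N (row j A) by apply: rows_ker.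
have /fin_all_exists[J hJ] : forall i, exists j, w i = row j A.
  by move=> i; apply: mem_rows; apply: sub.
pose z : 'rV[S]_r := \sum_(i < k) c i *: delta_mx 0 (J i).
have e0 : ((delta_mx 0 j : 'rV[S]_r) - z) *m A = 0.
  rewrite /z mulmxBl -rowE e mulmx_suml; apply/eqP; rewrite subr_eq0; apply/eqP.
  by apply: eq_bigr => i _; rewrite -scalemxAl -rowE hJ.
have /rowP/(_ j) := Ainj e0.
rewrite /z !mxE summxE big1 ?subr0 ?eqxx => [/eqP|i _]; first by rewrite oner_eq0.
rewrite !mxE eqxx /=; case: eqP => [ej|_]; last by rewrite mulr0.
by case/negP: nG'; rewrite ej -hJ.
Qed.

Lemma rows_independent : linearly_independent (fun i => row i A).
Proof.
move=> c h i; have e0 : (\row_j c j) *m A = 0.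
  by rewrite mulmx_sum_row -[RHS]h; apply: eq_bigr => j _; rewrite mxE.
by have /rowP/(_ i) := Ainj e0; rewrite !mxE.
Qed.

End Generators.

(** * The syzygies and their leading monomials *)

Section KoszulIdentities.

Variables (R : comNzRingType) (k : nat).
Implicit Types (v w : 'rV[R]_k).
Local Open Scope ring_scope.

(** This identity and the next are the vanishing of [syz2 n *m Phi2] for rho(n) = n + 1 and for m(n)
    = n + 1. [P], [Q] are P_m, Q_m; [A * A'] and [B * B'] are the powers of T_0 and T_1 with
    exponent b_{n+1}, split along b_{n+1} = b_{m(n+1)} + b_{rho(n+1)}. *)
Lemma koszul_step (P Q Pn Qn A A' B B' : R) v1 v2 v3 w :
  P *: (Q *: v1 - A *: v2 - (B * B' * Qn) *: v3)
  - Q *: (P *: v1 - (A * A' * Pn) *: v3 - B *: v2)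
  + A *: (P *: v2 - (A' * (Pn * Q)) *: v3 - B *: w)
  - B *: (Q *: v2 - A *: w - (B' * (Qn * P)) *: v3) = 0.
Proof. by apply/rowP => j; rewrite !mxE; ring. Qed.

Lemma koszul_turn (P Q Pn Qn A A' B B' : R) v1 v2 v3 w :
  Q *: (P *: v1 - (A * Pn) *: v2 - (B * B') *: v3)
  - P *: (Q *: v1 - (A * A') *: v3 - (B * Qn) *: v2)
  + A *: ((Pn * Q) *: v2 - (A' * P) *: v3 - B *: w)
  - B *: ((Qn * P) *: v2 - A *: w - (B' * Q) *: v3) = 0.
Proof. by apply/rowP => j; rewrite !mxE; ring. Qed.

Lemma mulmx_lin3 l (x y z : R) v1 v2 v3 (M : 'M[R]_(k, l)) :
  (x *: v1 - y *: v2 - z *: v3) *m M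
  = x *: (v1 *m M) - y *: (v2 *m M) - z *: (v3 *m M).
Proof. by rewrite !mulmxBl -!scalemxAl. Qed.

Lemma mulmx_lin4 l (x y z t : R) v1 v2 v3 v4 (M : 'M[R]_(k, l)) :
  (x *: v1 - y *: v2 + z *: v3 - t *: v4) *m M
  = x *: (v1 *m M) - y *: (v2 *m M) + z *: (v3 *m M) - t *: (v4 *m M).
Proof. by rewrite !(mulmxBl, mulmxDl) -!scalemxAl. Qed.

Lemma opp_lin3 v1 v2 v3 : v1 - v2 - v3 = - (v3 + v2 - v1).
Proof. by rewrite opprB opprD addrA addrAC. Qed.

(** In this identity and the next the split exponent is b_n = b_m + b_rho, and the three binomials
    are F_n, F_m and F_rho, the last one being -F_{q+2} for n = q. *)
Lemma koszul_m (P Q Pn Qn A A' B B' : R) :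
  P *: (A * A' * Pn - B * B' * Qn)%:M - (A' * Pn) *: (A * P - B * Q)%:M
  - B *: (A' * (Pn * Q) - B' * (Qn * P))%:M = 0 :> 'M_1.
Proof. by rewrite !scale_scalar_mx -!raddfB /= -[RHS](raddf0 (@scalar_mx R 1)); congr (_%:M);
  ring. Qed.

Lemma koszul_rho (P Q Pn Qn A A' B B' : R) :
  Q *: (A * A' * Pn - B * B' * Qn)%:M - A *: (A' * (Pn * Q) - B' * (Qn * P))%:M
  - (B' * Qn) *: (A * P - B * Q)%:M = 0 :> 'M_1.
Proof. by rewrite !scale_scalar_mx -!raddfB /= -[RHS](raddf0 (@scalar_mx R 1)); congr (_%:M);
  ring. Qed.

End KoszulIdentities.

(** * Uniform formulas for the binomials and the syzygies *)

Section Resolution.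

Variables (K : fieldType) (u d : nat).
Hypothesis hu : (0 < u)%N.
Hypothesis hud : (2 * u < d)%N.
Hypothesis hcop : coprime u d.

Local Notation S := {mpoly K[5]}.
Local Notation mon := 'X_{1..5}.
Local Notation q := (q u d).
Local Notation m := (mm u d).
Local Notation r := (rho u d).
Local Notation b := (b_ u d).
Local Notation s := (sigma u d).
Local Notation t := (tau u d).
Local Notation x := (abs_sigma u d).
Local Notation y := (abs_tau u d).
Local Notation sigma_side := (sigma_side u d).
Local Notation e := (e1 K u d).

Local Open Scope ring_scope.

Let q2 : (1 < q)%N := q_ge2 hu hud hcop.

(** [lmon n] and [tmon n] are P_n and Q_n. They are coprime, one in X_1 and the other in X_0, X_2;
    for n <= q, [lmon n] involves the same variables as [tmon (m n)]. *)
Definition lmon n := if sigma_side n then mon5 0 0 0 (x n + y n) 0 else mon5 0 0 (x n) 0 (y n).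
Definition tmon n := if sigma_side n then mon5 0 0 (x n) 0 (y n) else mon5 0 0 0 (x n + y n) 0.
Definition T0mon i := mon5 i 0 0 0 0.
Definition T1mon i := mon5 0 i 0 0 0.

Lemma exponents n : (0 < n <= q.+1)%N ->
  ([/\ `|- s n| = x n, `|s n| = x n, `|- t n| = y n, `|t n| = y n
    & `|s n - t n| = x n + y n /\ `|t n - s n| = x n + y n])%N /\
  (s n <= 0) = ~~ sigma_side n /\ (0 < s n) = sigma_side n.
Proof.
move=> hn; have := sign_spec hu hud hcop hn; rewrite (sigma_sideE hu hud hcop); last by lia.
rewrite /abs_sigma /abs_tau; split; last by split; lia.
by split; [lia|lia|lia|lia|split; lia].
Qed.

Let monE := (mon5D, add0n, addn0, mpolyX_mon5, expr0, mulr1, mul1r).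

Lemma FE n : (0 < n <= q.+2)%N ->
  F K u d n = 'X_[(T0mon (b n) + lmon n)%MM] - 'X_[(T1mon (b n) + tmon n)%MM].
Proof.
move=> hn; rewrite /F /lmon /tmon /T0mon /T1mon; have [E|ne] := eqVneq n q.+2.
  have [hx hy] := xy_q2 hu hud hcop; have [_ _ hb] := b_last hu hud hcop.
  have [|_ [_ e2]] := @exponents q; first by lia.
  have [_ hp] := sigma_side_q hu hud hcop.
  rewrite E hb hx hy hp e2; case: (sigma_side q); rewrite /= !monE //.
    by have -> : (d - u + u = d)%N by lia.
  by have -> : (d - u + u = d)%N by lia.
have [|[h1 h2 h3 h4 [h5 h6]] [e1 _]] := @exponents n; first by lia.
by rewrite h1 h2 h3 h4 h5 h6 e1; case: (sigma_side n); rewrite /= !monE // mulrA.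
Qed.

Lemma lmon_tmon_rho n : (0 < n < q)%N -> lmon (r n) = (lmon n + tmon (m n))%MM /\
  tmon (r n) = (tmon n + lmon (m n))%MM.
Proof.
move=> hn; have hn' : (0 < n <= q)%N by lia.
rewrite /lmon /tmon (sigma_side_rho hu hud hcop hn) (sigma_side_mm hu hud hcop hn').
have [-> -> _] := xy_rho hu hud hcop hn'.
by case: (sigma_side n) => /=; rewrite !mon5D !add0n; split; congr mon5; lia.
Qed.

(** Compared with [lmon_tmon_rho], the two monomials are exchanged: this is the origin of the sign
    of e_{q+2}. *)
Lemma lmon_tmon_last : lmon q.+2 = (tmon q + lmon q.+1)%MM /\ tmon q.+2 = (lmon q + tmon
  q.+1)%MM.
Proof.
have hq : (0 < q <= q)%N by lia.
have [] := xy_rho hu hud hcop hq; have [-> ->] := mm_rho_q hu hud hcop.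
rewrite /lmon /tmon; have [-> ->] := sigma_side_q hu hud hcop => -> -> _.
by case: (sigma_side q) => /=; rewrite !mon5D !add0n; split; congr mon5; lia.
Qed.

Lemma s_rhoE n : (0 < n < q)%N -> s_rho K u d n =
  'X_[tmon (m n)] *: e n - 'X_[T0mon (b (m n))] *: e (r n)
  - 'X_[(T1mon (b (r n)) + tmon n)%MM] *: e (m n).
Proof.
move=> hn; have hn' : (0 < n <= q)%N by lia.
have hp := sigma_side_mm hu hud hcop hn'; have [hm _ _] := mm_bounds hu hud hcop hn'.
have [|[h1 h2 h3 h4 [h5 h6]] [e1 _]] := @exponents n; first by lia.
have [|[k1 k2 k3 k4 [k5 k6]] _] := @exponents (m n); first by lia.
rewrite /s_rho ?h1 ?h2 ?h3 ?h4 ?h5 ?h6 ?k1 ?k2 ?k3 ?k4 ?k5 ?k6 e1 /tmon hp /T0mon /T1mon.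
by case: (sigma_side n); rewrite /= !monE // mulrA.
Qed.

Lemma s_mE n : (0 < n < q)%N -> s_m K u d n =
  'X_[lmon (m n)] *: e n - 'X_[(T0mon (b (r n)) + lmon n)%MM] *: e (m n)
  - 'X_[T1mon (b (m n))] *: e (r n).
Proof.
move=> hn; have hn' : (0 < n <= q)%N by lia.
have hp := sigma_side_mm hu hud hcop hn'; have [hm _ _] := mm_bounds hu hud hcop hn'.
have [|[h1 h2 h3 h4 [h5 h6]] [e1 _]] := @exponents n; first by lia.
have [|[k1 k2 k3 k4 [k5 k6]] _] := @exponents (m n); first by lia.
rewrite /s_m ?h1 ?h2 ?h3 ?h4 ?h5 ?h6 ?k1 ?k2 ?k3 ?k4 ?k5 ?k6 e1 /lmon hp /T0mon /T1mon.
by case: (sigma_side n); rewrite /= !monE // mulrA.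
Qed.

Lemma s_qE : s_q K u d =
  'X_[lmon q.+1] *: e q - 'X_[lmon q] *: e q.+1 + 'X_[T1mon 1] *: e q.+2.
Proof.
have [hp _] := sigma_side_q hu hud hcop.
have [|[h1 h2 h3 h4 [h5 h6]] [_ e2]] := @exponents q; first by lia.
have [|[k1 k2 k3 k4 [k5 k6]] _] := @exponents q.+1; first by lia.
have sq : s q != 0 by apply: (sigma_neq0 hu hud hcop); lia.
have e1 : (s q < 0) = ~~ sigma_side q by rewrite -e2; lia.
rewrite /s_q ?h1 ?h2 ?h3 ?h4 ?h5 ?h6 ?k1 ?k2 ?k3 ?k4 ?k5 ?k6 e1 /lmon hp /T1mon.
by case: (sigma_side q); rewrite /= !monE expr1.
Qed.

Lemma s_q1E : s_q1 K u d =
  'X_[tmon q] *: e q.+1 - 'X_[T0mon 1] *: e q.+2 - 'X_[tmon q.+1] *: e q.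
Proof.
have [hp _] := sigma_side_q hu hud hcop.
have [|[h1 h2 h3 h4 [h5 h6]] _] := @exponents q; first by lia.
have [|[k1 k2 k3 k4 [k5 k6]] [e1 _]] := @exponents q.+1; first by lia.
rewrite /s_q1 ?h1 ?h2 ?h3 ?h4 ?h5 ?h6 ?k1 ?k2 ?k3 ?k4 ?k5 ?k6 e1 /tmon hp /T0mon.
by case: (sigma_side q); rewrite /= !monE expr1.
Qed.

(* [other n] is the element of {m(n), rho(n)} distinct from n + 1, and
   [step_cofactor n], [other_cofactor n] are the monomials by which
   s_{n,n+1} and s_{n,other n} enter the Koszul relation between them. *)
Definition other n := if r n == n.+1 then m n else r n.
Definition step_cofactor n := if r n == n.+1 then lmon (m n) else tmon (m n).
Definition other_cofactor n := if r n == n.+1 then tmon (m n) else lmon (m n).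

Lemma otherE n : (0 < n < q)%N ->
  [/\ other n = m n.+1, (n.+1 < other n <= q.+1)%N &
   (r n = n.+1 /\ m n = other n) \/ (m n = n.+1 /\ r n = other n)].
Proof.
move=> hn; have hn' : (0 < n <= q)%N by lia.
rewrite /other; case: (stepP hu hud hcop hn').
- by move=> _ -> hm -> _; rewrite eqxx; split=> //; left.
- by move=> _ -> hm -> _; rewrite ifF ?hm; [split=> //; right|lia].
- by move=> h; rewrite h ltnn andbF in hn.
Qed.

Lemma syz2E n : (0 < n < q)%N -> syz2 K u d n =
  'X_[step_cofactor n] *: e2 K u d n n.+1
  - 'X_[other_cofactor n] *: e2 K u d n (other n)
  + 'X_[T0mon (b (other n))] *: e2 K u d n.+1 (other n)
  - 'X_[T1mon (b (other n))] *: e2 K u d n.+1 (r n.+1).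
Proof.
move=> hn; have hn' : (0 < n <= q)%N by lia.
have hp := sigma_side_mm hu hud hcop hn'; have [hm _ _] := mm_bounds hu hud hcop hn'.
have [|[h1 h2 h3 h4 [h5 h6]] [e1 _]] := @exponents n; first by lia.
have [|[k1 k2 k3 k4 [k5 k6]] _] := @exponents (m n); first by lia.
have [_ _ hk] := otherE hn.
rewrite /syz2 ?h1 ?h2 ?h3 ?h4 ?h5 ?h6 ?k1 ?k2 ?k3 ?k4 ?k5 ?k6 e1.
rewrite /step_cofactor /other_cofactor /other /lmon /tmon hp /T0mon /T1mon.
have [er|ner] := eqVneq (r n) n.+1.
  by rewrite er; case: (sigma_side n); rewrite /= !monE.
have -> : m n = n.+1 by case: hk => -[] // h; rewrite h eqxx in ner.
by case: (sigma_side n); rewrite /= !monE.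
Qed.

Lemma indicator_row_mul k l (T : eqType) (f : 'I_k -> T) (B : 'M[S]_(k, l)) j :
  injective f -> indicator_row K f (f j) *m B = row j B.
Proof.
move=> inj; rewrite rowE; congr (_ *m _); apply/rowP => i.
by rewrite !mxE (inj_eq inj) eqxx.
Qed.

Definition basis_index (j : 'I_q.+2) := j.+1.

Lemma basis_index_inj : injective basis_index.
Proof. by move=> i j [] /val_inj. Qed.

Lemma basis_index_onto n : (0 < n <= q.+2)%N -> basis_index (inord n.-1) = n.
Proof. by move=> hn; rewrite /basis_index inordK; lia. Qed.

Lemma e1_mul n l (B : 'M[S]_(q.+2, l)) : (0 < n <= q.+2)%N ->
  e n *m B = row (inord n.-1) B.
Proof.
by move=> hn; rewrite -(indicator_row_mul B _ basis_index_inj) (basis_index_onto hn).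
Qed.

Lemma e1_Phi1 n : (0 < n <= q.+2)%N -> e n *m Phi1 K u d = (F K u d n)%:M.
Proof.
move=> hn; rewrite e1_mul //; apply/rowP => i; rewrite (ord1 i) !mxE eqxx mulr1n.
by have /= := basis_index_onto hn; rewrite /basis_index => ->.
Qed.

(* e_{q+2} enters the last two syzygies with the opposite sign of e_{rho(n)} in
   the others. *)
Definition e_rho n : 'rV[S]_(q.+2) := if n == q then - e q.+2 else e (r n).

(** [gen_m] and [gen_rho] give all first syzygies by formulas valid for n <= q; [gen_rho q] is
    -s_{q+1,q+2}, see [syz1_last]. *)
Definition gen_m n : 'rV[S]_(q.+2) :=
  'X_[lmon (m n)] *: e n - 'X_[(T0mon (b (r n)) + lmon n)%MM] *: e (m n)
  - 'X_[T1mon (b (m n))] *: e_rho n.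

Definition gen_rho n : 'rV[S]_(q.+2) :=
  'X_[tmon (m n)] *: e n - 'X_[T0mon (b (m n))] *: e_rho n
  - 'X_[(T1mon (b (r n)) + tmon n)%MM] *: e (m n).

Lemma T0mon0 : T0mon 0 = 0%MM. Proof. exact: mon5_0. Qed.
Lemma T1mon0 : T1mon 0 = 0%MM. Proof. exact: mon5_0. Qed.

Lemma syz1_m n : (0 < n <= q)%N -> syz1 K u d (n, m n) = gen_m n.
Proof.
move=> hn; rewrite /syz1 /gen_m /e_rho; have [E|ne] := eqVneq n q.
  have [e1 e2 e3] := b_last hu hud hcop; have [f1 f2] := mm_rho_q hu hud hcop.
  by rewrite E f1 f2 e2 e3 T0mon0 add0m s_qE scalerN opprK.
have -> : (n == q.+1) = false by lia.
have hn' : (0 < n < q)%N by lia.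
rewrite ifF ?s_mE //; have [_ h1] := otherE hn'; lia.
Qed.

Lemma syz1_rho n : (0 < n < q)%N -> syz1 K u d (n, r n) = gen_rho n.
Proof.
move=> hn; rewrite /syz1 /gen_rho /e_rho.
have -> : (n == q.+1) = false by lia.
have -> : (n == q) = false by lia.
by rewrite eqxx s_rhoE.
Qed.

Lemma syz1_last : syz1 K u d (q.+1, q.+2) = - gen_rho q.
Proof.
have [e1 e2 e3] := b_last hu hud hcop; have [f1 f2] := mm_rho_q hu hud hcop.
rewrite /syz1 /gen_rho /e_rho eqxx ifF; last by lia.
rewrite eqxx f1 f2 e2 e3 T1mon0 add0m s_q1E scalerN opprK.
exact: opp_lin3.
Qed.

Lemma T0monD i j : T0mon (i + j) = (T0mon i + T0mon j)%MM.
Proof. by rewrite /T0mon mon5D. Qed.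
Lemma T1monD i j : T1mon (i + j) = (T1mon i + T1mon j)%MM.
Proof. by rewrite /T1mon mon5D. Qed.

Lemma F_rho n : (0 < n <= q)%N -> e_rho n *m Phi1 K u d =
  ('X_[(T0mon (b (r n)) + (lmon n + tmon (m n)))%MM]
   - 'X_[(T1mon (b (r n)) + (tmon n + lmon (m n)))%MM])%:M.
Proof.
move=> hn; rewrite /e_rho; have [E|ne] := eqVneq n q.
  have [e1 e2 e3] := b_last hu hud hcop; have [f1 f2] := mm_rho_q hu hud hcop.
  have [p1 p2] := lmon_tmon_last.
  rewrite mulNmx e1_Phi1; last by lia.
  rewrite FE; last by lia.
  by rewrite E f1 f2 p1 p2 e3 T0mon0 T1mon0 !add0m -raddfN opprB.
have [_ h _] := mm_bounds hu hud hcop hn.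
rewrite e1_Phi1 ?FE; try lia.
by have [|-> ->] := @lmon_tmon_rho n; first by lia.
Qed.

Lemma gen_Phi1 n : (0 < n <= q)%N ->
  gen_m n *m Phi1 K u d = 0 /\ gen_rho n *m Phi1 K u d = 0.
Proof.
move=> hn; have [h1 _ _] := mm_bounds hu hud hcop hn.
have [_ _ hb] := xy_rho hu hud hcop hn.
rewrite /gen_m /gen_rho !mulmx_lin3 (F_rho hn) !e1_Phi1 ?FE; try lia.
rewrite hb !T0monD !T1monD !mpolyXD.
by split; [exact: koszul_m | exact: koszul_rho].
Qed.

(** * The indexing of the first syzygies *)

Local Notation pairs := (pairs u d).
Local Notation pair_at := (pair_at u d).

Lemma pairsP p : reflect
  [\/ exists2 n, (0 < n < q)%N & p = (n, m n), exists2 n, (0 < n < q)%N & p = (n, r n),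
      p = (q, q.+1) | p = (q.+1, q.+2)] (p \in pairs).
Proof.
rewrite /Defs.pairs mem_sort !mem_cat !inE.
apply: (iffP idP) => [/or3P[|/mapP[n]|]|].
- by case/mapP=> n; rewrite mem_iota => hn ->; apply: Or41; exists n; [lia|].
- by rewrite mem_iota => hn ->; apply: Or42; exists n; [lia|].
- by case/orP=> /eqP ->; [apply: Or43 | apply: Or44].
case=> [[n hn ->]|[n hn ->]|->|->]; rewrite ?eqxx ?orbT //.
  by rewrite map_f // mem_iota; lia.
by rewrite [X in _ || (X || _)]map_f ?orbT // mem_iota; lia.
Qed.

Lemma mm_rho_neq n : (0 < n < q)%N -> m n != r n.
Proof. by move=> hn; have [_ h1] := otherE hn; lia. Qed.

Lemma pairs_uniq : uniq pairs.
Proof.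
rewrite /Defs.pairs sort_uniq !cat_uniq !map_inj_uniq ?iota_uniq; try by move=> i j [].
apply/and5P; split=> //; last by rewrite /= inE xpair_eqE; lia.
- apply/hasPn => p; rewrite mem_cat => /orP[/mapP[n] | ].
    rewrite mem_iota => hn ->; apply/negP => /mapP[n' _ [<- h]].
    by have := @mm_rho_neq n; rewrite h eqxx; lia.
  by rewrite !inE => /orP[] /eqP ->; apply/negP => /mapP[n]; rewrite mem_iota => hn []; lia.
- apply/hasPn => p; rewrite !inE => /orP[] /eqP ->; apply/negP => /mapP[n];
  by rewrite mem_iota => hn []; lia.
Qed.

Lemma size_pairs : size pairs = (2 * q)%N.
Proof. by rewrite /Defs.pairs size_sort !size_cat !size_map !size_iota /=; lia. Qed.

Definition pair_of (j : 'I_(2 * q)) := pair_at j.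

Lemma pair_of_inj : injective pair_of.
Proof.
move=> i j /eqP; rewrite /pair_of /Defs.pair_at nth_uniq ?size_pairs ?pairs_uniq //.
by move/eqP/val_inj.
Qed.

Lemma pair_of_mem j : pair_of j \in pairs.
Proof. by rewrite /pair_of mem_nth // size_pairs. Qed.

Lemma pair_of_onto p : p \in pairs -> exists j, pair_of j = p.
Proof.
move=> hp; have h : (index p pairs < 2 * q)%N by rewrite -size_pairs index_mem.
by exists (Ordinal h); rewrite /pair_of /Defs.pair_at nth_index.
Qed.

(** Ties in the induced order are broken by positions in the sorted list; this reduces them to
    comparing pairs. *)
Lemma pair_of_lt i j : pair_lex (pair_of i) (pair_of j) -> pair_of i != pair_of j -> (i < j)%N.
Proof.
have tr : transitive pair_lex by move=> [? ?] [? ?] [? ?]; rewrite /pair_lex /=; lia.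
have to : total pair_lex by move=> [? ?] [? ?]; rewrite /pair_lex /=; lia.
have re : reflexive pair_lex by move=> [? ?]; rewrite /pair_lex /=; lia.
move=> h ne; rewrite ltnNge; apply: contra ne => hij.
have h2 : pair_lex (pair_of j) (pair_of i).
  apply: (sorted_leq_nth tr re) => //; rewrite ?inE ?size_pairs //.
  exact: sort_sorted.
move: h h2; case: (pair_of i) (pair_of j) => [a1 a2] [c1 c2]; rewrite /pair_lex /= xpair_eqE;
  lia.
Qed.

Lemma e2_basis_mul p l (B : 'M[S]_(2 * q, l)) j : pair_of j = p ->
  e2_basis K u d p.1 p.2 *m B = row j B.
Proof.
by move=> <-; rewrite -(indicator_row_mul B _ pair_of_inj) /e2_basis; congr (_ *m _).
Qed.

Lemma e2_basis_Phi2 n k : (n, k) \in pairs ->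
  e2_basis K u d n k *m Phi2 K u d = syz1 K u d (n, k).
Proof.
case/pair_of_onto=> j hj; rewrite (e2_basis_mul _ hj); apply/rowP => i.
by rewrite !mxE -hj.
Qed.

Lemma e2_Phi2 n : (0 < n <= q)%N ->
  e2 K u d n (m n) *m Phi2 K u d = gen_m n /\ e2 K u d n (r n) *m Phi2 K u d = gen_rho n.
Proof.
move=> hn; rewrite /e2 !xpair_eqE; have [E|ne] := eqVneq n q; last first.
  have hn' : (0 < n < q)%N by lia.
  rewrite !e2_basis_Phi2 ?syz1_m ?syz1_rho //; apply/pairsP.
    by apply: Or42; exists n.
  by apply: Or41; exists n.
have [f1 f2] := mm_rho_q hu hud hcop.
rewrite E f1 f2 eqxx ifF; last by lia.
have p1 : (q, q.+1) \in pairs by apply/pairsP; apply: Or43.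
have p2 : (q.+1, q.+2) \in pairs by apply/pairsP; apply: Or44.
rewrite mulNmx !e2_basis_Phi2 // syz1_last opprK; split=> //.
by have := @syz1_m q; rewrite f1; apply; lia.
Qed.

Lemma e2_Phi2_cases n : (0 < n < q)%N ->
  e2 K u d n n.+1 *m Phi2 K u d = (if r n == n.+1 then gen_rho n else gen_m n) /\
  e2 K u d n (other n) *m Phi2 K u d = (if r n == n.+1 then gen_m n else gen_rho n).
Proof.
move=> hn; have hn' : (0 < n <= q)%N by lia.
have [<- <-] := e2_Phi2 hn'; have [_ h [[h1 ->]|[-> h1]]] := otherE hn.
  by rewrite h1 eqxx.
by rewrite h1 (_ : (other n == n.+1) = false) //; lia.
Qed.

Lemma syz2_Phi2 n : (0 < n < q)%N -> syz2 K u d n *m Phi2 K u d = 0.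
Proof.
move=> hn; have hn1 : (0 < n.+1 <= q)%N by lia.
have hn' : (0 < n <= q)%N by lia.
rewrite (syz2E hn) mulmx_lin4.
have [-> ->] := e2_Phi2_cases hn; have [eo ho hc] := otherE hn.
rewrite {2}eo; have [-> ->] := e2_Phi2 hn1.
have [_ _ hb] := xy_rho hu hud hcop hn1; have [_ _ hb'] := xy_rho hu hud hcop hn'.
have [hP hQ] := lmon_tmon_rho hn; have nq : (n == q) = false by lia.
rewrite /gen_m /gen_rho /step_cofactor /other_cofactor /e_rho nq -eo.
rewrite -eo in hb.
move: (if n.+1 == q then - e q.+2 else e (r n.+1)) => e'.
case: hc => -[h1 h2].
  rewrite h1 eqxx h2 in hP hQ hb' *; rewrite hP hQ hb !mpolyXD !T0monD !T1monD !mpolyXD.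
  move: (e n) (e n.+1) (e (other n)) => v1 v2 v3.
exact: koszul_step.
have -> : (r n == n.+1) = false by rewrite h2; lia.
rewrite h1 h2 in hP hQ hb' *; rewrite hP hQ hb.
rewrite !mpolyXD !T0monD !T1monD !mpolyXD.
move: (e n) (e n.+1) (e (other n)) => v1 v2 v3.
exact: koszul_turn.
Qed.

(** * Leading monomials of the rows of the three matrices *)

Lemma T0monE i : [/\ T0mon i iT0 = i, T0mon i iT1 = 0, T0mon i iX0 = 0, T0mon i iX1 = 0 &
  T0mon i iX2 = 0]%N.
Proof. by rewrite /T0mon !mnmE. Qed.

Lemma T1monE i : [/\ T1mon i iT0 = 0, T1mon i iT1 = i, T1mon i iX0 = 0, T1mon i iX1 = 0 &
  T1mon i iX2 = 0]%N.
Proof. by rewrite /T1mon !mnmE. Qed.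

Lemma lmonE n : [/\ lmon n iT0 = 0, lmon n iT1 = 0, lmon n iX0 = if sigma_side n then 0 else
  x n,
  lmon n iX1 = if sigma_side n then x n + y n else 0 & lmon n iX2 = if sigma_side n then 0
    else y n]%N.
Proof. by rewrite /lmon; case: ifP; rewrite !mnmE. Qed.

Lemma tmonE n : [/\ tmon n iT0 = 0, tmon n iT1 = 0, tmon n iX0 = if sigma_side n then x n
  else 0,
  tmon n iX1 = if sigma_side n then 0 else x n + y n & tmon n iX2 = if sigma_side n then y n
    else 0]%N.
Proof. by rewrite /tmon; case: ifP; rewrite !mnmE. Qed.

Lemma below_vmonom k (lt : rel (mon * 'I_k)) z z' :
  lt z z' -> below lt (vmonom_vec K z) z'.
Proof.
by move=> h z1; rewrite vcoef_vmonom; case: (eqVneq z z1) => [<- //|_]; rewrite eqxx.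
Qed.

(** F_{q+2} does not involve T_0, so the order of X_0 and X_1 decides; [lex_vars] chooses it by the
    sign of sigma_q to this end. *)
Lemma lex_last i j : lex_lt u d (tmon q.+2, i) (lmon q.+2, j).
Proof.
have [hx hy] := xy_q2 hu hud hcop; have [_ hp] := sigma_side_q hu hud hcop.
have [|_ [_ e2]] := @exponents q; first by lia.
have [p1 p2 p3 p4 p5] := lmonE q.+2; have [r1 r2 r3 r4 r5] := tmonE q.+2.
rewrite hx hy hp in p3 p4 p5 r3 r4 r5.
rewrite lex_ltE /lex_vars e2 /=.
case: (sigma_side q) p3 p4 p5 r3 r4 r5 => /= p3 p4 p5 r3 r4 r5;
by rewrite !lexmon_cons p1 p2 p3 p4 r1 r2 r3 r4; lia.
Qed.

Definition nu0 (i : 'I_q.+2) : mon * 'I_1 :=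
  ((T0mon (b (basis_index i)) + lmon (basis_index i))%MM, ord0).

Lemma lead0 i : is_lead (lex_lt u d) (row i (Phi1 K u d)) (nu0 i).
Proof.
have -> : row i (Phi1 K u d) =
    vmonom_vec K (nu0 i) - vmonom_vec K ((T1mon (b (basis_index i)) + tmon (basis_index
      i))%MM, ord0).
  apply/rowP => j; rewrite /vmonom_vec (ord1 j) !mxE /= !mulr1.
  by rewrite -FE // /basis_index; have := ltn_ord i; lia.
apply: (is_lead_vmonom (lex_term_order u d)); apply: belowN; apply: below_vmonom; rewrite /nu0.
have hi : (0 < basis_index i <= q.+2)%N by rewrite /basis_index; have := ltn_ord i; lia.
have [h|h] := leqP (basis_index i) q.+1; last first.
  have -> : basis_index i = q.+2 by lia.
  have [_ _ ->] := b_last hu hud hcop.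
  by rewrite T0mon0 T1mon0 !add0m lex_last.
apply: lex_T0; rewrite !mnmDE; have [-> _ _ _ _] := T0monE (b (basis_index i)).
have [-> _ _ _ _] := T1monE (b (basis_index i)); have [-> _ _ _ _] := lmonE (basis_index i).
have [-> _ _ _ _] := tmonE (basis_index i); rewrite !addn0.
by apply: (b_gt0 hu hud hcop); lia.
Qed.

Let T0ord := lex_term_order u d.

Lemma order_F0E z z' : order_F0 K u d z z' =
  lex_lt u d (lead_image nu0 z) (lead_image nu0 z')
  || (lead_image nu0 z == lead_image nu0 z') && (z'.2 < z.2)%N.
Proof. by rewrite /order_F0 (induced_orderE T0ord lead0). Qed.

Lemma order_F0_term : term_order (order_F0 K u d).
Proof. exact: induced_term_order T0ord lead0. Qed.

Lemma lead_image_T0 (z : mon * 'I_q.+2) n : basis_index z.2 = n ->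
  (lead_image nu0 z).1 iT0 = (z.1 iT0 + b n)%N.
Proof.
move=> <-; rewrite /= !mnmDE; have [-> _ _ _ _] := T0monE (b (basis_index z.2)).
by have [-> _ _ _ _] := lmonE (basis_index z.2); rewrite addn0.
Qed.

Lemma order_F0_T0 (mu mu' : mon) (i i' : 'I_q.+2) n n' : basis_index i = n ->
  basis_index i' = n' ->
  (mu iT0 + b n < mu' iT0 + b n')%N -> order_F0 K u d (mu, i) (mu', i').
Proof.
move=> hn hn' h; rewrite order_F0E; apply/orP; left; apply: lex_T0.
have := @lead_image_T0 (mu, i) _ hn; have := @lead_image_T0 (mu', i') _ hn'.
by rewrite /= => -> ->.
Qed.

Lemma order_F0_tie (mu mu' : mon) (i i' : 'I_q.+2) n n' : basis_index i = n ->
  basis_index i' = n' ->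
  (mu + (T0mon (b n) + lmon n) = mu' + (T0mon (b n') + lmon n'))%MM -> (n' < n)%N ->
  order_F0 K u d (mu, i) (mu', i').
Proof.
move=> hn hn' h lt; rewrite order_F0E; apply/orP; right; apply/andP; split.
  by rewrite /lead_image /shift /nu0 /= hn hn' h.
by move: hn hn'; rewrite /basis_index /=; lia.
Qed.

Definition syz1_lmon (p : nat * nat) : mon :=
  if p.1 == q.+1 then tmon q else if p.2 == m p.1 then lmon (m p.1) else tmon (m p.1).

Definition nu1 (j : 'I_(2 * q)) : mon * 'I_q.+2 :=
  (syz1_lmon (pair_of j), inord (pair_of j).1.-1).

Lemma row_Phi2 j : row j (Phi2 K u d) = syz1 K u d (pair_of j).
Proof. by apply/rowP => i; rewrite !mxE. Qed.

Lemma below_e_rho lt mu n z : (0 < n <= q)%N ->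
  below lt ('X_[mu] *: e (r n)) z -> below lt ('X_[mu] *: e_rho n) z.
Proof.
move=> hn h; rewrite /e_rho; have [E|//] := eqVneq n q.
by rewrite scalerN; apply: belowN; move: h; rewrite E (mm_rho_q hu hud hcop).2.
Qed.

Lemma e1_vmonom mu n : (0 < n <= q.+2)%N ->
  'X_[mu] *: e n = vmonom_vec K (mu, inord n.-1 : 'I_q.+2).
Proof. by move=> hn; rewrite -(term_vmonom _ _ (basis_index_onto hn) basis_index_inj). Qed.

(** The terms at e_n and e_m tie at T_0^{b_n} P_n P_m and the smaller index wins; the term at e_rho
    has lost a factor T_0^{b_m}. *)
Lemma lead_gen_m n : (0 < n <= q)%N ->
  is_lead (order_F0 K u d) (gen_m n) (lmon (m n), inord n.-1).
Proof.
move=> hn; have [h1 h2 h3] := mm_bounds hu hud hcop hn.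
have [_ _ hb] := xy_rho hu hud hcop hn.
rewrite /gen_m -addrA e1_vmonom; last by lia.
have hi : basis_index (inord n.-1) = n by apply: basis_index_onto; lia.
have bm : (0 < b (m n))%N by apply: (b_gt0 hu hud hcop); lia.
apply: (is_lead_vmonom order_F0_term); apply: belowD; apply: belowN.
  apply: below_term => i ei; apply: (order_F0_tie ei hi) => /=; last by lia.
  rewrite hb !T0monD; apply/mnmP => v; rewrite !mnmDE; lia.
apply: below_e_rho => //; apply: below_term => i ei; apply: (order_F0_T0 ei hi) => /=.
have [-> _ _ _ _] := T1monE (b (m n)); have [-> _ _ _ _] := lmonE (m n); lia.
Qed.

(** Here e_n ties with e_rho, and the term at e_m is smaller because b_rho > 0, which fails for n =
    q. *)
Lemma lead_gen_rho n : (0 < n < q)%N ->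
  is_lead (order_F0 K u d) (gen_rho n) (tmon (m n), inord n.-1).
Proof.
move=> hn; have hn' : (0 < n <= q)%N by lia.
have [h1 h2 h3] := mm_bounds hu hud hcop hn'; have [hP _] := lmon_tmon_rho hn.
have [_ _ hb] := xy_rho hu hud hcop hn'.
rewrite /gen_rho -addrA e1_vmonom; last by lia.
have hi : basis_index (inord n.-1) = n by apply: basis_index_onto; lia.
have br : (0 < b (r n))%N by apply: (b_gt0 hu hud hcop); lia.
apply: (is_lead_vmonom order_F0_term); apply: belowD; apply: belowN.
  apply: below_e_rho => //.
  apply: below_term => i ei; apply: (order_F0_tie ei hi) => /=; last by lia.
  rewrite hb hP !T0monD; apply/mnmP => v; rewrite !mnmDE; lia.
apply: below_term => i ei; apply: (order_F0_T0 ei hi) => /=.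
rewrite mnmDE; have [-> _ _ _ _] := T1monE (b (r n)); have [-> _ _ _ _] := tmonE n.
have [-> _ _ _ _] := tmonE (m n); lia.
Qed.

(** All three terms have T_0-exponent 1. Those at e_{q+1} and e_{q+2} tie at T_0 P_{q+2}, while the
    one at e_q gives T_0 Q_{q+2}, smaller by [lex_last]. So the leading basis vector is e_{q+1}. *)
Lemma lead_s_q1 : is_lead (order_F0 K u d) (s_q1 K u d) (tmon q, inord q).
Proof.
have [b1 b2 b3] := b_last hu hud hcop; have [P1 Q1] := lmon_tmon_last.
rewrite s_q1E -addrA e1_vmonom; last by lia.
have hi : basis_index (inord q) = q.+1 by apply: (@basis_index_onto q.+1); lia.
apply: (is_lead_vmonom order_F0_term); apply: belowD; apply: belowN.
  apply: below_term => i ei; apply: (order_F0_tie ei hi) => /=; last by lia.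
  by rewrite b2 b3 P1 T0mon0; apply/mnmP => v; rewrite !mnmDE mnm0E; lia.
apply: below_term => i ei; rewrite order_F0E; apply/orP; left.
have iq : basis_index i = q by exact: ei.
rewrite lex_ltE /lead_image /nu0 /= iq hi b1 b2.
have -> : (tmon q + (T0mon 1 + lmon q.+1) = T0mon 1 + lmon q.+2)%MM.
  by rewrite P1; apply/mnmP => v; rewrite !mnmDE; lia.
have -> : (tmon q.+1 + (T0mon 1 + lmon q) = T0mon 1 + tmon q.+2)%MM.
  by rewrite Q1; apply/mnmP => v; rewrite !mnmDE; lia.
rewrite lexmon_add; exact: (lex_last ord0 ord0).
Qed.

Lemma syz1_lmon_m n : (0 < n <= q)%N -> syz1_lmon (n, m n) = lmon (m n).
Proof. by move=> hn; rewrite /syz1_lmon /= ifF ?eqxx //; lia. Qed.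

Lemma syz1_lmon_rho n : (0 < n < q)%N -> syz1_lmon (n, r n) = tmon (m n).
Proof.
move=> hn; rewrite /syz1_lmon /= ifF; last by lia.
by rewrite eq_sym (negbTE (mm_rho_neq hn)).
Qed.

Lemma syz1_lmon_last : syz1_lmon (q.+1, q.+2) = tmon q.
Proof. by rewrite /syz1_lmon eqxx. Qed.

Lemma lead1 j : is_lead (order_F0 K u d) (row j (Phi2 K u d)) (nu1 j).
Proof.
rewrite row_Phi2 /nu1; case: (pairsP _ (pair_of_mem j)) => [[n hn ->]|[n hn ->]|->|->].
- by rewrite syz1_lmon_m ?syz1_m; try lia; apply: lead_gen_m; lia.
- by rewrite syz1_lmon_rho // syz1_rho //; apply: lead_gen_rho.
- have hq : (0 < q <= q)%N by lia.
  by have := lead_gen_m hq; rewrite -(syz1_lmon_m hq) -(syz1_m hq) (mm_rho_q hu hud hcop).1.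
- rewrite syz1_lmon_last /syz1 eqxx ifF; [exact: lead_s_q1 | lia].
Qed.

Lemma order_F1E z z' : order_F1 K u d z z' =
  order_F0 K u d (lead_image nu1 z) (lead_image nu1 z')
  || (lead_image nu1 z == lead_image nu1 z') && (z'.2 < z.2)%N.
Proof. by rewrite /order_F1 (induced_orderE order_F0_term lead1). Qed.

Lemma order_F1_term : term_order (order_F1 K u d).
Proof. exact: induced_term_order order_F0_term lead1. Qed.

Lemma pair_of_bounds j : (0 < (pair_of j).1 <= q.+1)%N.
Proof.
by case: (pairsP _ (pair_of_mem j)) => [[n hn ->]|[n hn ->]|->|->] /=; lia.
Qed.

Lemma basis_index_nu1 j : basis_index (nu1 j).2 = (pair_of j).1.
Proof. by have := pair_of_bounds j => h; rewrite /nu1 basis_index_onto //; lia. Qed.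

Lemma order_F1_T0 (mu mu' : mon) j j' p p' : pair_of j = p -> pair_of j' = p' ->
  ((mu + syz1_lmon p)%MM iT0 + b p.1 < (mu' + syz1_lmon p')%MM iT0 + b p'.1)%N ->
  order_F1 K u d (mu, j) (mu', j').
Proof.
move=> <- <- h; rewrite order_F1E; apply/orP; left.
by apply: (order_F0_T0 (basis_index_nu1 j) (basis_index_nu1 j')).
Qed.

Lemma order_F1_tie0 (mu mu' : mon) j j' p p' : pair_of j = p -> pair_of j' = p' ->
  (mu + syz1_lmon p + (T0mon (b p.1) + lmon p.1) = mu' + syz1_lmon p' + (T0mon (b p'.1) +
    lmon p'.1))%MM ->
  (p'.1 < p.1)%N -> order_F1 K u d (mu, j) (mu', j').
Proof.
move=> <- <- h lt; rewrite order_F1E; apply/orP; left.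
by apply: (order_F0_tie (basis_index_nu1 j) (basis_index_nu1 j')).
Qed.

Lemma order_F1_tie1 (mu mu' : mon) j j' n k k' : pair_of j = (n, k) -> pair_of j' = (n, k') ->
  (mu + syz1_lmon (n, k) = mu' + syz1_lmon (n, k'))%MM ->
  (k' < k)%N -> order_F1 K u d (mu, j) (mu', j').
Proof.
move=> hj hj' h lt; rewrite order_F1E; apply/orP; right; apply/andP; split.
  by rewrite /lead_image /shift /nu1 /= hj hj' h.
by apply: pair_of_lt; rewrite hj hj' /pair_lex ?xpair_eqE /=; lia.
Qed.

Lemma pairs_gt0 : (0 < 2 * q)%N.
Proof. by lia. Qed.

Definition pair_ord p : 'I_(2 * q) := insubd (Ordinal pairs_gt0) (index p pairs).

Lemma pair_of_pair_ord p : p \in pairs -> pair_of (pair_ord p) = p.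
Proof.
move=> hp; rewrite /pair_of /pair_ord /Defs.pair_at insubdK ?nth_index //.
by rewrite -topredE /= -size_pairs index_mem.
Qed.

Definition nu2 (i : 'I_q.-1) : mon * 'I_(2 * q) :=
  (step_cofactor i.+1, pair_ord (i.+1, i.+2)).

Lemma cofactors n : (step_cofactor n + other_cofactor n = lmon (m n) + tmon (m n))%MM.
Proof. by rewrite /step_cofactor /other_cofactor; case: ifP => // _; rewrite addmC. Qed.

Lemma step_pair n : (0 < n < q)%N ->
  [/\ (n, n.+1) \in pairs, (n, other n) \in pairs
    & syz1_lmon (n, n.+1) = other_cofactor n /\ syz1_lmon (n, other n) = step_cofactor n].
Proof.
move=> hn; have [_ ho hc] := otherE hn.
have h1 : (n, m n) \in pairs by apply/pairsP; apply: Or41; exists n.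
have h2 : (n, r n) \in pairs by apply/pairsP; apply: Or42; exists n.
have c1 : syz1_lmon (n, m n) = lmon (m n) by apply: syz1_lmon_m; lia.
have c2 := syz1_lmon_rho hn.
rewrite /step_cofactor /other_cofactor.
case: hc => -[e1 e2].
  rewrite e1 e2 in h1 h2 c1 c2 *; rewrite eqxx c1 c2.
  by [].
rewrite e1 e2 in h1 h2 c1 c2 *; have -> : (other n == n.+1) = false by lia.
by rewrite c1 c2.
Qed.

Lemma below_e2 lt mu n z : (0 < n <= q)%N ->
  below lt ('X_[mu] *: (if n == q then e2_basis K u d q.+1 q.+2 else e2_basis K u d n (r n)))
    z ->
  below lt ('X_[mu] *: e2 K u d n (r n)) z.
Proof.
move=> hn h; rewrite /e2 xpair_eqE; move: h; case: eqVneq => [->|_] //=.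
by rewrite (mm_rho_q hu hud hcop).2 eqxx scalerN => h; apply: belowN.
Qed.

Lemma below_e2_basis (lt : rel (mon * 'I_(2 * q))) (mu : mon) p z :
  (forall j, pair_of j = p -> lt (mu, j) z) -> below lt ('X_[mu] *: e2_basis K u d p.1 p.2) z.
Proof.
move=> h; have -> : e2_basis K u d p.1 p.2 = indicator_row K pair_of p.
  by apply/rowP => i; rewrite !mxE -surjective_pairing.
exact: below_term.
Qed.

Lemma e2E n k : (0 < n < q)%N || (k <= q.+1)%N -> e2 K u d n k = e2_basis K u d n k.
Proof. by move=> h; rewrite /e2 ifF // xpair_eqE; lia. Qed.

Lemma row_Phi3 i : row i (Phi3 K u d) = syz2 K u d i.+1.
Proof. by apply/rowP => j; rewrite !mxE. Qed.

(** The second term of [syz2E] ties with the first in S^{q+2} and loses because n + 1 < [other n].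
    The third ties with it only in S and loses because n < n + 1. The last has a smaller power of
    T_0, as b([other n]) > 0. *)
Lemma lead2 i : is_lead (order_F1 K u d) (row i (Phi3 K u d)) (nu2 i).
Proof.
rewrite row_Phi3 /nu2; set n := i.+1.
have hn : (0 < n < q)%N by rewrite /n; have := ltn_ord i; lia.
have hn' : (0 < n <= q)%N by lia.
have hn1 : (0 < n.+1 <= q)%N by lia.
have [h1 h2 [h3 h4]] := step_pair hn; have [ho hb hc] := otherE hn.
have [_ _ be] := xy_rho hu hud hcop hn'.
have [P1 _] := lmon_tmon_rho hn.
have h5 := cofactors n.
have [b1 b2 b3] := b_last hu hud hcop.
have -> : syz2 K u d n = 'X_[step_cofactor n] *: e2_basis K u d n n.+1
    + (- ('X_[other_cofactor n] *: e2_basis K u d n (other n))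
       + ('X_[T0mon (b (other n))] *: e2_basis K u d n.+1 (other n)
          - 'X_[T1mon (b (other n))] *: e2 K u d n.+1 (r n.+1))).
  by rewrite -(@e2E n n.+1) ?hn // -(@e2E n (other n)) ?hn // -(@e2E n.+1 (other n));
    [rewrite !addrA; exact: syz2E | lia].
have -> : 'X_[step_cofactor n] *: e2_basis K u d n n.+1
    = vmonom_vec K (step_cofactor n, pair_ord (n, n.+1)).
  rewrite -(term_vmonom K _ (pair_of_pair_ord h1) pair_of_inj); congr (_ *: _).
apply: (is_lead_vmonom order_F1_term); apply: belowD; [apply: belowN|apply: belowD;
  [|apply: belowN]].
- apply: (@below_e2_basis _ _ (n, other n)) => j hj.
  apply: (order_F1_tie1 hj (pair_of_pair_ord h1)); last by lia.
  by rewrite h3 h4 addmC.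
- apply: (@below_e2_basis _ _ (n.+1, other n)) => j hj.
  apply: (order_F1_tie0 hj (pair_of_pair_ord h1)) => //=.
  rewrite h3 h5 {2}ho syz1_lmon_m // -ho.
  case: hc => -[e1 e2].
    rewrite e1 e2 in P1 be *; rewrite P1 be T0monD.
    by apply/mnmP => v; rewrite !mnmDE; lia.
  rewrite e1 e2 in P1 be *; rewrite P1 be T0monD.
  by apply/mnmP => v; rewrite !mnmDE; lia.
have bo : (0 < b (other n))%N by apply: (b_gt0 hu hud hcop); lia.
have bS : (b n = b n.+1 + b (other n))%N by case: hc => -[e1 e2]; rewrite be e1 e2 // addnC.
have s0 : step_cofactor n iT0 = 0%N.
  rewrite /step_cofactor; case: ifP => _; first by have [] := lmonE (m n).
  by have [] := tmonE (m n).
have c0 p : syz1_lmon p iT0 = 0%N.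
  rewrite /syz1_lmon; case: ifP => _; first by have [] := tmonE q.
  by case: ifP => _; [have [] := lmonE (m p.1) | have [] := tmonE (m p.1)].
apply: (below_e2 hn1); have [E|ne] := eqVneq n.+1 q.
  apply: (@below_e2_basis _ _ (q.+1, q.+2)) => j hj.
  apply: (order_F1_T0 hj (pair_of_pair_ord h1)); rewrite !mnmDE !c0 s0 /=.
  by have [-> _ _ _ _] := T1monE (b (other n)); rewrite bS E b1 b2; lia.
apply: (@below_e2_basis _ _ (n.+1, r n.+1)) => j hj.
apply: (order_F1_T0 hj (pair_of_pair_ord h1)); rewrite !mnmDE !c0 s0 /=.
by have [-> _ _ _ _] := T1monE (b (other n)); rewrite bS; lia.
Qed.

(** * Injectivity on standard monomials *)

Lemma standard2_cofactor M j n : (0 < n < q)%N -> pair_of j = (n, n.+1) ->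
  standard nu2 (M, j) -> ~~ (step_cofactor n <= M)%MM.
Proof.
move=> hn hz; have h : (n.-1 < q.-1)%N by lia.
move/forallP => /(_ (Ordinal h)); rewrite /nu2 /= prednK; last by lia.
have [h1 _ _] := step_pair hn.
have -> : pair_ord (n, n.+1) = j by apply: pair_of_inj; rewrite pair_of_pair_ord.
by rewrite eqxx.
Qed.

Lemma pairs_fst p : p \in pairs -> (p.1 < q)%N ->
  p = (p.1, p.1.+1) \/ p = (p.1, other p.1).
Proof.
case/pairsP=> [[n hn ->]|[n hn ->]|->|->] /=; [ | | by rewrite ltnn | by move=> h; lia].
  by have [_ _ [[_ ->]|[-> _]]] := otherE hn; [right | left].
by have [_ _ [[-> _]|[_ ->]]] := otherE hn; [left | right].
Qed.

Lemma addm_inj (M M' N : mon) : (M + N = M' + N)%MM -> M = M'.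
Proof. by move=> h; rewrite -(addmK N M) h addmK. Qed.

(** Equal images lie at the same e_n, where only the two syzygies at n compete. Their leading
    monomials P_m and Q_m are coprime, so the step cofactor would divide the monomial at (n, n + 1),
    against standardness. *)
Lemma standard2_inj z z' : standard nu2 z -> standard nu2 z' ->
  lead_image nu1 z = lead_image nu1 z' -> z = z'.
Proof.
have main (M M' : mon) j j' n : (0 < n < q)%N -> pair_of j = (n, n.+1) ->
    pair_of j' = (n, other n) -> standard nu2 (M, j) ->
    (M + syz1_lmon (pair_of j) = M' + syz1_lmon (pair_of j'))%MM -> False.
  move=> hn hj hj' st; have [_ _ [c1 c2]] := step_pair hn; rewrite hj hj' c1 c2.
  move=> E; have := standard2_cofactor hn hj st; rewrite /= mon_le => /negP; apply.
  have [p1 p2 p3 p4 p5] := lmonE (m n); have [r1 r2 r3 r4 r5] := tmonE (m n).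
  have ev v : (M v + other_cofactor n v = M' v + step_cofactor n v)%N.
    by rewrite -!mnmDE E.
  have := ev iX0; have := ev iX1; have := ev iX2.
  rewrite /step_cofactor /other_cofactor; case: ifP => _;
  rewrite ?p1 ?p2 p3 p4 p5 r3 r4 r5 ?r1 ?r2; case: (sigma_side (m n)); lia.
case: z z' => [M j] [M' j'] st st' E.
have E1 : (M + syz1_lmon (pair_of j) = M' + syz1_lmon (pair_of j'))%MM by have := congr1 fst E.
have E2 : (pair_of j).1 = (pair_of j').1.
  by rewrite -!basis_index_nu1; have := congr1 snd E; rewrite /lead_image /shift /= => ->.
have [e|ne] := eqVneq (pair_of j) (pair_of j').
  by rewrite e in E1; rewrite (addm_inj E1) (pair_of_inj e).
have hb := pair_of_bounds j.
have [h|h] := ltnP (pair_of j).1 q; last first.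
  (* Only one pair has first entry q, and only one has first entry q + 1. *)
  case: (pairsP _ (pair_of_mem j)) ne hb h E2 => [[n hn ->]|[n hn ->]|->|->] /=; try lia;
  case: (pairsP _ (pair_of_mem j')) => [[n hn ->]|[n hn ->]|->|->] /=; rewrite ?eqxx //; lia.
have hn : (0 < (pair_of j).1 < q)%N by lia.
have h' : ((pair_of j').1 < q)%N by rewrite -E2.
have := pairs_fst (pair_of_mem j) h; have := pairs_fst (pair_of_mem j') h'.
rewrite -E2 => -[e'|e'] [e|e]; first by rewrite e e' eqxx in ne.
- by case: (main _ _ _ _ _ hn e' e st' (esym E1)).
- by case: (main _ _ _ _ _ hn e e' st E1).
- by rewrite e e' eqxx in ne.
Qed.

Lemma standard1_coef M i p : p \in pairs -> basis_index i = p.1 -> standard nu1 (M, i) ->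
  ~~ (syz1_lmon p <= M)%MM.
Proof.
move=> /pair_of_onto[j hj] hi /forallP /(_ j); rewrite /nu1 hj /=.
have -> : inord p.1.-1 = i :> 'I_q.+2.
  apply: basis_index_inj; rewrite hi basis_index_onto -?hj //.
  by have /andP[-> h] := pair_of_bounds j; apply: leq_trans h _.
by rewrite eqxx.
Qed.

(** Let n < k be the two positions and M the monomial at n. If n and k are on the same side, P_k /
    P_n divides M and is divisible by Q_m; otherwise P_k is coprime to P_n, hence divides M, and is
    divisible by P_m. Both use [xy_mono], and Q_m, P_m lead s_{n,rho(n)}, s_{n,m(n)}. *)
Lemma standard1_inj z z' : standard nu1 z -> standard nu1 z' ->
  lead_image nu0 z = lead_image nu0 z' -> z = z'.
Proof.
have main (M M' : mon) (i i' : 'I_q.+2) : (basis_index i < basis_index i')%N ->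
  standard nu1 (M, i) ->
    (M + (T0mon (b (basis_index i)) + lmon (basis_index i)) = M' + (T0mon (b (basis_index
      i')) + lmon (basis_index i')))%MM -> False.
  have [n ei] : exists n, basis_index i = n by exists (basis_index i).
  rewrite ei.
  have hn : (0 < n <= q.+2)%N by rewrite -ei /basis_index; have := ltn_ord i; lia.
  have : (0 < basis_index i' <= q.+2)%N by rewrite /basis_index; have := ltn_ord i'; lia.
  move: (basis_index i') => k hk hnk st E.
  have ev v : (M v + (T0mon (b n) v + lmon n v) = M' v + (T0mon (b k) v + lmon k v))%N.
    by rewrite -!mnmDE E.
  have := ev iX0; have := ev iX1; have := ev iX2.
  have [c1 c2 c3 c4 c5] := T0monE (b n); have [d1 d2 d3 d4 d5] := T0monE (b k).
  have [p1 p2 p3 p4 p5] := lmonE n; have [r1 r2 r3 r4 r5] := lmonE k.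
  rewrite c3 c4 c5 d3 d4 d5 p3 p4 p5 r3 r4 r5 => {ev c1 c2 c3 c4 c5 d1 d2 d3 d4 d5} e2 e1 e0.
  have [hnq|hnq] := leqP n q; last first.
    (* Outside the range of [xy_mono]: the quotient P_{q+2} / P_{q+1} is Q_q, which leads
       s_{q+1,q+2}. *)
    have En : n = q.+1 by lia.
    have Ek : k = q.+2 by lia.
    have hp : (q.+1, q.+2) \in pairs by apply/pairsP; apply: Or44.
    have := standard1_coef hp _ st; rewrite ei En => /(_ erefl) /negP; apply.
    rewrite syz1_lmon_last mon_le; have [-> -> -> -> ->] := tmonE q.
    have hq : (0 < q <= q)%N by lia.
    have [] := xy_rho hu hud hcop hq; have [-> ->] := mm_rho_q hu hud hcop.
    rewrite En Ek in e2 e1 e0; move: e2 e1 e0; have [-> ->] := sigma_side_q hu hud hcop.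
    by case: (sigma_side q) => /= *; lia.
  have hn' : (0 < n <= q)%N by lia.
  have hk' : (n < k <= q.+2)%N by lia.
  have := xy_mono hu hud hcop hn' hk'; have pm := sigma_side_mm hu hud hcop hn'.
  case: eqVneq => [ep|ep] hxy.
    (* Both steps after q are on the other side, so s_{n,rho(n)} is available here. *)
    have hnq' : (n < q)%N.
      rewrite ltn_neqAle hnq andbT; apply/negP => /eqP En; move: ep; rewrite En.
      have [p0 p0'] := sigma_side_q hu hud hcop.
      have [->|->] : k = q.+1 \/ k = q.+2 by lia.
        by rewrite p0; case: (sigma_side q).
      by rewrite p0'; case: (sigma_side q).
    have hn2 : (0 < n < q)%N by lia.
    have hp : (n, r n) \in pairs by apply/pairsP; apply: Or42; exists n.
    have := standard1_coef hp ei st; rewrite syz1_lmon_rho // => /negP; apply.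
    rewrite mon_le; have [-> -> -> -> ->] := tmonE (m n); rewrite pm.
    by move: e2 e1 e0; rewrite ep; case: (sigma_side n) => /= *; lia.
  have hp : (n, m n) \in pairs.
    have [En|nE] := eqVneq n q.
      by apply/pairsP; apply: Or43; rewrite En (mm_rho_q hu hud hcop).1.
    by apply/pairsP; apply: Or41; exists n => //; lia.
  have := standard1_coef hp ei st; rewrite syz1_lmon_m // => /negP; apply.
  rewrite mon_le; have [-> -> -> -> ->] := lmonE (m n); rewrite pm.
  by move: e2 e1 e0 ep; case: (sigma_side n); case: (sigma_side k) => //= *; lia.
case: z z' => [M i] [M' i'] st st' E.
have E1 : (M + (T0mon (b (basis_index i)) + lmon (basis_index i)) = M' + (T0mon (b
  (basis_index i')) + lmon (basis_index i')))%MM.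
  by have := congr1 fst E.
have [h|h|h] := ltngtP (basis_index i) (basis_index i').
- by case: (main _ _ _ _ h st E1).
- by case: (main _ _ _ _ h st' (esym E1)).
- by rewrite h in E1; rewrite (addm_inj E1) (basis_index_inj h).
Qed.

Lemma standard0_lead M n : (0 < n <= q.+2)%N -> standard nu0 (M, ord0) ->
  ~~ (T0mon (b n) + lmon n <= M)%MM.
Proof.
by move=> hn /forallP /(_ (inord n.-1)); rewrite /nu0 (basis_index_onto hn).
Qed.

Lemma first_step :
  [/\ b 1 = (d - u)%N, b (m 1) = u, sigma_side 1 = false & [/\ x 1 = 0, y 1 = 1, x (m 1) = 1
    & y (m 1) = 0]]%N.
Proof.
have h1 : (0 < 1 <= q)%N by lia.
have [e1 e2 e3] := sers_mm hu hud hcop h1.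
have [|f1 f2 f3] := @sersE _ _ hu hud hcop 1; first by lia.
rewrite /abs_sigma /abs_tau e1 e2 e3 f1 f2 f3 (sigma_sideE hu hud hcop) ?f1; last by lia.
by [].
Qed.

(** Suppose that N has the larger T_0-exponent, and put sigma = N'_{X0} - N_{X0}, tau = N_{X2} -
    N'_{X2}. The T_0-exponents differ by u sigma + (d - u) tau, and tau, sigma are the coordinates
    on steps 1 and m(1). So [approx] at 1 provides an F_k whose leading monomial divides N. *)
Lemma standard0_inj M M' : standard nu0 (M, ord0) -> standard nu0 (M', ord0) ->
  (M iT0 + d * M iX0 + (d - u) * M iX1 = M' iT0 + d * M' iX0 + (d - u) * M' iX1)%N ->
  (M iT1 + u * M iX1 + d * M iX2 = M' iT1 + u * M' iX1 + d * M' iX2)%N ->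
  (M iX0 + M iX1 + M iX2 = M' iX0 + M' iX1 + M' iX2)%N -> M = M'.
Proof.
have [bw bu p1 [x1 y1 xm ym]] := first_step.
have hq1 : (0 < 1 <= q)%N by lia.
have pm : sigma_side (m 1) by rewrite (sigma_side_mm hu hud hcop hq1) p1.
have height (N N' : mon) :
    (N iT0 + d * N iX0 + (d - u) * N iX1 = N' iT0 + d * N' iX0 + (d - u) * N' iX1)%N ->
    (N iX0 + N iX1 + N iX2 = N' iX0 + N' iX1 + N' iX2)%N ->
    (N iT0 + u * N iX0 + (d - u) * N' iX2 = N' iT0 + u * N' iX0 + (d - u) * N iX2)%N.
  move=> h1 h3; have := congr1 (muln (d - u)) h3; rewrite !mulnDr.
  have ed k : (d * k = u * k + (d - u) * k)%N by rewrite -mulnDl addnC subnK //; lia.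
  by move: h1; rewrite !ed; lia.
have main (N N' : mon) : (N' iT0 < N iT0)%N -> standard nu0 (N, ord0) ->
    (N iT0 + d * N iX0 + (d - u) * N iX1 = N' iT0 + d * N' iX0 + (d - u) * N' iX1)%N ->
    (N iX0 + N iX1 + N iX2 = N' iX0 + N' iX1 + N' iX2)%N -> False.
  move=> lt st h1 h3; have := height _ _ h1 h3; clear h1.
  have nst k : (0 < k <= q.+1)%N -> (b k <= N iT0)%N -> (lmon k <= N)%MM -> False.
    move=> hk hb hP; have hk' : (0 < k <= q.+2)%N by lia.
    have := standard0_lead hk' st => /negP; apply; move: hP; rewrite !mon_le !mnmDE.
    by have [-> -> -> -> ->] := T0monE (b k); have [-> -> _ _ _] := lmonE k; lia.
  have [ha|ha] := leqP (N' iX0) (N iX0).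
    have [e0 ea] : exists Y, N iX0 = (N' iX0 + Y)%N by exists (N iX0 - N' iX0)%N; lia.
    rewrite ea mulnDr => E.
    have hc : (N' iX2 < N iX2)%N.
      rewrite ltnNge; apply/negP => hc.
      by have := leq_mul (leqnn (d - u)) hc; lia.
    have [e1 ec] : exists X, N iX2 = (N' iX2 + X.+1)%N.
      by exists (N iX2 - N' iX2).-1; lia.
    rewrite ec mulnDr in E.
    have [+ _] := approx hu hud hcop e1 e0 hq1; rewrite bw bu p1 x1 y1 xm ym.
    case=> [|k [k1 k2 k3 k4 k5]]; first by lia.
    apply: (nst k k1); first by lia.
    rewrite mon_le; have [-> -> -> -> ->] := lmonE k; rewrite k2; lia.
  have [e1 ea] : exists Y, N' iX0 = (N iX0 + Y.+1)%N by exists (N' iX0 - N iX0).-1; lia.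
  rewrite ea mulnDr => E.
  have [hc|hc] := leqP (N iX2) (N' iX2); last first.
    (* Both coordinates are positive, a case outside [approx]; the height is then at least d - u,
       and T_0^{d-u} X_2, which leads F_1, divides N. *)
    apply: (nst 1%N); first by lia.
      have [e2 ec] : exists X, N iX2 = (N' iX2 + X.+1)%N.
        by exists (N iX2 - N' iX2).-1; lia.
      by rewrite bw; rewrite ec mulnDr mulnS in E; lia.
    by rewrite mon_le; have [-> -> -> -> ->] := lmonE 1; rewrite p1 x1 y1; lia.
  have [e0 ec] : exists X, N' iX2 = (N iX2 + X)%N by exists (N' iX2 - N iX2)%N; lia.
  rewrite ec mulnDr in E.
  have [_] := approx hu hud hcop e0 e1 hq1; rewrite bw bu x1 y1 xm ym.
  case=> [|k [k1 k2 k3 k4 k5]]; first by lia.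
  apply: (nst k k1); first by lia.
  rewrite mon_le; have [-> -> -> -> ->] := lmonE k; rewrite k2 pm; lia.
(* Height 0: by coprimality the difference is a multiple of (d - u, u). If it is nonzero, X_0^{d-u}
   X_2^u divides N' and X_1^d divides N, and one of these leads F_{q+2}. *)
have tie (N N' : mon) : N iT0 = N' iT0 -> (N iX0 <= N' iX0)%N ->
    standard nu0 (N, ord0) -> standard nu0 (N', ord0) ->
    (N iT0 + d * N iX0 + (d - u) * N iX1 = N' iT0 + d * N' iX0 + (d - u) * N' iX1)%N ->
    (N iT1 + u * N iX1 + d * N iX2 = N' iT1 + u * N' iX1 + d * N' iX2)%N ->
    (N iX0 + N iX1 + N iX2 = N' iX0 + N' iX1 + N' iX2)%N -> N = N'.
  move=> e0 la st st' h1 h2 h3; have := height _ _ h1 h3.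
  have [Y ea] : exists Y, N' iX0 = (N iX0 + Y)%N by exists (N' iX0 - N iX0)%N; lia.
  rewrite e0 ea mulnDr => E.
  have lc : (N iX2 <= N' iX2)%N.
    have : ((d - u) * N iX2 <= (d - u) * N' iX2)%N by lia.
    by rewrite leq_pmul2l //; lia.
  have [X ec] : exists X, N' iX2 = (N iX2 + X)%N by exists (N' iX2 - N iX2)%N; lia.
  rewrite ec mulnDr in E.
  have EE : (u * Y = (d - u) * X)%N by lia.
  have : (d - u %| Y)%N.
    rewrite -(@Gauss_dvdr _ u) ?EE ?dvdn_mulr //.
    by rewrite coprime_sym /coprime -gcdnDr subnK //; lia.
  case/dvdnP=> k ek; have ek' : X = (k * u)%N.
    have : ((d - u) * X = (d - u) * (k * u))%N by rewrite -EE ek; ring.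
    by move/eqP; rewrite eqn_pmul2l; [move/eqP | lia].
  case: k ek ek' => [|k] ek ek'.
    rewrite ek ek' !mul0n !addn0 in ea ec.
    have eb : N iX1 = N' iX1 by lia.
    by apply: mon_eq => //; move: h2; rewrite eb ec; lia.
  have hl : (d - u + u = d)%N by lia.
  have [hx hy] := xy_q2 hu hud hcop; have [_ _ hb] := b_last hu hud hcop.
  rewrite !mulSn in ek ek'; have h2q : (0 < q.+2 <= q.+2)%N by rewrite leqnn.
  have s1 := standard0_lead h2q st; have s2 := standard0_lead h2q st'.
  rewrite hb T0mon0 add0m !mon_le in s1 s2.
  have [r1 r2 r3 r4 r5] := lmonE q.+2; rewrite hx hy in r3 r4 r5.
  rewrite r1 r2 r3 r4 r5 in s1 s2; case: (sigma_side q.+2) s1 s2; lia.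
move=> st st' h1 h2 h3; have [h|h|h] := ltngtP (M iT0) (M' iT0).
- by case: (main _ _ h st' (esym h1) (esym h3)).
- by case: (main _ _ h st h1 h3).
have [la|la] := leqP (M iX0) (M' iX0); first exact: tie.
by apply/esym; apply: tie => //; exact: ltnW.
Qed.

(** * Bidegrees and minimality *)

Section Homogeneous.

Variables (k : nat) (deg : 'I_k -> int * int) (D : int * int).

(** Homogeneity and minimality are carried together, since both are checked on the same terms. *)
Definition homog_min (v : 'rV[S]_k) :=
  forall j, bihomog (D - deg j) (v 0 j) /\ (v 0 j)@_0%MM = 0.

Lemma homog_minD v w : homog_min v -> homog_min w -> homog_min (v + w).
Proof.
move=> hv hw j; have [a1 a2] := hv j; have [c1 c2] := hw j; rewrite mxE; split.
  exact: bihomogD.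
by rewrite mcoeffD a2 c2 addr0.
Qed.

Lemma homog_minN v : homog_min v -> homog_min (- v).
Proof.
move=> hv j; have [a1 a2] := hv j; rewrite mxE; split; first exact: bihomogN.
by rewrite mcoeffN a2 oppr0.
Qed.

Lemma homog_minB v w : homog_min v -> homog_min w -> homog_min (v - w).
Proof. by move=> hv hw; apply: homog_minD => //; apply: homog_minN. Qed.

Lemma homog_min_term (T : eqType) (f : 'I_k -> T) (mu : mon) a :
  (forall j, f j = a -> mbideg mu + deg j = D) -> mbideg mu != 0 ->
  homog_min ('X_[mu] *: indicator_row K f a).
Proof.
move=> h nz j; split; first by apply: bihomog_term => /h <-; rewrite addrK.
apply: minimal_term; apply: contra nz => /eqP ->.
by rewrite /mbideg !mnm0E.
Qed.

End Homogeneous.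

Local Notation w n := (x n + y n)%N.

Lemma mbideg_T0mon i : mbideg (T0mon i) = (i%:Z, 0).
Proof. by rewrite mbideg_mon5 addn0. Qed.

Lemma mbideg_T1mon i : mbideg (T1mon i) = (i%:Z, 0).
Proof. by rewrite mbideg_mon5. Qed.

Lemma mbideg_lmon n : mbideg (lmon n) = (0, (w n)%:Z).
Proof. by rewrite /lmon; case: ifP => _; rewrite mbideg_mon5 ?addn0. Qed.

Lemma mbideg_tmon n : mbideg (tmon n) = (0, (w n)%:Z).
Proof. by rewrite /tmon; case: ifP => _; rewrite mbideg_mon5 ?addn0. Qed.

Let mbidegE := (mbidegD, mbideg_T0mon, mbideg_T1mon, mbideg_lmon, mbideg_tmon).

Lemma pair_intP (a c a' c' : int) : a = a' -> c = c' -> (a, c) = (a', c').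
Proof. by move=> -> ->. Qed.

Lemma addp (a c a' c' : int) : (a, c) + (a', c') = (a + a', c + c').
Proof. by []. Qed.

Lemma pair_int_neq0 (a c : int) : (a != 0) || (c != 0) -> (a, c) != 0.
Proof. by move=> h; rewrite xpair_eqE negb_and. Qed.

Let rowdeg1 (i : 'I_q.+2) := deg_e1 u d (basis_index i).

Lemma homog_min_e mu n D : (0 < n <= q.+2)%N ->
  mbideg mu + ((b n)%:Z, (w n)%:Z) = D -> mbideg mu != 0 ->
  homog_min rowdeg1 D ('X_[mu] *: e n).
Proof.
move=> hn h nz; apply: (homog_min_term (f := basis_index)) nz => j hj.
by rewrite /rowdeg1 hj /deg_e1 widthE.
Qed.

Lemma homog_min_e_rho mu n D : (0 < n <= q)%N ->
  mbideg mu + ((b (r n))%:Z, (w (r n))%:Z) = D -> mbideg mu != 0 ->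
  homog_min rowdeg1 D ('X_[mu] *: e_rho n).
Proof.
move=> hn h nz; have [_ h2 _] := mm_bounds hu hud hcop hn.
have h3 : homog_min rowdeg1 D ('X_[mu] *: e (r n)) by apply: homog_min_e => //; lia.
rewrite /e_rho; have [E|//] := eqVneq n q.
rewrite scalerN; apply: homog_minN; move: h3.
by rewrite E (mm_rho_q hu hud hcop).2.
Qed.

Lemma homog_min_gen n : (0 < n <= q)%N ->
  homog_min rowdeg1 ((b n)%:Z, (w n + w (m n))%N%:Z) (gen_m n) /\
  homog_min rowdeg1 ((b n)%:Z, (w n + w (m n))%N%:Z) (gen_rho n).
Proof.
move=> hn; have [h1 h2 _] := mm_bounds hu hud hcop hn.
have [ex ey eb] := xy_rho hu hud hcop hn.
have wn : (0 < w n)%N by apply: (xy_gt0 hu hud hcop); lia.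
have wm : (0 < w (m n))%N by apply: (xy_gt0 hu hud hcop); lia.
have bm : (0 < b (m n))%N by apply: (b_gt0 hu hud hcop); lia.
have hn2 : (0 < n <= q.+2)%N by lia.
have hm2 : (0 < m n <= q.+2)%N by lia.
split; apply: homog_minB; [apply: homog_minB| |apply: homog_minB| ].
- apply: (homog_min_e hn2); rewrite mbideg_lmon ?addp;
  [apply: pair_intP|apply: pair_int_neq0]; lia.
- apply: (homog_min_e hm2); rewrite mbidegD mbideg_T0mon mbideg_lmon ?eb ?addp; cbn [fst snd].
    by apply: pair_intP; lia.
  by apply: pair_int_neq0; lia.
- apply: (homog_min_e_rho hn); rewrite mbideg_T1mon ?eb ?ex ?ey ?addp; cbn [fst snd].
    by apply: pair_intP; lia.
  by apply: pair_int_neq0; lia.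
- apply: (homog_min_e hn2); rewrite mbideg_tmon ?addp;
  [apply: pair_intP|apply: pair_int_neq0]; lia.
- apply: (homog_min_e_rho hn); rewrite mbideg_T0mon ?eb ?ex ?ey ?addp; cbn [fst snd].
    by apply: pair_intP; lia.
  by apply: pair_int_neq0; lia.
- apply: (homog_min_e hm2); rewrite mbidegD mbideg_T1mon mbideg_tmon ?eb ?addp; cbn [fst snd].
    by apply: pair_intP; lia.
  by apply: pair_int_neq0; lia.
Qed.

Lemma deg_e2E p : (0 < minn p.1 q <= q)%N -> deg_e2 u d p =
  ((b (minn p.1 q))%:Z, (w (minn p.1 q) + w (m (minn p.1 q)))%N%:Z).
Proof.
move=> hp; have [h1 _ _] := mm_bounds hu hud hcop hp.
by rewrite /deg_e2 !(widthE hu hud hcop) //; lia.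
Qed.

Lemma homog_min_Phi2 j : homog_min rowdeg1 (deg_e2 u d (pair_of j)) (row j (Phi2 K u d)).
Proof.
rewrite row_Phi2 deg_e2E; last by have := pair_of_bounds j; lia.
case: (pairsP _ (pair_of_mem j)) => [[n hn ->]|[n hn ->]|->|->]; cbn [fst].
- have hn' : (0 < n <= q)%N by lia.
  by rewrite syz1_m // (minn_idPl _); [have [] := homog_min_gen hn' | lia].
- have hn' : (0 < n <= q)%N by lia.
  by rewrite syz1_rho // (minn_idPl _); [have [] := homog_min_gen hn' | lia].
- have hq : (0 < q <= q)%N by lia.
  rewrite minnn; have := @syz1_m q hq; rewrite (mm_rho_q hu hud hcop).1 => ->.
  by have [h _] := homog_min_gen hq; move: h; rewrite (mm_rho_q hu hud hcop).1.
- have hq : (0 < q <= q)%N by lia.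
  rewrite syz1_last (minn_idPr _); last by lia.
  by apply: homog_minN; have [] := homog_min_gen hq.
Qed.

Let rowdeg2 (j : 'I_(2 * q)) := deg_e2 u d (pair_of j).

Lemma homog_min_e2_basis mu p D : (0 < minn p.1 q)%N ->
  mbideg mu + ((b (minn p.1 q))%:Z, (w (minn p.1 q) + w (m (minn p.1 q)))%N%:Z) = D ->
  mbideg mu != 0 -> homog_min rowdeg2 D ('X_[mu] *: e2_basis K u d p.1 p.2).
Proof.
move=> hp h nz; have -> : e2_basis K u d p.1 p.2 = indicator_row K pair_of p.
  by apply/rowP => i; rewrite !mxE -surjective_pairing.
apply: homog_min_term nz => j hj; rewrite /rowdeg2 hj deg_e2E ?h //; lia.
Qed.

Lemma homog_min_e2 mu n k D : (0 < n <= q)%N ->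
  mbideg mu + ((b n)%:Z, (w n + w (m n))%N%:Z) = D ->
  mbideg mu != 0 -> homog_min rowdeg2 D ('X_[mu] *: e2 K u d n k).
Proof.
move=> hn h nz; have hmin : minn n q = n by apply/minn_idPl; lia.
rewrite /e2; case: ifP => [|_].
  rewrite xpair_eqE => /andP[/eqP E _]; rewrite scalerN; apply: homog_minN.
  have hq : minn q.+1 q = q by apply/minn_idPr.
  by apply: (@homog_min_e2_basis _ (q.+1, q.+2)); rewrite /= ?hq -?E //; lia.
by apply: (@homog_min_e2_basis _ (n, k)); rewrite /= ?hmin //; lia.
Qed.

Lemma homog_min_Phi3 (i : 'I_q.-1) : homog_min rowdeg2 (deg_e3 u d i.+1) (row i (Phi3 K u d)).
Proof.
rewrite row_Phi3; set n := i.+1.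
have hn : (0 < n < q)%N by rewrite /n; have := ltn_ord i; lia.
have hn' : (0 < n <= q)%N by lia.
have [h1 h2 _] := mm_bounds hu hud hcop hn'.
have [ho hb hc] := otherE hn.
have [ex ey eb] := xy_rho hu hud hcop hn'.
have wm : (0 < w (m n))%N by apply: (xy_gt0 hu hud hcop); lia.
have bo : (0 < b (other n))%N by apply: (b_gt0 hu hud hcop); lia.
have bS : (b n = b n.+1 + b (other n))%N by case: hc => -[e1 e2]; rewrite eb e1 e2 // addnC.
have wS : (w n.+1 + w (other n) = w n + 2 * w (m n))%N.
  by case: hc => -[e1 e2]; move: ex ey; rewrite e1 e2; lia.
have hA : mbideg (step_cofactor n) = (0, (w (m n))%:Z).
  by rewrite /step_cofactor; case: ifP; rewrite !mbidegE.
have hB : mbideg (other_cofactor n) = (0, (w (m n))%:Z).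
  by rewrite /other_cofactor; case: ifP; rewrite !mbidegE.
rewrite /deg_e3 !(widthE hu hud hcop) ?syz2E //; try lia.
apply: homog_minB; [apply: homog_minD; [apply: homog_minB|]|];
  apply: homog_min_e2; rewrite ?hA ?hB ?mbideg_T0mon ?mbideg_T1mon -?ho ?addp; cbn [fst snd];
  try (by apply: pair_intP; lia); try (by apply: pair_int_neq0; lia); lia.
Qed.

Lemma homog_min_Phi1 i : bihomog (rowdeg1 i) (Phi1 K u d i 0) /\ (Phi1 K u d i 0)@_0%MM = 0.
Proof.
have hi : (0 < basis_index i <= q.+2)%N by rewrite /basis_index; have := ltn_ord i; lia.
have [hx hy] := xy_q2 hu hud hcop.
have wi : (0 < w (basis_index i))%N.
  have [h|h] := leqP (basis_index i) q.+1; first by apply: (xy_gt0 hu hud hcop); lia.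
  have -> : basis_index i = q.+2 by lia.
  by rewrite hx hy; lia.
rewrite mxE -/(basis_index i) FE // /rowdeg1 /deg_e1 widthE //.
have h0 (mu : mon) : mbideg mu = ((b (basis_index i))%:Z, (w (basis_index i))%:Z) ->
  ('X_[mu] : S)@_0%MM = 0.
  move=> h; rewrite mcoeffX; case: eqP => // E; move: h; rewrite E /mbideg !mnm0E /=.
  by case=> _; lia.
have e1 : mbideg (T0mon (b (basis_index i)) + lmon (basis_index i))%MM = ((b (basis_index
  i))%:Z, (w (basis_index i))%:Z).
  by rewrite !mbidegE addp; cbn [fst snd]; apply: pair_intP; lia.
have e2 : mbideg (T1mon (b (basis_index i)) + tmon (basis_index i))%MM = ((b (basis_index
  i))%:Z, (w (basis_index i))%:Z).
  by rewrite !mbidegE addp; cbn [fst snd]; apply: pair_intP; lia.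
split; last by rewrite mcoeffB !h0 // subr0.
apply: bihomogD; first by rewrite -e1; apply: bihomogX.
by apply: bihomogN; rewrite -e2; apply: bihomogX.
Qed.

(** * Exactness *)

Lemma Phi2_Phi1 : Phi2 K u d *m Phi1 K u d = 0.
Proof.
apply/row_matrixP => j; rewrite row_mul row_Phi2 row0.
case: (pairsP _ (pair_of_mem j)) => [[n hn ->]|[n hn ->]|->|->].
- have hn' : (0 < n <= q)%N by lia.
  by rewrite syz1_m // (gen_Phi1 hn').1.
- have hn' : (0 < n <= q)%N by lia.
  by rewrite syz1_rho // (gen_Phi1 hn').2.
- have hq : (0 < q <= q)%N by lia.
  have := @syz1_m q hq; rewrite (mm_rho_q hu hud hcop).1 => ->.
  by have [] := gen_Phi1 hq.
- have hq : (0 < q <= q)%N by lia.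
  by rewrite syz1_last mulNmx (gen_Phi1 hq).2 oppr0.
Qed.

Lemma Phi3_Phi2 : Phi3 K u d *m Phi2 K u d = 0.
Proof.
apply/row_matrixP => i; rewrite row_mul row_Phi3 row0 syz2_Phi2 //.
by have := ltn_ord i; lia.
Qed.

Lemma graded_minimal k l (degs : 'I_k -> int * int) (degt : 'I_l -> int * int)
    (B : 'M[S]_(k, l)) : (forall i, homog_min degt (degs i) (row i B)) ->
  bigraded_map degs degt B /\ minimal_map B.
Proof.
move=> h; split; first by apply: bigraded_mapP => i j; have [] := h i j; rewrite mxE.
by move=> i j; have [_] := h i j; rewrite mxE.
Qed.

Lemma kernel_sub k l (B : 'M[S]_(k, l)) (v w : 'rV_k) :
  v *m B = 0 -> w *m B = 0 -> (v - w) *m B = 0.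
Proof. by move=> hv hw; rewrite mulmxBl hv hw subrr. Qed.

Lemma kernel_comp k l n (A : 'M[S]_(n, k)) (B : 'M[S]_(k, l)) (w : 'rV_n) :
  A *m B = 0 -> w *m A *m B = 0.
Proof. by move=> h; rewrite -mulmxA h mulmx0. Qed.

(** The rows lead at distinct basis vectors e_{n,n+1}, so no two monomials of the source have the
    same leading image. *)
Lemma Phi3_inj (v : 'rV[S]_q.-1) : v *m Phi3 K u d = 0 -> v = 0.
Proof.
move=> h; apply/eqP; apply/negP => /negP nz.
have [z hz] := exists_lead (induced_term_order order_F1_term lead2) nz.
have := lead_mulmx order_F1_term lead2 hz; rewrite h eqxx => ne.
have {}ne : ~ (forall z', vcoef v z' != 0 -> lead_image nu2 z' = lead_image nu2 z -> z' = z).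
  by move/ne.
apply: ne => -[M j] _; case: z hz => [M' j'] _ E.
have hp (i : 'I_q.-1) : (i.+1, i.+2) \in pairs.
  by have [|] := @step_pair i.+1; have := ltn_ord i; lia.
have : pair_of (nu2 j).2 = pair_of (nu2 j').2.
  by have := congr1 (fun z => pair_of z.2) E; rewrite /lead_image /shift.
rewrite /nu2 /= !pair_of_pair_ord // => -[ej _].
have ej' : j = j' by apply: val_inj.
have := congr1 fst E; rewrite /lead_image /shift /= ej' => /addm_inj -> //.
Qed.

Lemma Phi2_standard_inj (s0 : 'rV[S]_(2 * q)) : s0 *m Phi2 K u d = 0 ->
  (forall z, vcoef s0 z != 0 -> standard nu2 z) -> s0 = 0.
Proof.
move=> h st; apply/eqP; apply/negP => /negP nz.
have [z hz] := exists_lead order_F1_term nz.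
have := lead_mulmx order_F0_term lead1 hz; rewrite h eqxx => ne.
have // : false by apply: ne => z' hz'; apply: standard2_inj; apply: st => //; exact: hz.1.
Qed.

Lemma Phi1_standard_inj (s0 : 'rV[S]_q.+2) : s0 *m Phi1 K u d = 0 ->
  (forall z, vcoef s0 z != 0 -> standard nu1 z) -> s0 = 0.
Proof.
move=> h st; apply/eqP; apply/negP => /negP nz.
have [z hz] := exists_lead order_F0_term nz.
have := lead_mulmx T0ord lead0 hz; rewrite h eqxx => ne.
have // : false by apply: ne => z' hz'; apply: standard1_inj; apply: st => //; exact: hz.1.
Qed.

Lemma Phi0_standard_inj (s0 : 'rV[S]_1) : Phi0 K u d (s0 0 0) = 0 ->
  (forall z, vcoef s0 z != 0 -> standard nu0 z) -> s0 = 0.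
Proof.
move=> h st; apply/rowP => i; rewrite (ord1 i) mxE; apply: (Phi0_inj h).
move=> M M'; rewrite !mcoeff_msupp => hM hM' e1 e2.
have [t1 t2] := TpartE u d M; have [t3 t4] := TpartE u d M'.
apply: standard0_inj => //; last first.
- by rewrite -t2 -t4 e1.
- by rewrite -t1 -t3 e1.
- by apply: st.
- by apply: st.
Qed.

(** [inv_b] in absolute values: it is the condition for the two monomials of F_n to have the same
    image under [Phi0]. *)
Lemma height_rel n : (0 < n <= q.+2)%N ->
  if sigma_side n then (b n + (d - u) * y n = u * x n)%N else (b n + u * x n = (d - u) * y n)%N.
Proof.
move=> hn; have [h|h] := leqP n q.+1; last first.
  have -> : n = q.+2 by lia.
  have [-> ->] := xy_q2 hu hud hcop; have [_ _ ->] := b_last hu hud hcop.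
  by case: ifP => _; rewrite mulnC.
have hn' : (0 < n <= q.+1)%N by lia.
have [e1 e2 e3] := sersE hu hud hcop h; have := inv_b (sersP hu hud hcop hn').
rewrite -e1 -e2 -e3 => hb.
have eu : d%:Z - u%:Z = (d - u)%N%:Z by lia.
rewrite eu in hb; rewrite (sigma_sideE hu hud hcop h); have := sign_spec hu hud hcop hn'.
case: ifP => hs hsg.
  have [es et] : s n = (x n)%:Z /\ t n = - (y n)%:Z by rewrite /abs_sigma /abs_tau; lia.
  by rewrite es et in hb; lia.
have [es et] : s n = - (x n)%:Z /\ t n = (y n)%:Z by rewrite /abs_sigma /abs_tau; lia.
by rewrite es et in hb; lia.
Qed.

Lemma Phi0_F n : (0 < n <= q.+2)%N -> Phi0 K u d (F K u d n) = 0.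
Proof.
move=> hn; have hh := height_rel hn.
have -> : Phi0 K u d (F K u d n) = mmap1 (Phi0_var K u d) (T0mon (b n) + lmon n)%MM
    - mmap1 (Phi0_var K u d) (T1mon (b n) + tmon n)%MM.
  by rewrite phiE FE // rmorphB /phi /= !mmapX.
rewrite !mmap1_Phi0.
have ed k : (d * k = u * k + (d - u) * k)%N by rewrite -mulnDl addnC subnK //; lia.
have [c1 c2 c3 c4 c5] := T0monE (b n); have [d1 d2 d3 d4 d5] := T1monE (b n).
have [p1 p2 p3 p4 p5] := lmonE n; have [r1 r2 r3 r4 r5] := tmonE n.
have -> : Zdeg (T0mon (b n) + lmon n) = Zdeg (T1mon (b n) + tmon n).
  rewrite /Zdeg !mnmDE c3 c4 c5 d3 d4 d5 p3 p4 p5 r3 r4 r5.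
  by case: (sigma_side n); lia.
have -> : Tpart u d (T0mon (b n) + lmon n) = Tpart u d (T1mon (b n) + tmon n).
  have [t1 t2] := TpartE u d (T0mon (b n) + lmon n).
  have [t3 t4] := TpartE u d (T1mon (b n) + tmon n).
  apply/mnmP => v; have [->|->] : v = jT0 \/ v = jT1.
  - by case: v => -[|[|//]] hv; [left|right]; apply: val_inj.
  - rewrite t1 t3 !mnmDE c1 c3 c4 d1 d3 d4 p1 p3 p4 r1 r3 r4 !ed.
    by move: hh; case: (sigma_side n) => hh; rewrite !mulnDr; lia.
  - rewrite t2 t4 !mnmDE c2 c4 c5 d2 d4 d5 p2 p4 p5 r2 r4 r5 !ed.
    by move: hh; case: (sigma_side n) => hh; rewrite !mulnDr; lia.
by rewrite subrr.
Qed.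

End Resolution.

Section Exactness.

Variables (K : fieldType) (u d : nat).
Hypothesis hu : (0 < u)%N.
Hypothesis hud : (2 * u < d)%N.
Hypothesis hcop : coprime u d.

Local Notation S := {mpoly K[5]}.
Local Notation q := (q u d).
Local Open Scope ring_scope.

Lemma Phi0_mulmx (w : 'rV[S]_q.+2) : Phi0 K u d ((w *m Phi1 K u d) 0 0) = 0.
Proof.
rewrite phiE mxE rmorph_sum big1 // => i _; rewrite rmorphM mxE -!phiE.
by rewrite (Phi0_F K hu hud hcop) ?mulr0 //; have := ltn_ord i; lia.
Qed.

Lemma Phi0_exact f : Phi0 K u d f = 0 <-> exists v : 'rV_q.+2, v *m Phi1 K u d = f%:M.
Proof.
split=> [h|[v hv]]; last first.
  by have := Phi0_mulmx v; rewrite hv mxE eqxx mulr1n.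
apply: (kernel_image (lex_term_order u d) (lead0 K hu hud hcop)
  (N := fun v : 'rV[S]_1 => Phi0 K u d (v 0 0) = 0)) => /=.
- by move=> v w hv hw; rewrite phiE !mxE rmorphB -!phiE hv hw subrr.
- exact: Phi0_mulmx.
- exact: Phi0_standard_inj.
- by rewrite mxE eqxx mulr1n.
Qed.

Lemma Phi1_exact (v : 'rV_q.+2) :
  v *m Phi1 K u d = 0 <-> exists w : 'rV_(2 * q), w *m Phi2 K u d = v.
Proof.
split=> [h|[w <-]]; last exact: kernel_comp (Phi2_Phi1 K hu hud hcop).
apply: (kernel_image (order_F0_term K hu hud hcop) (lead1 K hu hud hcop)
  (N := fun v => v *m Phi1 K u d = 0)) h => /=.
- exact: kernel_sub.
- move=> w; exact: kernel_comp (Phi2_Phi1 K hu hud hcop).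
- exact: Phi1_standard_inj.
Qed.

Lemma Phi2_exact (v : 'rV_(2 * q)) :
  v *m Phi2 K u d = 0 <-> exists w : 'rV_q.-1, w *m Phi3 K u d = v.
Proof.
split=> [h|[w <-]]; last exact: kernel_comp (Phi3_Phi2 K hu hud hcop).
apply: (kernel_image (order_F1_term K hu hud hcop) (lead2 K hu hud hcop)
  (N := fun v => v *m Phi2 K u d = 0)) h => /=.
- exact: kernel_sub.
- move=> w; exact: kernel_comp (Phi3_Phi2 K hu hud hcop).
- exact: Phi2_standard_inj.
Qed.

Lemma Phi2_kernel_lead v z : ker_Phi2 K u d v -> is_lead (order_F1 K u d) v z ->
  exists j m, z = shift m (nu2 hu hud hcop j).
Proof.
apply: (kernel_lead (order_F1_term K hu hud hcop) (lead2 K hu hud hcop)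
  (N := fun v => v *m Phi2 K u d = 0)) => /=.
- exact: kernel_sub.
- move=> w; exact: kernel_comp (Phi3_Phi2 K hu hud hcop).
- exact: Phi2_standard_inj.
Qed.

Lemma mem_F2 g : (g \in F2 K u d) = [exists j, g == row j (Phi3 K u d)].
Proof.
apply/mapP/existsP => [[n]|[j /eqP ->]].
  rewrite mem_iota => hn ->; have h : (n.-1 < q.-1)%N by lia.
  exists (Ordinal h); rewrite row_Phi3 /= prednK //; lia.
by exists j.+1; rewrite ?row_Phi3 // mem_iota; have := ltn_ord j; lia.
Qed.

Lemma Phi1_bigraded :
  bigraded_map (fun i : 'I_q.+2 => deg_e1 u d i.+1) (fun _ => (0, 0)) (Phi1 K u d).
Proof.
apply: bigraded_mapP => i j; rewrite (ord1 j) (_ : (0, 0) = 0) // subr0.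
by have [] := homog_min_Phi1 K hu hud hcop i.
Qed.

End Exactness.

Theorem theorem2p4 (K : fieldType) (u d : nat)
    (hu : (0 < u)%N) (hud : (2 * u < d)%N) (hcop : coprime u d) :
  minimal_bigraded_free_resolution d (rees (idealI K u d)) (Phi0 K u d)
    (fun i : 'I_(q u d).+2 => deg_e1 u d i.+1) (Phi1 K u d)
    (fun i : 'I_(2 * q u d) => deg_e2 u d (pair_at u d i)) (Phi2 K u d)
    (fun i : 'I_(q u d).-1 => deg_e3 u d i.+1) (Phi3 K u d)
  /\ groebner_basis (order_F1 K u d) (ker_Phi2 K u d) (F2 K u d)
  /\ linearly_independent (fun i : 'I_(q u d).-1 => syz2 K u d i.+1)
  /\ minimal_generators (ker_Phi2 K u d) (F2 K u d).
Proof.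
have hF2 := @mem_F2 K _ _ hu hud hcop.
have ex2 v : ker_Phi2 K u d v <-> exists w, (w *m Phi3 K u d = v)%R.
  exact: (Phi2_exact hu hud hcop).
have inj3 := @Phi3_inj K _ _ hu hud hcop.
split; last split; last split.
- have [g2 m2] := graded_minimal (homog_min_Phi2 K hu hud hcop).
  have [g3 m3] := graded_minimal (homog_min_Phi3 K hu hud hcop).
  have h1 := homog_min_Phi1 K hu hud hcop.
  split=> //.
  + by move=> e f; apply: Phi0_graded; lia.
  + exact: Phi1_bigraded.
  + move=> P; split=> [/rees_in_image[f hf]|[f <-]]; last exact: rees_Phi0.
    by exists f.
  + exact: (Phi0_exact hu hud hcop).
  + exact: (Phi1_exact hu hud hcop).
  + by move=> i j; rewrite (ord1 j); have [] := h1 i.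
- apply: (rows_groebner hF2 ex2 (order_F1_term K hu hud hcop) (lead2 K hu hud hcop)).
  exact: Phi2_kernel_lead.
- move=> c h; apply: (rows_independent inj3); rewrite -[RHS]h.
  by apply: eq_bigr => i _; rewrite row_Phi3.
- exact: (rows_minimal hF2 ex2 inj3).
Qed.
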